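(* Let $p\in[1,+\infty)$ and suppose that $\pi\in\mathcal P_p(\Omega)$. Then a subset $\mathcal K\subset\mathcal P_{\pi,p}(\Omega\times X)$ is relatively compact in the $W_p$-metric if and only if it is fibrely tight and such that, for some (and thus all) $\omega_0\in\Omega$, $$\sup_{\boldsymbol\mu\in\mathcal K}\int_{\{(\omega,x)\,:\,\mathsf d_\Omega(\omega,\omega_0)+\|x\|_X\ge k\}}\|x\|_X^p\,d\boldsymbol\mu(\omega,x)\;\longrightarrow\;0\quad\text{as }k\to+\infty.$$ The latter condition can be equivalently recast as $$\sup_{\boldsymbol\mu\in\mathcal K}\Big(\int_{\{\omega\,:\,\mathsf d_\Omega(\omega,\omega_0)\ge k\}}\mathcal M_p^p(\mu_\omega)\,d\pi(\omega)+\int_{\{(\omega,x)\,:\,\|x\|_X\ge k\}}\|x\|_X^p\,d\boldsymbol\mu(\omega,x)\Big)\;\longrightarrow\;0\quad\text{as }k\to+\infty$$ for some (and thus all) $\omega_0\in\Omega$.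
   Context: $(\Omega,\mathsf d_\Omega)$ is a Polish space, $\pi$ is a probability measure on $\Omega$ and $(\Omega,\mathcal A,\pi)$ is the corresponding complete probability space. $(X,\|\cdot\|_X)$ is a separable Banach space. $\mathcal P_p(\Omega)$ is the set of Borel probability measures on $\Omega$ for which $\int_\Omega \mathsf d_\Omega^p(\omega,\omega_0)\,d\pi(\omega)<+\infty$ for some (hence all) $\omega_0$. $\mathcal P_\pi(\Omega\times X)$ is the set of Borel probability measures $\boldsymbol\mu$ on $\Omega\times X$ whose first marginal is $\pi$. Each such measure has a $\pi$-a.e. uniquely determined Borel disintegration $\{\mu_\omega\}_{\omega\in\Omega}\subset\mathcal P(X)$, written $\boldsymbol\mu=\int_\Omega\mu_\omega\,d\pi(\omega)$. Set $\mathcal M_p(\mu):=(\int_X\|x\|_X^p\,d\mu(x))^{1/p}$ for $\mu \in \mathcal P(X)$. $\mathcal P_{\pi,p}(\Omega\times X)$ is the set of $\boldsymbol\mu\in\mathcal P_\pi(\Omega\times X)$ with $\int_\Omega\mathcal M_p^p(\mu_\omega)\,d\pi(\omega)<+\infty$. $\Omega\times X$ is endowed with the metric $\big(\mathsf d_\Omega^p(\omega,\theta)+\|x-y\|_X^p\big)^{1/p}$, and $W_p$ denotes the classical $p$-Wasserstein distance over $\Omega\times X$ with respect to this metric. A subset $\mathcal K\subset\mathcal P_\pi(\Omega\times X)$ is fibrely tight if for each $\epsilon>0$ there exists a compact set $K_\epsilon\subset X$ such that $\sup_{\boldsymbol\mu\in\mathcal K}\boldsymbol\mu(\Omega\times(X\setminus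 K_\epsilon))<\epsilon$. *)

(* Defs.v *)
From HB Require Import structures.
From mathcomp Require Import all_boot all_order all_algebra.
From mathcomp Require Import all_classical all_reals all_analysis.

Set Implicit Arguments.
Unset Strict Implicit.
Unset Printing Implicit Defensive.

Import Order.TTheory GRing.Theory Num.Theory.
Import numFieldNormedType.Exports.

Local Open Scope classical_set_scope.
Local Open Scope ring_scope.

#[short(type="completeMetricType")]
HB.structure Definition CompleteMetric (R : numDomainType) :=
  {T of Metric R T & Complete T}.

HB.instance Definition _ (T U : ptopologicalType) := Pointed.on (T * U)%type.

Definition separable (T : topologicalType) : Prop :=
  exists2 D : set T, countable D & dense D.

Notation borel T := (g_sigma_algebraType (@open T)).

(* Supremum in [0, +oo] of the nonnegative quantity [F] over [K]: adding 0 only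
   matters when [K] is empty, where [ereal_sup set0 = -oo]. *)
Definition sup_ge0 (R : realType) (I : Type) (K : set I) (F : I -> \bar R) :
    \bar R :=
  ereal_sup (0%E |` [set F i | i in K]).

Section wasserstein.
Context {R : realType} {T : ptopologicalType}.
Implicit Types mu nu : probability (borel T) R.

(* A measure is a function on all subsets, meaningful on measurable ones only;
   equalities of measures are therefore restricted to measurable sets. *)
Definition coupling mu nu : set (probability (borel (T * T)%type) R) :=
  [set gam | forall A : set (borel T), measurable A ->
    gam (fst @^-1` A) = mu A /\ gam (snd @^-1` A) = nu A].

Definition wasserstein (d : T -> T -> R) (p : R) mu nu : \bar R :=
  (ereal_inf [set \int[gam]_z ((d z.1 z.2) `^ p)%:E | gam in coupling mu nu]
    `^ p^-1)%E.

End wasserstein.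

Section moments.
Context {R : realType}.

Definition finite_moment (Om : completeMetricType R) (p : R)
    (pi : probability (borel Om) R) : Prop :=
  exists w0 : Om, (\int[pi]_w ((mdist w w0) `^ p)%:E < +oo)%E.

Definition pnorm_moment (X : completeNormedModType R) (p : R)
    (mu : probability (borel X) R) : \bar R :=
  ((\int[mu]_x (`|x| `^ p)%:E) `^ p^-1)%E.

End moments.

Section fibred.
Context {R : realType} {Om : completeMetricType R}
  {X : completeNormedModType R}.
Variables (pi : probability (borel Om) R) (p : R).
Implicit Type mu : probability (borel (Om * X)%type) R.

Definition first_marginal mu : Prop :=
  forall A : set (borel Om), measurable A -> mu (fst @^-1` A) = pi A.

(* [pprobability] carries the sigma-algebra generated by the evaluations
   [nu |-> nu B], so measurability of [k] is that of every [w |-> k w B]. *)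
Definition is_disintegration mu (k : borel Om -> probability (borel X) R) :
    Prop :=
  measurable_fun setT (k : borel Om -> pprobability (borel X) R) /\
  forall C : set (borel (Om * X)%type), measurable C ->
    mu C = (\int[pi]_w k w (xsection C w))%E.

(* The disintegration exists (Om and X are Polish) and is [pi]-a.e. unique, so
   the choice made by [get] affects none of the integrals against [pi]. *)
Definition disintegration mu : borel Om -> probability (borel X) R :=
  get (is_disintegration mu).

Definition Ppi_p : set (probability (borel (Om * X)%type) R) :=
  [set mu | first_marginal mu /\
    (\int[pi]_w (pnorm_moment p (disintegration mu w) `^ p) < +oo)%E].

Definition prod_dist (z1 z2 : Om * X) : R :=
  ((mdist z1.1 z2.1) `^ p + `|z1.2 - z2.2| `^ p) `^ p^-1.

Definition Wp mu nu : \bar R := wasserstein prod_dist p mu nu.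

Definition fibrely_tight (K : set (probability (borel (Om * X)%type) R)) :
    Prop :=
  forall eps : R, 0 < eps -> exists2 Ke : set X, compact Ke &
    (sup_ge0 K (fun mu => mu ([set: Om] `*` ~` Ke)) < eps%:E)%E.

Definition unif_integrable (K : set (probability (borel (Om * X)%type) R))
    (w0 : Om) : Prop :=
  sup_ge0 K (fun mu =>
    \int[mu]_(z in [set z : Om * X | (k <= mdist z.1 w0 + `|z.2|)%R])
      (`|z.2| `^ p)%:E)%E @[k --> +oo%R] --> 0%E.

Definition unif_integrable_split
    (K : set (probability (borel (Om * X)%type) R)) (w0 : Om) : Prop :=
  sup_ge0 K (fun mu =>
    \int[pi]_(w in [set w : Om | (k <= mdist w w0)%R])
      (pnorm_moment p (disintegration mu w) `^ p)
    + \int[mu]_(z in [set z : Om * X | (k <= `|z.2|)%R]) (`|z.2| `^ p)%:E)%E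
  @[k --> +oo%R] --> 0%E.

(* Declaring a set open when it contains a [Wp]-ball around each of its points
   gives the metric topology without first proving that [Wp] is a metric.
   Elements of [Ppi_p_space] agreeing on Borel sets but differing elsewhere are
   topologically indistinguishable. *)
Definition Ppi_p_space : Type := set_type Ppi_p.

HB.instance Definition _ := Choice.on Ppi_p_space.

Definition Wp_open : set_system Ppi_p_space :=
  [set U | forall mu : Ppi_p_space, U mu -> exists2 eps : R, 0 < eps &
    [set nu : Ppi_p_space | (Wp (\val mu) (\val nu) < eps%:E)%E] `<=` U].

Let Wp_openT : Wp_open setT.
Proof. by move=> mu _; exists 1. Qed.

Let Wp_openI : setI_closed Wp_open.
Proof.
move=> U V oU oV mu [/oU[e e0 eU] /oV[f f0 fV]].
exists (Num.min e f); first by rewrite lt_min e0.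
move=> nu /= h; split; [apply: eU|apply: fV];
  by apply: (lt_le_trans h); rewrite lee_fin ge_min lexx ?orbT.
Qed.

Let Wp_open_bigU (I : Type) (f : I -> set Ppi_p_space) :
  (forall i, Wp_open (f i)) -> Wp_open (\bigcup_i f i).
Proof.
move=> of_ mu [i _ /(of_ i)[e e0 ef]]; exists e => // nu /ef fnu.
by exists i.
Qed.

HB.instance Definition _ :=
  isOpenTopological.Build Ppi_p_space Wp_openT Wp_openI Wp_open_bigU.

End fibred.

Arguments Ppi_p {R Om X} pi p.
Arguments Ppi_p_space {R Om} X pi p.

(* Closure and compactness are taken in [Ppi_p_space], i.e. for [Wp]. *)
Definition Wp_relatively_compact {R : realType} {Om : completeMetricType R}
    {X : completeNormedModType R} (pi : probability (borel Om) R) (p : R)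
    (K : set (probability (borel (Om * X)%type) R)) : Prop :=
  compact (closure [set mu : Ppi_p_space X pi p | K (\val mu)]).

(* Main.v *)
(* Points of a separable complete metric space are coded by sequences of
   integers, and every law on it is the image of the uniform law on [0, 1) under
   a map read off the masses of the coding cells.  Convergence of these masses
   yields almost sure convergence of the maps (Skorokhod's representation).
   The same coding, through densities of the slices, provides disintegrations,
   which turn the fibred moments into integrals against [mu].

   Integrals of [f `^ p], for [f] nonnegative and 1-Lipschitz, are controlled by
   [Wp].  If the closure of [K] is compact, Dini's argument makes the decreasing
   functions "truncated distance to finitely many points of X" and "excess of
   [max(d(w, w0), |x|)] over [k]" uniformly small in mean, whence tightness and
   uniform integrability.  Conversely these two bounds pass to the closure of
   [K]; tightness gives a limit law along any ultrafilter, and the almost surely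
   convergent representation, with the excess bound, converges for [Wp]. *)
From HB Require Import structures.
Require Import Defs.
From mathcomp Require Import all_boot all_order all_algebra.
From mathcomp Require Import all_classical all_reals all_analysis.
From mathcomp Require Import measurable_realfun lra.
Import Order.TTheory GRing.Theory Num.Theory.
Import numFieldNormedType.Exports.
Local Open Scope classical_set_scope.
Local Open Scope ring_scope.
Set Implicit Arguments.
Unset Strict Implicit.
Unset Printing Implicit Defensive.

(** * Coding of laws by the unit interval *)

(** Cells are neither open nor closed, so convergence of their masses along an ultrafilter has no
    direct link with the topology. The limit law is defined as the image of the uniform law under
    [decode] after [code m], where [m] collects the limit masses; it need not give mass [m r] to the
    cell of [r]. What survives is the continuity of [decode], which turns letters that are
    eventually constant into points that converge.

    Almost sure convergence, Fatou's lemma and dominated convergence speak of sequences, whereas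
    compactness is tested on ultrafilters. As words are countably many, a sequence with the same
    limit masses can be picked inside any set of the ultrafilter, and the limit law, read off [m],
    does not depend on that sequence.

    Tightness and uniform integrability are stated with indicators, which [Wp] does not control.
    Each is traded for a bound on [Np] of a 1-Lipschitz function, a truncated distance or [excess],
    since this form passes to the closure; tightness is recovered there by Markov's inequality. *)

Fixpoint prefix (c : nat -> nat) (n : nat) : seq nat :=
  if n is n'.+1 then c n' :: prefix c n' else [::].

(** Words list the latest letter first: refining a cell is a [cons], and recursions over cells are
    structural. *)
Definition cylinder (r : seq nat) : set (nat -> nat) :=
  [set c | prefix c (size r) = r].

(** Cylinders are nested or disjoint, so adding the empty set makes the family stable under
    intersection. *)
Definition cylinders : set (set (nat -> nat)) :=
  [set C | C = set0 \/ exists r, C = cylinder r].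

Notation baire := (g_sigma_algebraType cylinders).

Lemma size_prefix c n : size (prefix c n) = n.
Proof. by elim: n => //= n ->. Qed.

Lemma drop_prefix c k n : (k <= n)%N -> drop (n - k) (prefix c n) = prefix c k.
Proof.
elim: n => [|n IHn]; first by rewrite leqn0 => /eqP ->.
rewrite leq_eqVlt => /predU1P[->|]; first by rewrite subnn drop0.
by rewrite ltnS => kn; rewrite subSn//= IHn.
Qed.

Lemma cylinderT : cylinder [::] = setT.
Proof. by apply/seteqP; split. Qed.

Lemma cylinder_drop r r' : (size r <= size r')%N ->
  cylinder r `&` cylinder r' =
  if drop (size r' - size r) r' == r then cylinder r' else set0.
Proof.
move=> rr'; case: eqP => E.
  apply/seteqP; split => [c []//|c cr']; split=> //; rewrite /cylinder/=.
  by rewrite -(drop_prefix c rr') cr'.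
by apply/seteqP; split => // c [cr cr']; apply: E; rewrite -{2}cr'/= drop_prefix.
Qed.

Lemma cylindersI : setI_closed cylinders.
Proof.
move=> A B [->|[r ->]]; first by move=> _; rewrite set0I; left.
move=> [->|[r' ->]]; first by rewrite setI0; left.
have [rr'|/ltnW rr'] := leqP (size r) (size r').
  by rewrite cylinder_drop//; case: ifP; [right; exists r'|left].
by rewrite setIC cylinder_drop//; case: ifP; [right; exists r|left].
Qed.

Lemma measurable_cylinder r : measurable (cylinder r : set baire).
Proof. by apply: sub_sigma_algebra; right; exists r. Qed.

Lemma baire_measure_unique (R : realType) (m1 m2 : probability baire R) :
  (forall r, m1 (cylinder r) = m2 (cylinder r)) ->
  forall A, measurable A -> m1 A = m2 A.
Proof.
move=> E A mA; apply: (@measure_unique _ R baire cylinders (fun=> cylinder [::])) => //.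
- exact: cylindersI.
- by move=> _; right; exists [::].
- by rewrite bigcup_const//; exact: cylinderT.
- by move=> B [->|[r ->]]; [rewrite !measure0|exact: E].
- by move=> _; apply: le_lt_trans (probability_le1 m1 (measurable_cylinder _)) _; rewrite ltry.
Qed.

Section interval_coding.
Context {R : realType}.
Implicit Types (m : seq nat -> R) (r : seq nat) (t : R).

(** Consistent masses on the tree of words; [unif_code] realises each such family as the cylinder
    masses of a law on [baire]. *)
Definition mass m := [/\ m [::] = 1, forall r, 0 <= m r &
  forall r, series (fun i => m (i :: r)) @ \oo --> m r].

(** Left end of the subinterval of [0, 1) of length [m r] assigned to [r]: the children of a word
    are laid side by side, starting at the left end of their parent. *)
Fixpoint lft m r : R :=
  if r is i :: r' then lft m r' + series (fun j => m (j :: r')) i else 0.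

Definition cell_itv m r : set R := [set t | lft m r <= t < lft m r + m r].

(** As [lft m (i.+1 :: r)] is the right end of child [i], the minimum selects the child containing
    [t] and skips children of length 0. The default 0 is not met inside the cell of [r], by
    [nextP]. *)
Definition next m t r : nat :=
  match pselect (exists i, t < lft m (i.+1 :: r)) with
  | left h => ex_minn h
  | right _ => 0%N
  end.

Fixpoint path m t n : seq nat :=
  if n is n'.+1 then next m t (path m t n') :: path m t n' else [::].

(* The uniform law does not charge the complement of [[0, 1)]; clipping makes
   the code measurable on the whole line. *)
Definition clip t : R := if (0 <= t) && (t < 1) then t else 0.

Definition code m t (n : nat) : nat := next m (clip t) (path m (clip t) n).

Lemma prefix_code m t n : prefix (code m t) n = path m (clip t) n.
Proof. by elim: n => //= n ->. Qed.

Lemma size_path m t n : size (path m t n) = n.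
Proof. by elim: n => //= n ->. Qed.

Lemma lftS m i r : lft m (i.+1 :: r) = lft m (i :: r) + m (i :: r).
Proof. by rewrite /= seriesSr addrA. Qed.

Lemma le_lft m r i j : (forall r, 0 <= m r) -> (i <= j)%N ->
  lft m (i :: r) <= lft m (j :: r).
Proof.
move=> m0 /subnK <-; elim: (j - i)%N => // k IH.
by rewrite addSn lftS (le_trans IH)// lerDl.
Qed.

Lemma lft_le_mass m r i : mass m -> lft m (i :: r) <= lft m r + m r.
Proof.
move=> [_ m0 ms]; rewrite /= lerD2l; have /cvg_lim <- // := ms r.
apply: nondecreasing_cvgn_le; first exact: nondecreasing_series.
by apply/cvg_ex; exists (m r); exact: ms.
Qed.

Lemma cell_itv_cons m i r : mass m -> cell_itv m (i :: r) `<=` cell_itv m r.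
Proof.
move=> mm t /andP[it ti]; have [_ m0 _] := mm; apply/andP; split.
  by apply: le_trans it; rewrite /= lerDl sumr_ge0.
by apply: lt_le_trans ti _; rewrite -lftS; exact: lft_le_mass.
Qed.

Lemma cell_itv_sub m r : mass m -> cell_itv m r `<=` [set t | 0 <= t < 1].
Proof.
move=> mm; elim: r => [|i r IH]; last exact: subset_trans (cell_itv_cons mm) IH.
by rewrite /cell_itv /=; case: mm => -> _ _; rewrite add0r.
Qed.

Lemma nextP m t r : mass m -> cell_itv m r t ->
  cell_itv m (next m t r :: r) t.
Proof.
move=> [m1 m0 ms] /andP[rt tr]; rewrite /next; case: pselect => [h|]; last first.
  (* If [t] were at or beyond the right end of every child, it would be at or beyond their limit,
     the right end of the parent. *)
  move=> h; exfalso; apply: h; apply/not_existsP => h.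
  move: tr; rewrite ltNge => /negP; apply.
  rewrite -lerBrDl; have /cvg_lim <- // := ms r.
  apply: limr_le; first by apply/cvg_ex; exists (m r); exact: ms.
  near=> n; rewrite lerBrDl.
  have n0 : (0 < n)%N by near: n; exact: nbhs_infty_gt.
  have := h n.-1; rewrite prednK//= => /negP; by rewrite -leNgt.
case: ex_minnP => i ti min_i; apply/andP; split; last by rewrite -lftS.
case: i ti min_i => [|i] ti min_i; first by rewrite /= /series/= big_geq// addr0.
by rewrite leNgt; apply/negP => /min_i; rewrite ltnn.
Unshelve. all: end_near. Qed.

Lemma next_eq m t i r : mass m -> cell_itv m (i :: r) t -> next m t r = i.
Proof.
move=> [m1 m0 ms] /andP[it ti]; rewrite -lftS in ti.
rewrite /next; case: pselect => [h|[]]; last by exists i.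
case: ex_minnP => j tj /(_ _ ti) ji; apply/eqP; rewrite eqn_leq ji/= leqNgt.
apply/negP => ij; have := le_lt_trans it tj; rewrite ltNge => /negP; apply.
exact: le_lft.
Qed.

Lemma path_cell m t n : mass m -> 0 <= t < 1 -> cell_itv m (path m t n) t.
Proof.
move=> mm t01; elim: n => [|n IH]; last exact: nextP.
by rewrite /cell_itv/=; case: mm => -> _ _; rewrite add0r.
Qed.

Lemma cell_path m t r : mass m -> cell_itv m r t -> path m t (size r) = r.
Proof.
move=> mm; elim: r => //= i r IH irt.
by rewrite IH//; [rewrite (next_eq mm irt)|exact: cell_itv_cons irt].
Qed.

Lemma clip01 t : 0 <= clip t < 1.
Proof. by rewrite /clip; case: ifP => // _; rewrite lexx ltr01. Qed.

Lemma code_cylinder m r : mass m ->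
  code m @^-1` cylinder r = clip @^-1` cell_itv m r.
Proof.
move=> mm; apply/seteqP; split => t; rewrite /cylinder/= prefix_code.
  by move=> <-; apply: path_cell => //; exact: clip01.
exact: cell_path.
Qed.

Lemma measurable_clip : measurable_fun setT (clip : measurableTypeR R -> measurableTypeR R).
Proof.
apply: measurable_fun_ifT => //.
by apply: measurable_and; [exact: measurable_fun_ler|exact: measurable_fun_ltr].
Qed.

Lemma cell_itvE m r : cell_itv m r = `[lft m r, lft m r + m r[%classic.
Proof. by apply/seteqP; split => t; rewrite /= in_itv. Qed.

Lemma measurable_code m : mass m ->
  measurable_fun setT (code m : measurableTypeR R -> baire).
Proof.
move=> mm; apply: (@measurability _ _ _ baire _ _ cylinders) => // _ [_ [->|[r ->]] <-].
  by rewrite preimage_set0 setI0.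
rewrite setTI code_cylinder// -[X in measurable X]setTI.
by apply: measurable_clip => //; rewrite cell_itvE; exact: measurable_itv.
Qed.

Definition unif : probability (measurableTypeR R) R := uniform_prob (@ltr01 R).

Lemma measurable_I01 : measurable [set t : R | 0 <= t < 1].
Proof.
by rewrite (_ : mkset _ = `[0, 1[%classic).
Qed.

Lemma unif_null (A : set R) : A `&` [set t | 0 <= t < 1] = set0 -> unif A = 0%E.
Proof.
move=> A0; rewrite /unif /= /uniform_prob integral_uniform_pdf.
(* The density is supported by the closed interval [0, 1], so the point 1 may be left over. *)
apply: (integral_Sset1 1) => t [At /=]; rewrite in_itv/= => /andP[t0 t1].
apply/eqP; rewrite eq_le t1/= leNgt; apply/negP => t1'.
have : (A `&` [set t | 0 <= t < 1]) t by split => //=; rewrite t0.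
by rewrite A0.
Qed.

Lemma unif_countable (A : set R) : countable A -> unif A = 0%E.
Proof.
move=> cA; have mA : measurable A by exact: countable_measurable.
have /null_content_dominatesP := @dominates_uniform_prob R 0 1 ltr01.
by apply => //; exact: countable_lebesgue_measure0.
Qed.

Lemma unif_itv (a b : R) : 0 <= a -> a <= b -> b <= 1 ->
  unif `[a, b[%classic = (b - a)%:E.
Proof.
move=> a0 ab b1; rewrite /unif /= /uniform_prob integral_uniform_pdf.
rewrite setIidl; last first.
  move=> t /=; rewrite !in_itv/= => /andP[? ?]; apply/andP; split; lra.
rewrite (eq_integral (cst 1%E)); last first.
  move=> t; rewrite inE/= in_itv/= => /andP[? ?]; rewrite /uniform_pdf subr0 invr1.
  by case: ifPn => // /negP[]; apply/andP; split; lra.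
rewrite integral_cst//= mul1e lebesgue_measure_itv/= lte_fin.
by case: ltgtP ab => // -> _; rewrite subrr.
Qed.

Lemma unif_code m r : mass m -> unif (code m @^-1` cylinder r) = (m r)%:E.
Proof.
move=> mm; have mcyl : measurable (code m @^-1` cylinder r).
  rewrite -[X in measurable X]setTI; apply: measurable_code => //.
  exact: measurable_cylinder.
have [_ m0 _] := mm.
rewrite (measureDI unif mcyl measurable_I01).
rewrite [X in (X + _)%E]unif_null ?add0e; last first.
  by rewrite setDE -setIA (setIC (~` _)) setICr setI0.
rewrite (_ : _ `&` _ = `[lft m r, lft m r + m r[%classic).
  have sub := cell_itv_sub (r := r) mm.
  (* An empty cell says nothing about the position of its left end, so mass 0 is treated apart. *)
  have [mr0|mr0] := eqVneq (m r) 0.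
    by rewrite mr0 addr0 set_itvco0 measure0.
  have mr : 0 < m r by rewrite lt0r mr0 m0.
  have /andP[l0 _] : 0 <= lft m r < 1.
    by apply: sub; rewrite /cell_itv/= lexx ltrDl.
  rewrite -[in RHS](addKr (lft m r) (m r)) [in RHS]addrC.
  apply: unif_itv => //; first by rewrite lerDl.
  rewrite leNgt; apply/negP => h.
  (* If the right end were beyond 1, this point would belong to the cell, although cells lie below
     1. *)
  have /andP[_] : 0 <= Num.max 1 (lft m r) < 1.
    apply: sub; rewrite /cell_itv/= le_max lexx orbT/= gt_max h/=.
    by rewrite ltrDl.
  by rewrite gt_max ltxx.
rewrite -cell_itvE code_cylinder//; apply/seteqP; split => t.
  by move=> [/=]; rewrite /clip => + t01; rewrite t01.
move=> rt; have t01 := cell_itv_sub mm rt.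
by split => //=; rewrite /clip t01.
Qed.

Lemma cvg_lft (m_ : nat -> seq nat -> R) m r :
  (forall r, m_ n r @[n --> \oo] --> m r) -> lft (m_ n) r @[n --> \oo] --> lft m r.
Proof.
move=> mcvg; elim: r => /= [|i r IH]; first exact: cvg_cst.
apply: cvgD => //; elim: i => [|i IHi].
  have s0 (f : nat -> R) : series f 0%N = 0 by rewrite seriesEnat/= big_geq.
  by rewrite s0; under eq_fun do rewrite s0; exact: cvg_cst.
rewrite seriesSr; under eq_fun do rewrite seriesSr.
exact: cvgD.
Qed.

(* Skorokhod's device: off the countably many end points of the limit intervals
   each coordinate of the code is eventually constant. *)
Lemma code_cvg (m_ : nat -> seq nat -> R) m :
  (forall n, mass (m_ n)) -> mass m -> (forall r, m_ n r @[n --> \oo] --> m r) ->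
  exists2 E : set R, measurable E /\ unif E = 0%E &
    forall t, ~ E t -> forall k, \forall n \near \oo,
      prefix (code (m_ n) t) k = prefix (code m t) k.
Proof.
move=> mm_ mm mcvg; exists (~` [set t | 0 <= t < 1] `|` range (lft m)).
  have mC : measurable (~` [set t : R | 0 <= t < 1]).
    by apply: measurableC; exact: measurable_I01.
  have cr : countable (range (lft m)) by apply: sub_countable (card_image_le _ _) _; exact: countableP.
  have mr : measurable (range (lft m)) by exact: countable_measurable.
  split; first exact: measurableU.
  apply: null_set_setU => //; last exact: unif_countable.
  by apply: unif_null; rewrite setICl.
move=> t /not_orP[/contrapT t01 rt] k.
have ct : clip t = t by rewrite /clip t01.
have /andP[lt tl] := path_cell k mm t01.
set r := path m t k in lt tl.
have {}lt : lft m r < t.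
  by rewrite lt_neqAle lt andbT; apply: contra_notN rt => /eqP <-; exists r.
have c1 : lft (m_ n) r @[n --> \oo] --> lft m r by exact: cvg_lft.
have c2 : lft (m_ n) r + m_ n r @[n --> \oo] --> lft m r + m r by exact: cvgD.
near=> n.
rewrite !prefix_code ct -/r -{1}(size_path m t k); apply: cell_path => //.
apply/andP; split.
  by apply/ltW; near: n; exact: (cvgr_lt _ c1).
by near: n; exact: (cvgr_gt _ c2).
Unshelve. all: end_near. Qed.

End interval_coding.

(** * Polish distances and the coding of points by integer sequences *)

Section polish_dist.
Context {R : realType}.

(** A common interface for [Om], [X] and their products, in which [D] only has to induce the
    topology. Completeness is asked in the form in which codes produce sequences: the constant 3
    leaves room for two points within 2^-n and 2^-(n+1) of a common point. *)
Record polish_dist (T : ptopologicalType) (D : T -> T -> R) (q : nat -> T) :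
    Prop := {
  pd_refl : forall x, D x x = 0 ;
  pd_pos : forall x y, D x y = 0 -> x = y ;
  pd_sym : forall x y, D x y = D y x ;
  pd_tri : forall y x z, D x z <= D x y + D y z ;
  pd_nbhs : forall x (U : set T),
    nbhs x U <-> exists2 e, 0 < e & [set y | D x y < e] `<=` U ;
  pd_complete : forall u : nat -> T,
    (forall n, D (u n) (u n.+1) <= 3 * 2^-1 ^+ n) ->
    exists l, D (u n) l @[n --> \oo] --> 0 ;
  pd_dense : forall x e, 0 < e -> exists i, D x (q i) < e }.

Lemma expr_half_gt0 n : 0 < 2^-1 ^+ n :> R.
Proof. by rewrite exprn_gt0// invr_gt0. Qed.

Lemma expr_half_lt (C e : R) : 0 < e -> \forall n \near \oo, C * 2^-1 ^+ n < e.
Proof.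
move=> e0; have : C * 2^-1 ^+ n @[n --> \oo] --> C * 0.
  apply: cvgMr; apply: cvg_expr; rewrite ger0_norm ?invr_ge0// invf_lt1//.
  by rewrite ltr1n.
by rewrite mulr0 => /cvgr_lt; apply.
Qed.

(** The bound is the exact sum of the steps 3 * 2^-j for n <= j < n + k. *)
Lemma geometric_dist (T : Type) (D : T -> T -> R) (u : nat -> T) :
  (forall x, D x x = 0) -> (forall y x z, D x z <= D x y + D y z) ->
  (forall n, D (u n) (u n.+1) <= 3 * 2^-1 ^+ n) ->
  forall n k, D (u n) (u (n + k)%N) <= 6 * 2^-1 ^+ n * (1 - 2^-1 ^+ k).
Proof.
move=> D0 Dtri hu n; elim=> [|k IH]; first by rewrite addn0 D0 expr0 subrr mulr0.
rewrite addnS; apply: le_trans (Dtri (u (n + k)%N) _ _) _.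
apply: le_trans (lerD IH (hu (n + k)%N)) _.
by rewrite exprD exprS; lra.
Qed.

Lemma measurable_borel (T : ptopologicalType) (U : set T) :
  open U -> measurable (U : set (borel T)).
Proof. exact: sub_sigma_algebra. Qed.

Lemma measurable_borel_closed (T : ptopologicalType) (U : set T) :
  closed U -> measurable (U : set (borel T)).
Proof.
move=> cU; rewrite -(setCK U); apply: measurableC.
by apply: measurable_borel; rewrite openC.
Qed.

Lemma continuous_borel_measurable (T U : ptopologicalType) (f : T -> U) :
  continuous f -> measurable_fun setT (f : borel T -> borel U).
Proof.
move=> /continuousP cf; apply: (@measurability _ _ _ (borel U) _ _ open) => //.
by move=> _ [B oB <-]; rewrite setTI; apply: measurable_borel; exact: cf.
Qed.

Lemma continuous_real_measurable (T : ptopologicalType) (f : T -> R) :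
  continuous f -> measurable_fun setT (f : borel T -> measurableTypeR R).
Proof.
move=> /continuousP cf; apply: (measurability _ (RGenOpens.measurableE R)) => //.
move=> _ [_ [a [b ->]] <-]; rewrite setTI; apply: measurable_borel; apply: cf.
exact: interval_open.
Qed.

Section theory.
Context {T : ptopologicalType} {D : T -> T -> R} {q : nat -> T}.
Hypothesis pD : polish_dist D q.

Lemma pd_ge0 x y : 0 <= D x y.
Proof.
have := pd_tri pD y x x; rewrite (pd_refl pD) (pd_sym pD y x).
by rewrite -mulr2n pmulrn_lge0.
Qed.

Lemma pd_open_ball x e : open [set y | D x y < e].
Proof.
rewrite openE => y /= xy; apply/(pd_nbhs pD); exists (e - D x y).
  by rewrite subr_gt0.
by move=> z /=; rewrite ltrBrDl; apply: le_lt_trans; exact: (pd_tri pD).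
Qed.

Lemma pd_ballP (U : set T) x :
  open U -> U x -> exists2 e, 0 < e & [set y | D x y < e] `<=` U.
Proof. by move=> oU Ux; apply/(pd_nbhs pD); exact: open_nbhs_nbhs. Qed.

Lemma pd_lipschitz_continuous (f : T -> R) C :
  (forall x y, `|f x - f y| <= C * D x y) -> continuous f.
Proof.
move=> fC x; apply/cvgrPdist_lt => e e0; apply/(pd_nbhs pD).
have C1 : 0 < `|C| + 1 by rewrite ltr_wpDl.
exists (e / (`|C| + 1)); first by rewrite divr_gt0.
move=> y /=; rewrite ltr_pdivlMr// => xy; apply: le_lt_trans (fC x y) _.
apply: le_lt_trans xy; rewrite mulrC ler_wpM2l ?pd_ge0//.
by rewrite (le_trans (ler_norm _))// lerDl.
Qed.

(** Taking the least index makes the coding measurable: each level set is an open ball minus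
    finitely many open balls. *)
Definition kappa n z : nat :=
  ex_minn (pd_dense pD z (expr_half_gt0 n)).

Definition encode z : nat -> nat := fun n => kappa n z.

Lemma kappaP n z : D z (q (kappa n z)) < 2^-1 ^+ n.
Proof. by rewrite /kappa; case: ex_minnP. Qed.

Lemma kappa_le n z i : D z (q i) < 2^-1 ^+ n -> (kappa n z <= i)%N.
Proof. by rewrite /kappa; case: ex_minnP => j _; apply. Qed.

Lemma measurable_kappa n i : measurable ([set z | kappa n z = i] : set (borel T)).
Proof.
rewrite (_ : mkset _ = [set z | D (q i) z < 2^-1 ^+ n] `\`
    \bigcup_(j in `I_i) [set z | D (q j) z < 2^-1 ^+ n]).
  apply: measurableD; first by apply: measurable_borel; exact: pd_open_ball.
  apply: bigcup_measurable => j _; apply: measurable_borel.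
  exact: pd_open_ball.
apply/seteqP; split => z /=.
  move=> <-; split; first by rewrite (pd_sym pD); exact: kappaP.
  move=> -[j /= ji]; rewrite (pd_sym pD) => /kappa_le.
  by rewrite leqNgt ji.
rewrite (pd_sym pD) => -[/kappa_le ki h].
apply/eqP; rewrite eqn_leq ki/= leqNgt; apply/negP => ik; apply: h.
by exists (kappa n z) => //=; rewrite (pd_sym pD); exact: kappaP.
Qed.

Lemma measurable_encode : measurable_fun setT (encode : borel T -> baire).
Proof.
apply: (@measurability _ _ _ baire _ _ cylinders) => // _ [_ [->|[r ->]] <-].
  by rewrite preimage_set0 setI0.
rewrite setTI; elim: r => [|i r IH].
  by rewrite cylinderT preimage_setT.
rewrite (_ : _ @^-1` _ = [set z | kappa (size r) z = i] `&`
    encode @^-1` cylinder r).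
  by apply: measurableI => //; exact: measurable_kappa.
by apply/seteqP; split => z; rewrite /cylinder/= => -[]; rewrite /encode => -> ->.
Qed.

(* Jumps that are too long to occur along the code of a point are skipped, so
   that [approx c] is Cauchy for every [c]. *)
Fixpoint approx (c : nat -> nat) n : T :=
  if n is n'.+1 then
    if D (approx c n') (q (c n)) <= 3 * 2^-1 ^+ n' then q (c n)
    else approx c n'
  else q (c 0%N).

Lemma approx_cauchy c n : D (approx c n) (approx c n.+1) <= 3 * 2^-1 ^+ n.
Proof.
by rewrite /=; case: ifPn => // _; rewrite (pd_refl pD) mulr_ge0.
Qed.

Definition decode (c : nat -> nat) : T :=
  get [set l | D (approx c n) l @[n --> \oo] --> 0].

Lemma decodeP c : D (approx c n) (decode c) @[n --> \oo] --> 0.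
Proof.
rewrite /decode; case: xgetP => [l _ //|h].
have [l hl] := pd_complete pD (approx_cauchy c).
by have := h l hl.
Qed.

Lemma approx_dist c n k :
  D (approx c n) (approx c (n + k)) <= 6 * 2^-1 ^+ n * (1 - 2^-1 ^+ k).
Proof.
exact: (geometric_dist (u := approx c) (pd_refl pD) (pd_tri pD)
  (approx_cauchy c)).
Qed.

Lemma approx_decode c n : D (approx c n) (decode c) <= 6 * 2^-1 ^+ n.
Proof.
apply/ler_addgt0Pr => e e0.
have /cvgrPdist_lt/(_ e e0)[N _ hN] := decodeP c.
have := hN (n + N)%N (leq_addl _ _); rewrite sub0r normrN ger0_norm ?pd_ge0// => h.
apply: le_trans (pd_tri pD (approx c (n + N)) _ _) _; apply: lerD (ltW h).
by apply: le_trans (approx_dist c n N) _; rewrite ler_piMr// mulr_ge0.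
Qed.

Lemma approx_prefix c c' n : prefix c n.+1 = prefix c' n.+1 ->
  approx c n = approx c' n.
Proof.
elim: n => [|n IH]; first by move=> /= [->].
by move=> [E1 E2 E3]; rewrite /= E1 IH//= E2 E3.
Qed.

(** [approx c n] reads the letters 0 to n, so both codes share it, and each decoded point is within
    6 * 2^-n of it. This continuity of [decode] is what turns convergence of codes into convergence
    of points. *)
Lemma decode_prefix c c' n : prefix c n.+1 = prefix c' n.+1 ->
  D (decode c) (decode c') <= 12 * 2^-1 ^+ n.
Proof.
move=> /approx_prefix E; apply: le_trans (pd_tri pD (approx c n) _ _) _.
have := approx_decode c n; have := approx_decode c' n.
by rewrite -E (pd_sym pD (decode c)); lra.
Qed.

(** Along the code of a point no jump is skipped: consecutive centres are within 2^-n and 2^-(n+1)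
    of [z], hence less than 3 * 2^-n apart. *)
Lemma approx_encode z n : approx (encode z) n = q (kappa n z).
Proof.
elim: n => //= n ->; rewrite /encode; case: ifPn => // /negP[].
apply: le_trans (pd_tri pD z _ _) _; rewrite (pd_sym pD (q _)).
have := kappaP n z; have := kappaP n.+1 z; rewrite exprS.
by have := expr_half_gt0 n; lra.
Qed.

Lemma encodeK z : decode (encode z) = z.
Proof.
apply: (pd_pos pD); apply/eqP; rewrite eq_le pd_ge0 andbT.
apply/ler_addgt0Pr => e e0; rewrite add0r.
(* 7 = 6 + 1: the error of [approx_decode] plus that of [kappaP]. *)
have [N _ hN] := expr_half_lt 7 e0; have := hN N (leqnn _).
have := approx_decode (encode z) N; rewrite approx_encode (pd_sym pD (decode _)).
have := pd_tri pD (q (kappa N z)) z (decode (encode z)).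
by have := kappaP N z; rewrite (pd_sym pD z (decode _)); lra.
Qed.

(** The limit lies in an open [U] iff, for some [k], the points [f_ n t] eventually have their ball
    of radius 2^-k inside [U]. The hypothesis on arbitrary sets [B] fits the maps [approx], which
    are determined by finitely many letters. *)
Lemma measurable_fun_limit d (S : measurableType d) (f_ : nat -> S -> T)
    (f : S -> T) :
  (forall n (B : set T), measurable (f_ n @^-1` B)) ->
  (forall t, D (f_ n t) (f t) @[n --> \oo] --> 0) ->
  measurable_fun setT (f : S -> borel T).
Proof.
move=> mf_ cf; apply: (@measurability _ _ _ (borel T) _ _ open) => //.
move=> _ [U oU <-]; rewrite setTI.
pose V k := [set y | [set z | D y z < 2^-1 ^+ k] `<=` U].
rewrite (_ : _ @^-1` _ = \bigcup_k \bigcup_N \bigcap_n f_ (n + N)%N @^-1` V k).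
  apply: bigcupT_measurable => k; apply: bigcupT_measurable => N.
  by apply: bigcapT_measurable => n; exact: mf_.
apply/seteqP; split => [t Uft|t [k _ [N _ h]]].
  have [e e0 eU] := pd_ballP oU Uft.
  have [k _ hk] := expr_half_lt 2 e0.
  exists k => //; have /cvgrPdist_lt/(_ _ (expr_half_gt0 k))[N _ hN] := cf t.
  exists N => // n _ z /= h; apply: eU => /=; have /= hk' := hk k (leqnn _).
  have := hN (n + N)%N (leq_addl _ _).
  rewrite /= sub0r normrN ger0_norm ?pd_ge0// => h'.
  apply: le_lt_trans (pd_tri pD (f_ (n + N)%N t) _ _) _.
  by rewrite (pd_sym pD (f t)); lra.
have /cvgrPdist_lt/(_ _ (expr_half_gt0 k))[M _ hM] := cf t.
apply: (h M) => //=; have := hM (M + N)%N (leq_addr _ _).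
by rewrite /= sub0r normrN ger0_norm ?pd_ge0.
Qed.

Lemma measurable_decode : measurable_fun setT (decode : baire -> borel T).
Proof.
apply: (@measurable_fun_limit _ baire (fun n c => approx c n)); last exact: decodeP.
move=> n B; rewrite (_ : _ @^-1` _ = \bigcup_r
  (if `[< size r = n.+1 /\ exists2 c, prefix c n.+1 = r & B (approx c n) >]
   then cylinder r else set0)).
  apply: countable_bigcupT_measurable => // r.
  by case: ifPn => // _; exact: measurable_cylinder.
apply/seteqP; split => [c Bc|c [r _]].
  exists (prefix c n.+1) => //; case: ifPn => [_|/asboolP[]].
    by rewrite /cylinder/= size_prefix.
  by rewrite size_prefix; split => //; exists c.
case: ifPn => // /asboolP[rn [c' c'r Bc']]; rewrite /cylinder/= rn -c'r.
by move=> /approx_prefix ->.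
Qed.

End theory.

Lemma polish_dist_prod (T U : ptopologicalType) D1 D2 q1 q2 :
  @polish_dist T D1 q1 -> @polish_dist U D2 q2 ->
  exists q, @polish_dist (T * U)%type (fun x y => D1 x.1 y.1 + D2 x.2 y.2) q.
Proof.
move=> p1 p2; pose q n := let ij := odflt (0%N, 0%N) (unpickle n) in (q1 ij.1, q2 ij.2).
exists q; split => /=.
- by move=> x; rewrite (pd_refl p1) (pd_refl p2) addr0.
- move=> [x x'] [y y'] /= /eqP; rewrite paddr_eq0 ?(pd_ge0 p1) ?(pd_ge0 p2)//.
  by move=> /andP[/eqP/(pd_pos p1) -> /eqP/(pd_pos p2) ->].
- by move=> x y; rewrite (pd_sym p1) (pd_sym p2).
- by move=> y x z; rewrite addrACA lerD// ?(pd_tri p1) ?(pd_tri p2).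
- move=> [x x'] U'; split.
    move=> [[A B] /= [/(pd_nbhs p1)[e e0 eA] /(pd_nbhs p2)[f f0 fB]] AB].
    exists (Num.min e f); first by rewrite lt_min e0.
    move=> [y y'] /=; rewrite lt_min => /andP[h1 h2]; apply: AB; split => /=.
      by apply: eA => /=; apply: le_lt_trans h1; rewrite lerDl (pd_ge0 p2).
    by apply: fB => /=; apply: le_lt_trans h2; rewrite lerDr (pd_ge0 p1).
  move=> [e e0 eU]; exists ([set y | D1 x y < e / 2], [set y | D2 x' y < e / 2]).
    by split; [apply/(pd_nbhs p1)|apply/(pd_nbhs p2)]; exists (e / 2) => //;
      rewrite divr_gt0.
  by move=> [y y'] /= [h1 h2]; apply: eU => /=; lra.
- move=> u hu.
  have [n|l1 hl1] := pd_complete p1 (u := fst \o u).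
    by apply: le_trans (hu n); rewrite lerDl (pd_ge0 p2).
  have [n|l2 hl2] := pd_complete p2 (u := snd \o u).
    by apply: le_trans (hu n); rewrite lerDr (pd_ge0 p1).
  by exists (l1, l2) => /=; rewrite -(addr0 0); exact: cvgD.
- move=> [x x'] e e0; have e20 : 0 < e / 2 by rewrite divr_gt0.
  have [i hi] := pd_dense p1 x e20; have [j hj] := pd_dense p2 x' e20.
  by exists (pickle (i, j)); rewrite /q pickleK/=; lra.
Qed.

(** The Borel sets of the product are generated by its open sets, not by rectangles. Separability
    makes every open set a countable union of rectangles of balls, with centres in the dense
    sequences and radii 2^-k. *)
Lemma measurable_borel_pair (T U : ptopologicalType) D1 D2 q1 q2
    d (S : measurableType d) (f : S -> T) (g : S -> U) :
  @polish_dist T D1 q1 -> @polish_dist U D2 q2 ->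
  measurable_fun setT (f : S -> borel T) ->
  measurable_fun setT (g : S -> borel U) ->
  measurable_fun setT ((fun t => (f t, g t)) : S -> borel (T * U)%type).
Proof.
move=> p1 p2 mf mg; apply: (@measurability _ _ _ (borel (T * U)%type) _ _ open) => //.
move=> _ [W oW <-]; rewrite setTI.
pose B1 (k : nat * nat * nat) : set T := [set y | D1 (q1 k.1.1) y < 2^-1 ^+ k.2].
pose B2 (k : nat * nat * nat) : set U := [set y | D2 (q2 k.1.2) y < 2^-1 ^+ k.2].
rewrite (_ : _ @^-1` _ = \bigcup_k
  (if `[< B1 k `*` B2 k `<=` W >] then f @^-1` B1 k `&` g @^-1` B2 k else set0)).
  apply: countable_bigcupT_measurable => // k.
  case: ifPn => // _; apply: measurableI.
    rewrite -[X in measurable X]setTI; apply: mf => //.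
    by apply: measurable_borel; exact: pd_open_ball p1 _ _.
  rewrite -[X in measurable X]setTI; apply: mg => //.
  by apply: measurable_borel; exact: pd_open_ball p2 _ _.
apply/seteqP; split => [t Wt|t [k _]]; last first.
  by case: ifPn => // /asboolP kW [h1 h2]; apply: kW; split.
have [[A B] /= [/(pd_nbhs p1)[e e0 eA] /(pd_nbhs p2)[e' e'0 eB]] AB] :
    nbhs (f t, g t) W by exact: open_nbhs_nbhs.
have [m e0m] : exists m, 2 * 2^-1 ^+ m < Num.min e e' :> R.
  have [|m _ hm] := @expr_half_lt 2 (Num.min e e'); first by rewrite lt_min e0.
  by exists m; apply: hm => /=.
have [i hi] := pd_dense p1 (f t) (expr_half_gt0 m).
have [j hj] := pd_dense p2 (g t) (expr_half_gt0 m).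
exists (i, j, m) => //; case: ifPn => [_|/asboolP[]].
  by split; rewrite /B1 /B2/= ?(pd_sym p1 (q1 _)) ?(pd_sym p2 (q2 _)).
move: e0m; rewrite lt_min => /andP[me me'].
move=> [x y] /= [h1 h2]; apply: AB; split => /=.
  apply: eA => /=; apply: le_lt_trans (pd_tri p1 (q1 i) _ _) _.
  by move: h1; rewrite /B1/=; lra.
apply: eB => /=; apply: le_lt_trans (pd_tri p2 (q2 j) _ _) _.
by move: h2; rewrite /B2/=; lra.
Qed.

End polish_dist.

Arguments approx {R T} D q c n.
Arguments decode {R T} D q c.

Section polish_instances.
Context {R : realType}.

Lemma separable_seq (T : ptopologicalType) : separable T ->
  exists q : nat -> T, dense (range q).
Proof.
move=> [S cS dS]; have [S0|S0] := eqVneq S set0.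
  by have [x] := dS setT (ex_intro _ point I) openT; rewrite S0 => -[].
have /set0P[s Ss] := S0.
have /pcard_surjP[g gS] : (S #<= [set: nat])%card := cS.
exists g => U U0 oU; have [x [Ux /gS[n _ gn]]] := dS U U0 oU.
by exists x; split => //; exists n.
Qed.

Lemma polish_dist_complete (T : completePseudoMetricType R) (D : T -> T -> R) :
  (forall x e, ball x e = [set y | D x y < e]) ->
  (forall x, D x x = 0) -> (forall x y, D x y = 0 -> x = y) ->
  (forall x y, D x y = D y x) -> (forall y x z, D x z <= D x y + D y z) ->
  separable T -> exists q, polish_dist D q.
Proof.
move=> bD Dxx D0 Dsym Dtri /separable_seq[q dq].
have nD x (U : set T) :
    nbhs x U <-> exists2 e, 0 < e & [set y | D x y < e] `<=` U.
  split=> [/nbhs_ballP[e /= e0 eU]|[e e0 eU]]; first by exists e; rewrite -?bD.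
  by apply/nbhs_ballP; exists e => //; rewrite bD.
have Dge0 x y : 0 <= D x y.
  by have := Dtri y x x; rewrite Dxx (Dsym y x) -mulr2n pmulrn_lge0.
exists q; split=> //.
- move=> u hu; have : cvg (u @ \oo).
    apply: cauchy_cvg; apply: cauchy_exP => e e0.
    have [N _ hN] := expr_half_lt 6 e0.
    exists (u N); exists N => // n /= Nn; rewrite bD/=.
    apply: le_lt_trans (hN N (leqnn _)); rewrite -(subnKC Nn).
    apply: le_trans (geometric_dist Dxx Dtri hu _ _) _.
    by rewrite ler_piMr// mulr_ge0.
  move=> /cvg_ex[l ul]; exists l; apply/cvgrPdist_lt => e e0.
  have /ul[N _ hN] : nbhs l [set y | D l y < e] by apply/nD; exists e.
  by exists N => // n /hN /=; rewrite sub0r normrN ger0_norm// Dsym.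
- move=> x e e0; have [||y [xy [i _ iy]]] := dq [set y | D x y < e].
  + by exists x; rewrite /= Dxx.
  + rewrite openE => y /= xy; apply/nD; exists (e - D x y); first by rewrite subr_gt0.
    by move=> z /=; rewrite ltrBrDl; apply: le_lt_trans; exact: Dtri.
  by exists i; rewrite iy.
Qed.

Lemma polish_dist_metric (T : completeMetricType R) :
  separable T -> exists q, polish_dist (@mdist R T) q.
Proof.
apply: (@polish_dist_complete T).
- by move=> x e; rewrite ballEmdist.
- exact: mdistxx.
- exact: mdist_positivity.
- exact: metric_sym.
- by move=> y x z; exact: metric_triangle.
Qed.

Lemma polish_dist_normed (T : completeNormedModType R) :
  separable T -> exists q, polish_dist (fun x y : T => `|x - y|) q.
Proof.
apply: (@polish_dist_complete T).
- by move=> x e; rewrite -ball_normE.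
- by move=> x; rewrite subrr normr0.
- by move=> x y /normr0_eq0/subr0_eq.
- by move=> x y; rewrite distrC.
- by move=> y x z; exact: ler_distD.
Qed.

End polish_instances.

(** * Images and mixtures of laws; masses of the coding cells *)

Section laws.
Context {R : realType}.
Local Open Scope ereal_scope.

Lemma law_exists d d' (S : measurableType d) (T : measurableType d')
    (P : probability S R) (f : S -> T) : measurable_fun setT f ->
  exists nu : probability T R, forall A, nu A = P (f @^-1` A).
Proof.
move=> mf.
pose F : {mfun S >-> T} := HB.pack f (isMeasurableFun.Build _ _ _ _ f mf).
by exists (distribution P F).
Qed.

Lemma law_integral d d' (S : measurableType d) (T : measurableType d')
    (P : {measure set S -> \bar R}) (nu : {measure set T -> \bar R}) (f : S -> T) :
  measurable_fun setT f ->
  (forall A, measurable A -> nu A = P (f @^-1` A)) ->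
  forall (D : set T) (g : T -> \bar R), measurable D -> measurable_fun D g ->
  (forall x, 0 <= g x) ->
  \int[nu]_(x in D) g x = \int[P]_(t in f @^-1` D) g (f t).
Proof.
move=> mf E D g mD mg g0.
rewrite -(ge0_integral_pushforward mf P mD mg (fun y _ => g0 y)).
by apply: eq_measure_integral => A mA _; rewrite E.
Qed.

Lemma measure_bigcupT d (T : measurableType d) (mu : {measure set T -> \bar R})
    (F : (set T)^nat) : (forall n, measurable (F n)) -> trivIset setT F ->
  mu (\bigcup_n F n) = \sum_(n <oo) mu (F n).
Proof.
move=> mF tF; rewrite measure_bigcup//.
by apply: eq_eseriesl => k; rewrite in_setT.
Qed.

(** Dynkin's argument: the sets satisfying both claims are stable under complement, all masses being
    1, and under countable disjoint union, by monotone convergence. *)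
Lemma mixture_law d d' (S : measurableType d) (T : measurableType d')
    (P : probability S R) (u : S -> probability T R) (nu : probability T R)
    (G : set (set T)) :
  @measurable _ T = <<s G >> -> setI_closed G ->
  (forall E, G E -> measurable_fun setT (fun w => u w E) /\
                    nu E = \int[P]_w u w E) ->
  forall E, measurable E -> measurable_fun setT (fun w => u w E) /\
                    nu E = \int[P]_w u w E.
Proof.
move=> mG GI hG E; rewrite mG => GE.
apply: (@dynkin_induction _ _ G [set E | measurable_fun setT (fun w => u w E) /\
  nu E = \int[P]_w u w E] mG GI _ _ _ _ _ GE) => //=.
- split; first by under eq_fun do rewrite probability_setT; exact: measurable_cst.
  under eq_integral do rewrite probability_setT.
  by rewrite integral_cst// mul1e; apply: etrans (probability_setT _) (esym (probability_setT _)).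
- move=> A mA [mu_ nuA]; split.
    under eq_fun do rewrite (probability_setC _ mA).
    exact: emeasurable_funB.
  under eq_integral do rewrite (probability_setC _ mA).
  have iu : P.-integrable setT (fun w => u w A).
    apply/integrableP; split => //.
    under eq_integral do rewrite gee0_abs//.
    by rewrite -nuA (le_lt_trans (probability_le1 _ _))// ltry.
  rewrite integralB//; last exact: finite_measure_integrable_cst.
  by rewrite integral_cst// mul1e -nuA probability_setC//; congr (_ - _); exact/esym/probability_setT.
- move=> F mF tF hF.
  have mUF : measurable (\bigcup_k F k) by exact: bigcupT_measurable.
  have uE w : u w (\bigcup_k F k) = \sum_(k <oo) u w (F k).
    exact: measure_bigcupT.
  split.
    under eq_fun do rewrite uE.
    apply: (@ge0_emeasurable_sum _ _ R setT (fun k w => u w (F k)) xpredT) => //.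
    by move=> k _; have [] := hF k.
  under eq_integral do rewrite uE.
  rewrite integral_nneseries//; last by move=> k; have [] := hF k.
  rewrite measure_bigcupT//.
  by apply: eq_eseriesr => k _; exact: (hF k).2.
Qed.

End laws.

Section mass_of_measure.
Context {R : realType} {T : ptopologicalType} {D : T -> T -> R} {q : nat -> T}.
Hypothesis pD : polish_dist D q.

Definition cell r : set T := encode pD @^-1` cylinder r.

Lemma measurable_cell r : measurable (cell r : set (borel T)).
Proof.
rewrite -[X in measurable X]setTI; apply: (measurable_encode pD) => //.
exact: measurable_cylinder.
Qed.

Lemma cell_nil : cell [::] = setT.
Proof. by rewrite /cell cylinderT preimage_setT. Qed.

Lemma cell_cons r : \bigcup_i cell (i :: r) = cell r.
Proof.
apply/seteqP; split => [z [i _ []]//|z zr].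
by exists (encode pD z (size r)) => //; rewrite /cell/cylinder/= zr.
Qed.

Lemma trivIset_cell r : trivIset setT (fun i => cell (i :: r)).
Proof.
by move=> i j _ _ [z [[zi _] [zj _]]]; rewrite -zi -zj.
Qed.

Definition cell_mass (nu : probability (borel T) R) r : R := fine (nu (cell r)).

Lemma cell_massE nu r : (cell_mass nu r)%:E = nu (cell r).
Proof. by rewrite fineK// fin_num_measure//; exact: measurable_cell. Qed.

Lemma mass_cell_mass nu : mass (cell_mass nu).
Proof.
split.
- by rewrite /cell_mass cell_nil probability_setT.
- by move=> r; rewrite fine_ge0.
move=> r; apply: (@fine_cvg _ _ _ _ (EFin \o series (fun i => cell_mass nu (i :: r)))).
rewrite cell_massE -cell_cons.
have := @measure_semi_sigma_additive _ _ _ nu (fun i => cell (i :: r))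
  (fun i => measurable_cell (i :: r)) (@trivIset_cell r).
rewrite cell_cons => /(_ (measurable_cell r)).
rewrite (_ : (fun n => (\sum_(0 <= i < n) nu (cell (i :: r)))%E) =
  EFin \o series (fun i => cell_mass nu (i :: r)))//.
apply/funext => n /=; rewrite seriesEnat -sumEFin.
by apply: eq_bigr => i _; rewrite cell_massE.
Qed.

(** The law of [code] under [unif] and the law of [encode] under [nu] have the same cylinder masses,
    hence coincide on [baire]; applying [decode] to the second gives back [nu] by [encodeK]. *)
Lemma decode_code_law (nu : probability (borel T) R) (A : set (borel T)) :
  measurable A -> nu A = unif ((decode D q \o code (cell_mass nu)) @^-1` A).
Proof.
move=> mA.
have mc := measurable_code (mass_cell_mass nu).
have [l1 h1] := law_exists unif mc.
have [l2 h2] := law_exists nu (measurable_encode pD).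
have E : forall B, measurable B -> l1 B = l2 B.
  apply: baire_measure_unique => r.
  by rewrite h1 h2 unif_code ?cell_massE//; exact: mass_cell_mass.
rewrite comp_preimage -h1 E.
  by rewrite h2 -comp_preimage (_ : _ \o _ = id) //; apply/funext => z; exact: encodeK.
by rewrite -[X in measurable X]setTI; apply: (measurable_decode pD).
Qed.

End mass_of_measure.

(** * Disintegration *)

Section slices.
Context {R : realType} {Om X : ptopologicalType}.
Implicit Types (pi : probability (borel Om) R)
  (mu : probability (borel (Om * X)%type) R).
Local Open Scope ereal_scope.

Lemma measurable_borel_fst :
  measurable_fun setT (fst : borel (Om * X)%type -> borel Om).
Proof. by apply: continuous_borel_measurable => -[w x]; exact: cvg_fst. Qed.

Lemma measurable_borel_snd :
  measurable_fun setT (snd : borel (Om * X)%type -> borel X).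
Proof. by apply: continuous_borel_measurable => -[w x]; exact: cvg_snd. Qed.

Lemma measurable_borel_setX (A : set (borel Om)) (C : set (borel X)) :
  measurable A -> measurable C ->
  measurable (A `*` C : set (borel (Om * X)%type)).
Proof.
move=> mA mC; rewrite (_ : A `*` C = fst @^-1` A `&` snd @^-1` C)//.
apply: measurableI; rewrite -[X in measurable X]setTI.
  exact: measurable_borel_fst.
exact: measurable_borel_snd.
Qed.

(** For fixed [C] the mass of the rectangle over [A] is a finite measure in [A], dominated by [pi]
    because the first marginal of [mu] is [pi]; [f] is its Radon-Nikodym derivative. *)
Lemma slice_density pi mu (C : set (borel X)) :
  (forall A : set (borel Om), measurable A -> mu (fst @^-1` A) = pi A) ->
  measurable C ->
  exists f : borel Om -> R, [/\ forall w, (0 <= f w)%R,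
    measurable_fun setT (f : borel Om -> measurableTypeR R) &
    forall A : set (borel Om), measurable A -> mu (A `*` C) = \int[pi]_(w in A) (f w)%:E].
Proof.
move=> mupi mC.
have mTC : measurable (setT `*` C : set (borel (Om * X)%type)).
  exact: measurable_borel_setX.
pose F := fst : borel (Om * X)%type -> borel Om.
pose m0 : {measure set (borel Om) -> \bar R} :=
  pushforward (mrestr mu mTC) F.
pose m := m0 measurable_borel_fst.
have mE A : measurable A -> m A = mu (A `*` C).
  move=> mA; rewrite /m/= /pushforward /mrestr; congr (mu _).
  by apply/seteqP; split => -[w x] //= [] // ? [].
have finm : fin_num_fun m.
  move=> A mA; rewrite mE// fin_num_measure//.
  exact: measurable_borel_setX.
pose nu : {finite_measure set (borel Om) -> \bar R} :=
  HB.pack (Measure.sort m) (Measure.class m) (Measure_isFinite.Build _ _ _ m finm).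
have domin : nu `<< pi.
  apply/null_content_dominatesP => A mA pA0; change (m A = 0); rewrite mE//.
  have mA0 : mu (fst @^-1` A) = 0 by rewrite mupi//; exact: pA0.
  apply/eqP; rewrite eq_le measure_ge0 andbT -mA0; apply: le_measure; rewrite ?inE.
  - exact: measurable_borel_setX.
  - by rewrite -[X in measurable X]setTI; exact: measurable_borel_fst.
  by move=> [w x] [].
have [f [f0 ffin fi fE]] := radon_nikodym_sigma_finite domin.
exists (fine \o f); split.
- by move=> w /=; rewrite fine_ge0.
- by apply: measurableT_comp => //; exact: (measurable_int _ fi).
move=> A mA; rewrite -mE// -[LHS]/(nu A) fE//; apply: eq_integral => w _ /=.
by rewrite fineK.
Qed.

End slices.

Section disintegration_existence.
Context {R : realType} {Om : completeMetricType R}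
  {X : completeNormedModType R}.
Local Open Scope ereal_scope.

(** Each identity in [mass] holds after integration over every Borel set of [Om], because the cells
    of the children partition the cell of the parent. It therefore holds almost everywhere, and
    words are countably many. *)
Lemma cell_density_mass (pi : probability (borel Om) R)
    (mu : probability (borel (Om * X)%type) R)
    (D : X -> X -> R) q (pX : polish_dist D q) (h : seq nat -> borel Om -> R) :
  first_marginal pi mu ->
  (forall r, [/\ forall w, (0 <= h r w)%R,
    measurable_fun setT (h r : borel Om -> measurableTypeR R) &
    forall A : set (borel Om), measurable A ->
      mu (A `*` cell pX r) = \int[pi]_(w in A) (h r w)%:E]) ->
  {ae pi, forall w, mass (h ^~ w)}.
Proof.
move=> fm hP.
have h0 r w : (0 <= h r w)%R by have [] := hP r.
have mh r : measurable_fun setT (EFin \o h r) by apply/measurable_EFinP; have [] := hP r.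
have hE r (A : set (borel Om)) : measurable A ->
    mu (A `*` cell pX r) = \int[pi]_(w in A) (h r w)%:E by have [_ _] := hP r; exact.
have ih r : pi.-integrable setT (EFin \o h r).
  apply/integrableP; split => //=.
  under eq_integral do rewrite ger0_norm//.
  rewrite -hE// (le_lt_trans (probability_le1 _ _)) ?ltry//.
  by apply: measurable_borel_setX => //; exact: measurable_cell.
have a1 : ae_eq pi setT (EFin \o h [::]) (cst 1).
  apply: integral_ae_eq => // E _ mE; rewrite -hE// cell_nil.
  rewrite (_ : E `*` setT = fst @^-1` E); last by apply/seteqP; split => -[w x] //= [].
  by rewrite fm// integral_cst// mul1e.
have a2 r : ae_eq pi setT (EFin \o h r) (fun w => \sum_(i <oo) (h (i :: r) w)%:E).
  apply: integral_ae_eq => //.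
    apply: (@ge0_emeasurable_sum _ _ R setT (fun i w => (h (i :: r) w)%:E) xpredT).
      by move=> i w _ _; rewrite lee_fin.
    by move=> i _; exact: mh.
  move=> E _ mE; rewrite -hE// integral_nneseries//; last first.
  - by move=> n x _; rewrite lee_fin.
  - by move=> n; apply: measurable_funTS; exact: mh.
  rewrite -cell_cons setX_bigcupr measure_bigcupT.
  - by apply: eq_eseriesr => i _; exact: hE.
  - by move=> i; apply: measurable_borel_setX => //; exact: measurable_cell.
  move=> i j _ _ [[w x] [[_ xi] [_ xj]]].
  by apply: (@trivIset_cell _ _ _ _ pX r) => //; exists x.
have a3 : {ae pi, forall w, forall n, let r := odflt [::] (unpickle n) in
    (h r w)%:E = \sum_(i <oo) (h (i :: r) w)%:E}.
  apply: ae_foralln => n; have := a2 (odflt [::] (unpickle n)).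
  by apply: filterS => w; apply.
apply: filterS2 a1 a3 => w /(_ I)[h1] hs; split => // r.
have := hs (pickle r); rewrite pickleK/= => hr.
apply: (@fine_cvg _ _ _ _ (EFin \o series (fun i => h (i :: r) w))).
rewrite hr.
have : cvgn (fun n => \sum_(0 <= i < n) (h (i :: r) w)%:E).
  by apply: is_cvg_nneseries => i _ _; rewrite lee_fin.
rewrite (_ : (fun n => \sum_(0 <= i < n) (h (i :: r) w)%:E) =
  EFin \o series (fun i => h (i :: r) w))//.
by apply/funext => n /=; rewrite seriesEnat -sumEFin.
Qed.

(** For almost every [w] the densities at [w] form a [mass], hence code a law on [X]. The mixture
    identity is established for codes, on [Om] times [baire], where masses of cylinders are
    explicit, and then transported by [decode]. *)
Lemma disintegration_exists (sepOm : separable Om) (sepX : separable X)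
    (pi : probability (borel Om) R) (mu : probability (borel (Om * X)%type) R) :
  first_marginal pi mu -> exists k, is_disintegration pi mu k.
Proof.
move=> fm; have [qO pO] := polish_dist_metric sepOm.
have [qX pX] := polish_dist_normed sepX.
have [h hP] := choice (fun r => slice_density fm (measurable_cell pX r)).
have [N [mN N0 subN]] := cell_density_mass fm hP.
have [nuX _] := law_exists mu measurable_borel_snd.
pose m0 := cell_mass pX nuX.
(* On the null set [N], where the densities may fail to be a mass, the masses of the second marginal
   of [mu] are substituted. *)
pose m w r : R := (h r w * \1_(~` N) w + m0 r * \1_N w)%R.
have mEN w : ~ N w -> m w = h ^~ w.
  move=> Nw; apply/funext => r; rewrite /m !indicE in_setC (memNset Nw).
  by rewrite mulr1 mulr0 addr0.
have mm w : mass (m w).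
  have [Nw|Nw] := pselect (N w).
    rewrite (_ : m w = m0); first exact: mass_cell_mass.
    apply/funext => r; rewrite /m !indicE in_setC (mem_set Nw).
    by rewrite mulr0 mulr1 add0r.
  by rewrite mEN//; apply: contrapT => hm; apply: Nw; exact: subN.
have mm_ r : measurable_fun setT ((fun w => m w r) : borel Om -> measurableTypeR R).
  apply: measurable_funD; apply: measurable_funM => //.
  - by have [] := hP r.
  - by apply: measurable_indic; exact: measurableC.
(* On these rectangles the mixture identity is the defining property of the densities; they form a
   pi-system, as [mixture_law] requires. *)
pose G : set (set (Om * (nat -> nat))) :=
  [set E | exists2 A : set (borel Om), measurable A &
           exists2 C, cylinders C & E = A `*` C].
have GI : setI_closed G.
  move=> _ _ [A mA [C cC ->]] [A' mA' [C' cC' ->]]; rewrite -setXI.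
  exists (A `&` A'); first exact: measurableI.
  by exists (C `&` C') => //; exact: cylindersI.
pose M := g_sigma_algebraType G.
have mG (E : set M) : G E -> measurable E by exact: sub_sigma_algebra.
have mfst : measurable_fun setT (fst : M -> borel Om).
  move=> _ A mA; rewrite setTI; apply: mG; exists A => //.
  exists setT; last by apply/seteqP; split => // -[w c] [].
  by right; exists [::]; rewrite cylinderT.
have msnd : measurable_fun setT (snd : M -> baire).
  apply: (@measurability _ _ _ baire _ _ cylinders) => // _ [C cC <-].
  rewrite setTI; apply: mG; exists setT => //; exists C => //.
  by apply/seteqP; split => // -[w c] [].
pose Phi (z : M) : Om * X := (z.1, decode (fun x y : X => `|x - y|%R) qX z.2).
have mPhi : measurable_fun setT (Phi : M -> borel (Om * X)%type).
  apply: (measurable_borel_pair pO pX) => //.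
  exact: measurableT_comp (measurable_decode pX) msnd.
have mcode w : measurable_fun setT ((fun t => (w, code (m w) t)) : measurableTypeR R -> M).
  apply: (@measurability _ _ _ M _ _ G) => // _ [_ [A mA [C cC ->]] <-].
  rewrite setTI; have [Aw|Aw] := pselect (A w).
    rewrite (_ : _ @^-1` _ = code (m w) @^-1` C).
      rewrite -[X in measurable X]setTI; apply: (measurable_code (mm w)) => //.
      exact: sub_sigma_algebra.
    by apply/seteqP; split => t // [].
  rewrite (_ : _ @^-1` _ = set0)//.
  by apply/seteqP; split => t // [].
have [u uE] := choice (fun w => law_exists unif (mcode w)).
have menc : measurable_fun setT
    ((fun z => (z.1, encode pX z.2)) : borel (Om * X)%type -> M).
  apply: (@measurability _ _ _ M _ _ G) => // _ [_ [A mA [C cC ->]] <-].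
  rewrite setTI.
  rewrite (_ : _ @^-1` _ = A `*` (encode pX @^-1` C)).
    apply: measurable_borel_setX => //.
    rewrite -[X in measurable X]setTI; apply: (measurable_encode pX) => //.
    exact: sub_sigma_algebra.
  by apply/seteqP; split.
have [nu nuE] := law_exists mu menc.
have mixt : forall E, measurable E -> measurable_fun setT (fun w => u w E) /\
    nu E = \int[pi]_w u w E.
  apply: (@mixture_law _ _ _ (borel Om) M pi u nu G) => //.
  move=> _ [A mA [C [->|[r ->]] ->]].
    rewrite setX0; split.
      by under eq_fun do rewrite measure0; exact: measurable_cst.
    by rewrite measure0; under eq_integral do rewrite measure0; rewrite integral0.
  have urE w : u w (A `*` cylinder r) = (m w r * \1_A w)%:E.
    rewrite uE; have [Aw|Aw] := pselect (A w).
      rewrite (_ : _ @^-1` _ = code (m w) @^-1` cylinder r).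
        by rewrite unif_code// indicE (mem_set Aw) mulr1.
      by apply/seteqP; split => t // [].
    rewrite indicE (memNset Aw) mulr0 (_ : _ @^-1` _ = set0) ?measure0//.
    by apply/seteqP; split => t // [].
  split.
    under eq_fun do rewrite urE.
    by apply/measurable_EFinP; exact: measurable_funM (mm_ r) (measurable_indic mA).
  under eq_integral do rewrite urE.
  transitivity (mu (A `*` cell pX r)).
    by rewrite nuE; congr (mu _); apply/seteqP; split => -[].
  have [h0 mh ->] := hP r => //.
  pose f1 := (fun w : borel Om => (h r w)%:E) \_ A.
  pose f2 := (fun w : borel Om => (m w r * \1_A w)%:E).
  have mf1 : measurable_fun setT f1.
    have mhE : measurable_fun setT (fun w => (h r w)%:E) by exact/measurable_EFinP.
    exact/(measurable_restrictT _ mA)/measurable_funTS.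
  have mf2 : measurable_fun setT f2.
    by apply/measurable_EFinP; exact: measurable_funM (mm_ r) (measurable_indic mA).
  have f12 : ae_eq pi setT f1 f2.
    exists N; split => // w /= hw; apply: contrapT => Nw; apply: hw => _.
    by rewrite /f1 /f2 patchE mEN// indicE; case: ifP; rewrite ?mulr1 ?mulr0.
  transitivity (\int[pi]_w f1 w); first by rewrite /f1 -integral_mkcond.
  exact: (@ae_eq_integral _ _ _ pi setT f2 f1 measurableT mf1 mf2 f12).
have mdec w : measurable_fun setT
    ((decode (fun x y : X => `|x - y|%R) qX \o code (m w)) : measurableTypeR R -> borel X).
  by apply: measurableT_comp (measurable_decode pX) _; exact: measurable_code.
have [k kE] := choice (fun w => law_exists unif (mdec w)).
exists k; split.
  apply: (measurability (@pset _ _ _ : set (set (pprobability (borel X) R)))) => //.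
  move=> _ -[_ [r r01] [B mB <-]] <-.
  rewrite (_ : _ @^-1` _ = [set w | u w (Phi @^-1` (setT `*` B)) < r%:E]).
    have mB' : measurable (Phi @^-1` (setT `*` B) : set M).
      rewrite -[X in measurable X]setTI; apply: mPhi => //.
      exact: measurable_borel_setX.
    by apply: emeasurable_fun_infty_o => //; have [] := mixt _ mB'.
  have kuE w : k w B = u w (Phi @^-1` (setT `*` B)).
    by rewrite kE uE; congr (unif _); apply/seteqP; split => t; [split|case].
  by apply/seteqP; split => w /=; rewrite /mset/= kuE.
move=> C mC.
have mPC : measurable (Phi @^-1` C : set M).
  by rewrite -[X in measurable X]setTI; exact: mPhi.
have [_ nuI] := mixt _ mPC.
transitivity (nu (Phi @^-1` C)).
  rewrite nuE -comp_preimage (_ : _ \o _ = id)//.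
  by apply/funext => -[w x]; rewrite /Phi /= encodeK.
rewrite nuI; apply: eq_integral => w _; rewrite uE kE; congr (unif _).
by apply/seteqP; split => t; rewrite /= /xsection/= inE.
Qed.

Lemma disintegrationP (sepOm : separable Om) (sepX : separable X)
    (pi : probability (borel Om) R) (mu : probability (borel (Om * X)%type) R) :
  first_marginal pi mu -> is_disintegration pi mu (disintegration pi mu).
Proof.
move=> /(disintegration_exists sepOm sepX)[k hk].
by rewrite /disintegration; case: xgetP => // h; have := h k hk.
Qed.

End disintegration_existence.

Section sup_ge0_limit.
Context {R : realType}.

Lemma le_sup_ge0 (I : Type) (K : set I) (F : I -> \bar R) (b : \bar R) :
  (0 <= b)%E -> (sup_ge0 K F <= b)%E <-> forall i, K i -> (F i <= b)%E.
Proof.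
move=> b0; split=> [h i Ki|h].
  by apply: le_trans h; apply: ereal_sup_ubound; right; exists i.
by apply: ge_ereal_sup => _ [->//|[i Ki <-]]; exact: h.
Qed.

Lemma sup_ge0_ge0 (I : Type) (K : set I) (F : I -> \bar R) :
  (0 <= sup_ge0 K F)%E.
Proof. by apply: ereal_sup_ubound; left. Qed.

(** By monotonicity, smallness at a single [k] persists for all larger ones. Monotonicity is asked
    on [K] only, because for the split form it is derived from membership in [Ppi_p]. *)
Lemma sup_ge0_cvg0 (I : Type) (K : set I) (F : R -> I -> \bar R) :
  (forall k k' i, K i -> k <= k' -> (F k' i <= F k i)%E) ->
  (sup_ge0 K (F k) @[k --> +oo%R] --> 0%E) <->
  forall e : R, 0 < e -> exists k, forall i, K i -> (F k i <= e%:E)%E.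
Proof.
move=> ndF; split=> [/fine_cvgP[[M [Mr hM]] /cvgrPdist_le h] e e0|h].
  have [M' [M'r hM']] := h e e0.
  pose k := Num.max M M' + 1.
  have Mk : M < k by rewrite /k; have : M <= Num.max M M' by [rewrite le_max lexx]; lra.
  have M'k : M' < k.
    by rewrite /k; have : M' <= Num.max M M' by [rewrite le_max lexx orbT]; lra.
  exists k; apply/le_sup_ge0; first by rewrite lee_fin ltW.
  have := hM' k M'k; rewrite /= sub0r normrN => {}h.
  by rewrite -(fineK (hM k Mk)) lee_fin (le_trans (ler_norm _)).
have nears (e : R) : 0 < e -> \forall k \near +oo%R, (sup_ge0 K (F k) <= e%:E)%E.
  move=> e0; have [k hk] := h e e0.
  exists k; split; first exact: num_real.
  move=> k' kk'; apply/le_sup_ge0; first by rewrite lee_fin ltW.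
  by move=> i Ki; apply: le_trans (hk i Ki); apply: ndF => //; exact: ltW.
apply/fine_cvgP; split.
  apply: filterS (nears 1 ltr01) => k hk.
  by rewrite ge0_fin_numE ?sup_ge0_ge0// (le_lt_trans hk)// ltry.
apply/cvgrPdist_le => e e0; apply: filterS (nears e e0) => k hk.
rewrite /= sub0r normrN ger0_norm ?fine_ge0 ?sup_ge0_ge0//.
rewrite -lee_fin fineK// ge0_fin_numE ?sup_ge0_ge0//.
by rewrite (le_lt_trans hk)// ltry.
Qed.

End sup_ge0_limit.

(** * Fibred moments as integrals against the measure on the product *)

Section disintegration_integral.
Context {R : realType} {Om : completeMetricType R}
  {X : completeNormedModType R}.
Variables (sepOm : separable Om) (sepX : separable X).
Variables (pi : probability (borel Om) R) (p : R).
Hypothesis p1 : 1 <= p.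
Implicit Type mu : probability (borel (Om * X)%type) R.
Local Open Scope ereal_scope.

(** [mu] is the composition of the constant kernel [pi] with the kernel sending [w] to the image of
    [k w] under x |-> (w, x); the formula is the one for integrals against a composed kernel. *)
Lemma integral_disintegration mu k (f : borel (Om * X)%type -> \bar R) :
  is_disintegration pi mu k -> measurable_fun setT f -> (forall z, 0 <= f z) ->
  \int[mu]_z f z = \int[pi]_w \int[k w]_x f (w, x).
Proof.
move=> [mk muE] mf f0.
have [qO pO] := polish_dist_metric sepOm.
have [qX pX] := polish_dist_normed sepX.
have mx (w : borel Om) :
    measurable_fun setT ((fun x => (w, x)) : borel X -> borel (Om * X)%type).
  by apply: (measurable_borel_pair pO pX) => //; exact: measurable_cst.
have [u uE] := choice (fun w => law_exists (k w) (mx w)).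
have uxs w C : u w C = k w (xsection C w).
  by rewrite uE; congr (k w _); apply/seteqP; split => x; rewrite /= /xsection/= inE.
(* Measurability of sections refers to the product sigma-algebra, which contains the Borel sets of
   the product by separability. *)
have mprod (C : set (borel (Om * X)%type)) : measurable C ->
    measurable (C : set (borel Om * borel X)).
  move=> mC; have mid : measurable_fun setT
      ((fun z => (z.1, z.2)) : borel Om * borel X -> borel (Om * X)%type).
    by apply: (measurable_borel_pair pO pX); [exact: measurable_fst|exact: measurable_snd].
  have := mid measurableT _ mC; rewrite setTI.
  by rewrite (_ : _ @^-1` _ = C)//; apply/seteqP; split => -[].
have mu_ : measurable_fun setT (u : borel Om -> pprobability (borel (Om * X)%type) R).
  apply: (measurability (@pset _ _ _ : set (set (pprobability (borel (Om * X)%type) R)))) => //.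
  move=> _ -[_ [r r01] [C mC <-]] <-.
  apply: emeasurable_fun_infty_o => //.
  rewrite (_ : (fun w => _) = fun w => (kprobability mk) w (xsection C w)); last first.
    by apply/funext => w; rewrite uxs.
  by apply: measurable_fun_xsection_finite_kernel; rewrite inE; exact: mprod.
have mpi : measurable_fun setT (cst pi : unit -> pprobability (borel Om) R).
  exact: measurable_cst.
have mu2 : measurable_fun setT
    ((u \o snd) : unit * borel Om -> pprobability (borel (Om * X)%type) R).
  by apply: measurableT_comp mu_ _; exact: measurable_snd.
have := integral_kcomp (kprobability mpi) (kprobability mu2) tt f0 mf.
rewrite (_ : \int[_]_z f z = \int[mu]_z f z) => [->|]; last first.
  apply: eq_measure_integral => C mC _; apply: etrans (esym (muE C mC)).
  by apply: eq_integral => w _; exact: uxs.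
apply: eq_integral => w _.
by rewrite (law_integral (mx w) (fun A _ => uE w A) measurableT mf f0) preimage_setT.
Qed.

Lemma measurable_snd_pow :
  measurable_fun setT ((fun z => (`|z.2| `^ p)%:E) : borel (Om * X)%type -> \bar R).
Proof.
apply/measurable_EFinP; apply: (measurableT_comp (measurable_powR p)).
apply: continuous_real_measurable => z.
by apply: continuous_comp; [exact: cvg_snd|exact: norm_continuous].
Qed.

Lemma pnorm_momentE (nu : probability (borel X) R) :
  pnorm_moment p nu `^ p = \int[nu]_x (`|x| `^ p)%:E.
Proof.
rewrite /pnorm_moment -poweRrM mulVf ?poweRe1 ?gt_eqF ?(lt_le_trans ltr01)//.
by apply: integral_ge0 => x _; rewrite lee_fin powR_ge0.
Qed.

(** The power [p] cancels the root in [pnorm_moment], and the indicator of [A] is constant on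
    fibres. *)
Lemma integral_moment_disintegration mu (A : set (borel Om)) :
  first_marginal pi mu -> measurable A ->
  \int[pi]_(w in A) (pnorm_moment p (disintegration pi mu w) `^ p) =
  \int[mu]_(z in fst @^-1` A) (`|z.2| `^ p)%:E.
Proof.
move=> fm mA; have dis := disintegrationP sepOm sepX fm.
have mA' : measurable (fst @^-1` A : set (borel (Om * X)%type)).
  by rewrite -[X in measurable X]setTI; exact: measurable_borel_fst.
pose g := ((fun z => (`|z.2| `^ p)%:E) : borel (Om * X)%type -> \bar R).
have g0 z : 0 <= g z by rewrite lee_fin powR_ge0.
rewrite [RHS]integral_mkcond (integral_disintegration dis).
- rewrite integral_mkcond; apply: eq_integral => w _; rewrite patchE.
  case: ifPn => wA; first rewrite pnorm_momentE.
    by apply: eq_integral => x _; rewrite patchE /= mem_set//=; exact/set_mem.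
  rewrite integral0_eq// => x _; rewrite patchE memNset//=.
  by move=> /mem_set; rewrite (negbTE wA).
- apply/(measurable_restrictT _ mA'); apply: measurable_funTS.
  exact: measurable_snd_pow.
- by move=> z; rewrite patchE; case: ifP.
Qed.

End disintegration_integral.

(** * Uniform integrability *)

Section uniform_integrability.
Context {R : realType} {Om : completeMetricType R}
  {X : completeNormedModType R}.
Variables (sepOm : separable Om) (sepX : separable X).

(** Comparable to [prod_dist] up to a factor 2 in both directions, and its triangle inequality is
    immediate, so it serves as the distance for coding. *)
Definition sum_dist (z z' : Om * X) : R := mdist z.1 z'.1 + `|z.2 - z'.2|.

Lemma polish_dist_sum : exists q, polish_dist sum_dist q.
Proof.
have [qO pO] := polish_dist_metric sepOm.
have [qX pX] := polish_dist_normed sepX.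
exact: polish_dist_prod pO pX.
Qed.

Lemma measurable_lipschitz (f : Om * X -> R) C :
  (forall z z', `|f z - f z'| <= C * sum_dist z z') ->
  measurable_fun setT (f : borel (Om * X)%type -> measurableTypeR R).
Proof.
move=> fC; have [q pD] := polish_dist_sum.
have cf := pd_lipschitz_continuous pD fC.
exact: (continuous_real_measurable cf).
Qed.

Lemma sum_dist_lipschitz z0 z z' :
  `|sum_dist z z0 - sum_dist z' z0| <= 1 * sum_dist z z'.
Proof.
have [q pD] := polish_dist_sum; rewrite mul1r ler_norml.
have := pd_tri pD z z' z0; have := pd_tri pD z' z z0.
by rewrite (pd_sym pD z' z); move=> ? ?; apply/andP; split; lra.
Qed.

Lemma sum_dist0 w0 z : sum_dist z (w0, 0) = mdist z.1 w0 + `|z.2|.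
Proof. by rewrite /sum_dist subr0. Qed.

Lemma measurable_sum_dist z0 :
  measurable_fun setT ((sum_dist ^~ z0) : borel (Om * X)%type -> measurableTypeR R).
Proof. exact: measurable_lipschitz (sum_dist_lipschitz z0). Qed.

Lemma measurable_mdist w0 :
  measurable_fun setT ((fun w => mdist w w0) : borel Om -> measurableTypeR R).
Proof.
have [q pO] := polish_dist_metric sepOm.
apply: continuous_real_measurable; apply: (@pd_lipschitz_continuous _ _ _ _ pO _ 1).
move=> x y; rewrite mul1r ler_norml.
have := metric_triangle x y w0; have := metric_triangle y x w0.
by rewrite (metric_sym y x) => ? ?; apply/andP; split; lra.
Qed.

Lemma measurable_fst_mdist w0 :
  measurable_fun setT ((fun z => mdist z.1 w0) : borel (Om * X)%type -> measurableTypeR R).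
Proof. exact: measurableT_comp (measurable_mdist w0) measurable_borel_fst. Qed.

Lemma measurable_snd_norm :
  measurable_fun setT ((fun z => `|z.2|) : borel (Om * X)%type -> measurableTypeR R).
Proof.
apply: (measurable_lipschitz (C := 1)) => z z'; rewrite mul1r.
by apply: le_trans (ler_dist_dist _ _) _; rewrite lerDr mdist_ge0.
Qed.

Lemma measurable_ge d (T : measurableType d) (f : T -> measurableTypeR R) (k : R) :
  measurable_fun setT f -> measurable [set t | k <= f t].
Proof.
move=> mf; rewrite (_ : mkset _ = f @^-1` `[k, +oo[%classic).
  by rewrite -[X in measurable X]setTI; apply: mf => //; exact: measurable_itv.
by apply/seteqP; split => t /=; rewrite in_itv/= andbT.
Qed.

Variables (pi : probability (borel Om) R) (p : R).
Hypothesis p1 : 1 <= p.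
Implicit Type mu : probability (borel (Om * X)%type) R.
Implicit Type K : set (probability (borel (Om * X)%type) R).
Local Open Scope ereal_scope.

Definition moment_on mu (S : set (borel (Om * X)%type)) : \bar R :=
  \int[mu]_(z in S) (`|z.2| `^ p)%:E.

Lemma moment_on_le mu (A B : set (borel (Om * X)%type)) :
  measurable A -> measurable B -> A `<=` B -> moment_on mu A <= moment_on mu B.
Proof.
move=> mA mB AB; apply: ge0_subset_integral => //.
by apply: measurable_funTS; exact: measurable_snd_pow.
Qed.

Lemma moment_onU mu (A B : set (borel (Om * X)%type)) :
  measurable A -> measurable B ->
  moment_on mu (A `|` B) <= moment_on mu A + moment_on mu B.
Proof.
move=> mA mB; have mD : measurable (B `\` A) by exact: measurableD.
rewrite (_ : A `|` B = A `|` (B `\` A)).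
  rewrite /moment_on ge0_integral_setU//.
  - by rewrite leeD2l//; apply: moment_on_le => //; exact: subDsetl.
  - by apply: measurable_funTS; exact: measurable_snd_pow.
  - by apply/disj_setPS => z [Az [_]].
apply/seteqP; split => z; last by case=> [|[]]; [left|right].
by move=> [Az|Bz]; [left|have [?|?] := pselect (A z); [left|right]].
Qed.

Lemma measurable_far w0 (k : R) :
  measurable ([set z | (k <= mdist z.1 w0 + `|z.2|)%R] : set (borel (Om * X)%type)).
Proof.
have := measurable_ge k (measurable_sum_dist (w0, 0%R)).
by under eq_set do rewrite sum_dist0.
Qed.

Lemma unif_integrableP K w0 : unif_integrable p K w0 <->
  forall e : R, (0 < e)%R -> exists k : R, forall mu, K mu ->
    moment_on mu [set z | (k <= mdist z.1 w0 + `|z.2|)%R] <= e%:E.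
Proof.
apply: sup_ge0_cvg0 => k k' mu _ kk'.
apply: moment_on_le; [exact: measurable_far..|].
by move=> z /=; exact: le_trans.
Qed.

Lemma unif_integrable_splitP K w0 : K `<=` Ppi_p pi p ->
  unif_integrable_split pi p K w0 <->
  forall e : R, (0 < e)%R -> exists k : R, forall mu, K mu ->
    moment_on mu [set z | (k <= mdist z.1 w0)%R] +
    moment_on mu [set z | (k <= `|z.2|)%R] <= e%:E.
Proof.
move=> KP.
have mO (k : R) : measurable ([set w | (k <= mdist w w0)%R] : set (borel Om)).
  exact: measurable_ge (measurable_mdist w0).
have mO' (k : R) : measurable ([set z | (k <= mdist z.1 w0)%R] : set (borel (Om * X)%type)).
  exact: measurable_ge (measurable_fst_mdist w0).
have mX (k : R) : measurable ([set z | (k <= `|z.2|)%R] : set (borel (Om * X)%type)).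
  exact: measurable_ge measurable_snd_norm.
have momentE mu k : K mu ->
    \int[pi]_(w in [set w : Om | (k <= mdist w w0)%R])
      (pnorm_moment p (disintegration pi mu w) `^ p) =
    moment_on mu [set z | (k <= mdist z.1 w0)%R].
  by move=> /KP[fm _]; rewrite (integral_moment_disintegration sepOm sepX p1 fm).
split=> [/sup_ge0_cvg0 h e e0|h].
  have [|k hk] := h _ e e0.
    move=> k k' mu Kmu kk'; rewrite !momentE//; apply: leeD; apply: moment_on_le => //;
      by move=> z /=; exact: le_trans.
  by exists k => mu Kmu; rewrite -momentE//; exact: hk.
apply/sup_ge0_cvg0 => [k k' mu Kmu kk'|e e0].
  rewrite !momentE//; apply: leeD; apply: moment_on_le => //;
    by move=> z /=; exact: le_trans.
by have [k hk] := h e e0; exists k => mu Kmu; rewrite momentE//; exact: hk.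
Qed.

(** Each of the sets d >= k and |x| >= k lies in d + |x| >= k, and d + |x| >= 2k lies in their
    union. *)
Lemma unif_integrable_splitE K w0 : K `<=` Ppi_p pi p ->
  unif_integrable p K w0 <-> unif_integrable_split pi p K w0.
Proof.
move=> KP.
have mO (k : R) : measurable ([set z | (k <= mdist z.1 w0)%R] : set (borel (Om * X)%type)).
  exact: measurable_ge (measurable_fst_mdist w0).
have mX (k : R) : measurable ([set z | (k <= `|z.2|)%R] : set (borel (Om * X)%type)).
  exact: measurable_ge measurable_snd_norm.
split=> [/unif_integrableP h|/(unif_integrable_splitP _ KP) h].
  apply/unif_integrable_splitP => // e e0.
  have [|k hk] := h (e / 2)%R; first by rewrite divr_gt0.
  exists k => mu /hk hmu; rewrite [e]splitr EFinD; apply: leeD;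
    apply: le_trans hmu; apply: moment_on_le => //; try exact: measurable_far.
    by move=> z /= /le_trans; apply; rewrite lerDl.
  by move=> z /= /le_trans; apply; rewrite lerDr mdist_ge0.
apply/unif_integrableP => e /h[k hk]; exists (k + k)%R => mu /hk; apply: le_trans.
apply: le_trans (moment_onU mu (mO k) (mX k)).
apply: moment_on_le; [exact: measurable_far|exact: measurableU|].
move=> z /= kz; have [?|?] := leP k (mdist z.1 w0); first by left.
by right => /=; lra.
Qed.

Lemma unif_integrable_change K w0 w1 :
  unif_integrable p K w0 -> unif_integrable p K w1.
Proof.
move=> /unif_integrableP h; apply/unif_integrableP => e /h[k hk].
exists (k + mdist w1 w0)%R => mu /hk; apply: le_trans.
apply: moment_on_le; [exact: measurable_far..|].
by move=> z /=; have := metric_triangle z.1 w0 w1; rewrite (metric_sym w0); lra.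
Qed.

End uniform_integrability.

(** * Lipschitz functions and the Wasserstein distance *)

Section pnorm.
Context {R : realType}.
Variable p : R.
Hypothesis p1 : 1 <= p.
Local Open Scope ereal_scope.

Let p0 : (0 < p)%R. Proof. exact: lt_le_trans p1. Qed.

Lemma ler_powRl (a b r : R) : (0 <= r)%R -> (0 <= a)%R -> (a <= b)%R ->
  (a `^ r <= b `^ r)%R.
Proof.
move=> r0 a0 ab; apply: ge0_ler_powR => //; rewrite nnegrE//.
exact: le_trans ab.
Qed.

Lemma lee_poweRl (a b : \bar R) (r : R) : (0 <= r)%R -> 0 <= a -> a <= b ->
  a `^ r <= b `^ r.
Proof.
move=> r0 a0 ab; apply: gt0_ler_poweR => //; rewrite in_itv/= leey andbT//.
exact: le_trans ab.
Qed.

(* For nonnegative [f] this is ['N[mu]_p f], in the form met in [wasserstein]. *)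
Definition Np d (T : measurableType d) (mu : {measure set T -> \bar R})
  (f : T -> R) : \bar R := (\int[mu]_z (f z `^ p)%:E) `^ p^-1.

Lemma Np_ge0 d (T : measurableType d) (mu : {measure set T -> \bar R}) f :
  0 <= Np mu f.
Proof. exact: poweR_ge0. Qed.

Lemma measurable_powR_EFin d (T : measurableType d) (f : T -> measurableTypeR R) :
  measurable_fun setT f -> measurable_fun setT (fun z => (f z `^ p)%:E).
Proof.
by move=> mf; apply/measurable_EFinP; exact: measurableT_comp (measurable_powR p) mf.
Qed.

Lemma NpK d (T : measurableType d) (mu : {measure set T -> \bar R}) f :
  Np mu f `^ p = \int[mu]_z (f z `^ p)%:E.
Proof.
rewrite /Np -poweRrM mulVf ?poweRe1 ?gt_eqF//.
by apply: integral_ge0 => z _; rewrite lee_fin powR_ge0.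
Qed.

Lemma Np_le d (T : measurableType d) (mu : {measure set T -> \bar R}) f (c : R) :
  (0 <= c)%R -> Np mu f <= c%:E <-> \int[mu]_z (f z `^ p)%:E <= (c `^ p)%:E.
Proof.
move=> c0; split=> h.
  by rewrite -NpK -poweR_EFin; apply: lee_poweRl; rewrite ?Np_ge0// ltW.
rewrite /Np -[c](@powRr1 R)// -(@mulfV _ p) ?gt_eqF// powRrM -poweR_EFin.
apply: lee_poweRl => //; first by rewrite invr_ge0 ltW.
by apply: integral_ge0 => z _; rewrite lee_fin powR_ge0.
Qed.

Lemma Np_law d d' (S : measurableType d) (T : measurableType d')
    (P : {measure set S -> \bar R}) (nu : {measure set T -> \bar R})
    (f : S -> T) (g : T -> measurableTypeR R) :
  measurable_fun setT f ->
  (forall A, measurable A -> nu A = P (f @^-1` A)) -> measurable_fun setT g ->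
  Np nu g = Np P (g \o f).
Proof.
move=> mf E mg; congr (_ `^ _); rewrite (law_integral mf E) ?preimage_setT//.
- exact: measurable_powR_EFin mg.
- by move=> x; rewrite lee_fin powR_ge0.
Qed.

Lemma Np_Lnorm d (T : measurableType d) (mu : {measure set T -> \bar R}) f :
  (forall z, 0 <= f z)%R -> Np mu f = 'N[mu]_p%:E[EFin \o f].
Proof.
move=> f0; rewrite unlock /Np; apply: (congr1 (fun x => x `^ p^-1)); apply: eq_integral => z _.
by rewrite abse_EFin ger0_norm// poweR_EFin.
Qed.

Lemma Np_minkowski d (T : measurableType d) (mu : {measure set T -> \bar R})
    (f g h : T -> measurableTypeR R) :
  measurable_fun setT f -> measurable_fun setT g -> measurable_fun setT h ->
  (forall z, 0 <= f z)%R -> (forall z, 0 <= g z)%R -> (forall z, 0 <= h z)%R ->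
  (forall z, h z <= f z + g z)%R ->
  Np mu h <= Np mu f + Np mu g.
Proof.
move=> mf mg mh f0 g0 h0 hfg.
have fg0 z : (0 <= (f \+ g)%R z)%R by rewrite addr_ge0.
apply: (@le_trans _ _ (Np mu (f \+ g)%R)); last first.
  by rewrite !Np_Lnorm//; exact: minkowski_EFin.
apply: lee_poweRl; first by rewrite invr_ge0 ltW.
  by apply: integral_ge0 => z _; rewrite lee_fin powR_ge0.
apply: ge0_le_integral => //.
- by move=> z _; rewrite lee_fin powR_ge0.
- exact: measurable_powR_EFin.
- by apply: measurable_powR_EFin; exact: measurable_funD.
- by move=> z _; rewrite lee_fin; apply: ler_powRl => //; rewrite ltW.
Qed.

End pnorm.

Section wasserstein_lipschitz.
Context {R : realType} {Om : completeMetricType R}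
  {X : completeNormedModType R}.
Variables (sepOm : separable Om) (sepX : separable X).
Variable p : R.
Hypothesis p1 : 1 <= p.
Implicit Type (mu nu : probability (borel (Om * X)%type) R)
  (pi : probability (borel Om) R).

Let p0 : 0 < p. Proof. exact: lt_le_trans p1. Qed.

Lemma prod_dist_ge0 (z z' : Om * X) : 0 <= prod_dist p z z'.
Proof. exact: powR_ge0. Qed.

Lemma prod_distC (z z' : Om * X) : prod_dist p z z' = prod_dist p z' z.
Proof. by rewrite /prod_dist metric_sym distrC. Qed.

Lemma le_root (a b : R) : 0 <= a -> 0 <= b -> a <= (a `^ p + b `^ p) `^ p^-1.
Proof.
move=> a0 b0; rewrite -{1}[a]powRr1// -(@mulfV _ p) ?gt_eqF// powRrM.
by apply: ler_powRl; rewrite ?invr_ge0 ?powR_ge0// ?(ltW p0)// lerDl powR_ge0.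
Qed.

Lemma mdist_prod_dist (z z' : Om * X) : mdist z.1 z'.1 <= prod_dist p z z'.
Proof. by apply: le_root; rewrite ?mdist_ge0. Qed.

Lemma norm_prod_dist (z z' : Om * X) : `|z.2 - z'.2| <= prod_dist p z z'.
Proof. by rewrite /prod_dist (addrC (_ `^ p)); apply: le_root; rewrite ?mdist_ge0. Qed.

(** With s the sum, a^p + b^p <= 2 s^p <= (2 s)^p; the last inequality uses p >= 1. *)
Lemma prod_dist_sum (z z' : Om * X) : prod_dist p z z' <= 2 * sum_dist z z'.
Proof.
have h (a : R) : 0 <= a -> a <= sum_dist z z' -> a `^ p <= sum_dist z z' `^ p.
  by move=> a0 ab; apply: ler_powRl => //; exact: ltW.
have d0 := mdist_ge0 z.1 z'.1; have n0 := normr_ge0 (z.2 - z'.2).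
have s0 : 0 <= sum_dist z z' by exact: addr_ge0.
apply: (@le_trans _ _ (((2 * sum_dist z z') `^ p) `^ p^-1)); last first.
  by rewrite -powRrM mulfV ?gt_eqF// powRr1// mulr_ge0.
apply: ler_powRl; first by rewrite invr_ge0 ltW.
  by rewrite addr_ge0// powR_ge0.
apply: le_trans (lerD (h _ d0 _) (h _ n0 _)) _; rewrite ?lerDl ?lerDr//.
rewrite powRM// -mulr2n -[leLHS]mulr_natl; apply: ler_wpM2r; first exact: powR_ge0.
by apply: le1r_powR => //; rewrite ler1n.
Qed.

Lemma measurable_prod_dist : measurable_fun setT
  ((fun z => prod_dist p z.1 z.2) :
    borel ((Om * X) * (Om * X))%type -> measurableTypeR R).
Proof.
have [q pD] := @polish_dist_sum R Om X sepOm sepX.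
have [q2 pD2] := polish_dist_prod pD pD.
have m1 : measurable_fun setT ((fun z => mdist z.1.1 z.2.1) :
    borel ((Om * X) * (Om * X))%type -> measurableTypeR R).
  apply: continuous_real_measurable; apply: (@pd_lipschitz_continuous _ _ _ _ pD2 _ 1).
  move=> [[a b] [c e]] [[a' b'] [c' e']]; rewrite mul1r/= ler_norml /sum_dist/=.
  have := metric_triangle a a' c; have := metric_triangle a' c' c.
  have := metric_triangle a' a c'; have := metric_triangle a c c'.
  rewrite (metric_sym a' a) (metric_sym c' c).
  have := normr_ge0 (b - b'); have := normr_ge0 (e - e').
  by move=> *; apply/andP; split; lra.
have m2 : measurable_fun setT ((fun z => `|z.1.2 - z.2.2|) :
    borel ((Om * X) * (Om * X))%type -> measurableTypeR R).
  apply: continuous_real_measurable; apply: (@pd_lipschitz_continuous _ _ _ _ pD2 _ 1).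
  move=> [[a b] [c e]] [[a' b'] [c' e']]; rewrite mul1r/= /sum_dist/=.
  apply: le_trans (ler_dist_dist _ _) _.
  rewrite (_ : b - e - (b' - e') = (b - b') - (e - e')); last first.
    by rewrite !opprD !opprK addrACA.
  apply: le_trans (ler_normB _ _) _.
  by have := mdist_ge0 a a'; have := mdist_ge0 c c'; lra.
apply: (measurableT_comp (measurable_powR p^-1)).
by apply: measurable_funD; apply: measurableT_comp (measurable_powR p) _.
Qed.

Definition lipschitz1 (f : Om * X -> R) : Prop :=
  (forall z, 0 <= f z) /\ (forall z z', `|f z - f z'| <= prod_dist p z z').

Lemma measurable_lipschitz1 f : lipschitz1 f ->
  measurable_fun setT (f : borel (Om * X)%type -> measurableTypeR R).
Proof.
move=> [_ fL]; apply: (measurable_lipschitz sepOm sepX (C := 2)) => z z'.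
by apply: le_trans (fL z z') _; exact: prod_dist_sum.
Qed.

Local Open Scope ereal_scope.

Lemma Wp_coupling mu nu (e : R) : Wp p mu nu < e%:E ->
  exists2 gam, coupling mu nu gam & Np p gam (fun z => prod_dist p z.1 z.2) < e%:E.
Proof.
move=> h; apply: contrapT => hn.
have e0 : (0 <= e)%R by rewrite -lee_fin (le_trans _ (ltW h))// poweR_ge0.
move: h; rewrite /Wp /wasserstein ltNge => /negP; apply.
have -> : e%:E = (e `^ p)%:E `^ p^-1.
  by rewrite poweR_EFin -powRrM mulfV ?gt_eqF// powRr1.
apply: lee_poweRl; rewrite ?invr_ge0 ?(ltW p0)// ?lee_fin ?powR_ge0//.
apply: le_ereal_inf_tmp => _ [gam cgam <-].
rewrite -(NpK p1) -poweR_EFin; apply: lee_poweRl; rewrite ?(ltW p0)//.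
by rewrite leNgt; apply/negP => h; apply: hn; exists gam.
Qed.

(** Take a coupling of cost less than [e] and apply Minkowski's inequality under it to f(z') <= f(z)
    + d(z, z'), then with z and z' exchanged. *)
Lemma Wp_lipschitz mu nu (e : R) f : lipschitz1 f -> Wp p mu nu < e%:E ->
  Np p nu f <= Np p mu f + e%:E /\ Np p mu f <= Np p nu f + e%:E.
Proof.
move=> fL /Wp_coupling[gam c /ltW he].
have mf := measurable_lipschitz1 fL.
rewrite (Np_law p (@measurable_borel_fst _ _) (fun A mA => esym (c A mA).1) mf).
rewrite (Np_law p (@measurable_borel_snd _ _) (fun A mA => esym (c A mA).2) mf).
have mf1 := measurableT_comp mf (@measurable_borel_fst (Om * X)%type (Om * X)%type).
have mf2 := measurableT_comp mf (@measurable_borel_snd (Om * X)%type (Om * X)%type).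
have [f0 fl] := fL.
split; apply: le_trans (leeD2l _ he).
  apply: (@Np_minkowski _ _ p1 _ _ gam (f \o fst) (fun z => prod_dist p z.1 z.2) (f \o snd)).
  - exact: mf1.
  - exact: measurable_prod_dist.
  - exact: mf2.
  - by move=> z /=; exact: f0.
  - by move=> z; exact: powR_ge0.
  - by move=> z /=; exact: f0.
  by move=> z /=; have := fl z.1 z.2; rewrite ler_norml => /andP[]; lra.
apply: (@Np_minkowski _ _ p1 _ _ gam (f \o snd) (fun z => prod_dist p z.1 z.2) (f \o fst)).
- exact: mf2.
- exact: measurable_prod_dist.
- exact: mf1.
- by move=> z /=; exact: f0.
- by move=> z; exact: powR_ge0.
- by move=> z /=; exact: f0.
by move=> z /=; have := fl z.1 z.2; rewrite ler_norml => /andP[]; lra.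
Qed.

Lemma open_Wp pi (U : set (Ppi_p_space X pi p)) : open U <->
  forall mu : Ppi_p_space X pi p, U mu -> exists2 eps : R, (0 < eps)%R &
    [set nu : Ppi_p_space X pi p | Wp p (\val mu) (\val nu) < eps%:E] `<=` U.
Proof. by []. Qed.

Lemma open_Np_lt pi f (c : R) : lipschitz1 f ->
  open [set mu : Ppi_p_space X pi p | Np p (\val mu) f < c%:E].
Proof.
move=> fL; apply/open_Wp => mu /= h.
have Nfin : Np p (\val mu) f \is a fin_num.
  by rewrite ge0_fin_numE ?Np_ge0// (lt_trans h)// ltry.
move: h; rewrite -(fineK Nfin) lte_fin => h.
set a := fine _ in h.
exists ((c - a) / 2)%R; first by rewrite divr_gt0// subr_gt0.
move=> nu /= /(Wp_lipschitz fL)[+ _]; rewrite -(fineK Nfin) -/a -EFinD.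
by move=> /le_lt_trans; apply; rewrite lte_fin; lra.
Qed.

Lemma open_Np_gt pi f (c : R) : lipschitz1 f ->
  open [set mu : Ppi_p_space X pi p | c%:E < Np p (\val mu) f].
Proof.
move=> fL; apply/open_Wp => mu /= h.
(* The norm may be infinite, and then any radius works. *)
have [e e0 he] : exists2 e : R, (0 < e)%R & (c + e)%:E < Np p (\val mu) f.
  case: (Np p (\val mu) f) h => [a||//].
    rewrite lte_fin => ca; exists ((a - c) / 2)%R; first by rewrite divr_gt0// subr_gt0.
    by rewrite lte_fin; lra.
  by move=> _; exists 1%R => //; rewrite ltry.
exists e => // nu /= /(Wp_lipschitz fL)[_ h'].
have := lt_le_trans he h'; case: (Np _ _ _) => [r|_|].
- by rewrite -EFinD !lte_fin ltrD2r.
- by rewrite ltry.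
- by rewrite ltNge leNye.
Qed.

Lemma closed_Np_le pi f (c : R) : lipschitz1 f ->
  closed [set mu : Ppi_p_space X pi p | Np p (\val mu) f <= c%:E].
Proof.
move=> fL; rewrite (_ : mkset _ = ~` [set mu : Ppi_p_space X pi p | c%:E < Np p (\val mu) f]).
  by apply: open_closedC; exact: open_Np_gt.
by apply/seteqP; split => mu /=; rewrite leNgt => /negP.
Qed.

(* Dini's argument on the compact closure. *)
Lemma compact_Np_small pi (C : set (Ppi_p_space X pi p)) (f : nat -> Om * X -> R) :
  compact C -> (forall n, lipschitz1 (f n)) ->
  (forall n m z, (n <= m)%N -> (f m z <= f n z)%R) ->
  (forall mu : Ppi_p_space X pi p, C mu -> Np p (\val mu) (f n) @[n --> \oo] --> 0) ->
  forall e : R, (0 < e)%R -> exists n,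
    forall mu : Ppi_p_space X pi p, C mu -> Np p (\val mu) (f n) < e%:E.
Proof.
move=> cC fL fnd f0 e e0; apply: contrapT => hn.
pose V n := [set mu : Ppi_p_space X pi p | C mu /\ e%:E <= Np p (\val mu) (f n)].
have V0 n : V n !=set0.
  apply: contrapT => h; apply: hn; exists n => mu Cmu; rewrite ltNge; apply/negP => h'.
  by apply: h; exists mu.
have Np_nd (mu : Ppi_p_space X pi p) n m : (n <= m)%N ->
    Np p (\val mu) (f m) <= Np p (\val mu) (f n).
  move=> nm; have [fm0 _] := fL m; have [fn0 _] := fL n.
  apply: lee_poweRl; first by rewrite invr_ge0 ltW.
    by apply: integral_ge0 => z _; rewrite lee_fin powR_ge0.
  apply: ge0_le_integral => //.
  - by move=> z _; rewrite lee_fin powR_ge0.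
  - exact: (measurable_powR_EFin p (measurable_lipschitz1 (fL m))).
  - exact: (measurable_powR_EFin p (measurable_lipschitz1 (fL n))).
  - by move=> z _; rewrite lee_fin; apply: ler_powRl => //; [rewrite ltW|exact: fnd].
have Vnd n m : (n <= m)%N -> V m `<=` V n.
  by move=> nm mu [Cmu h]; split; [exact: Cmu|exact: le_trans h (Np_nd mu n m nm)].
pose F := filter_from setT V.
have FF : ProperFilter F.
  apply: filter_from_proper => //; apply: filter_from_filter; first by exists 0%N.
  move=> n m _ _; exists (maxn n m); first exact: I.
  by move=> mu Vmu; split; [apply: (Vnd _ _ (leq_maxl n m))|
    apply: (Vnd _ _ (leq_maxr n m))].
have [|mu [Cmu clu]] := cC F FF; first by exists 0%N => // mu [].
have /fine_cvgP[[N1 _ h1] /cvgrPdist_lt/(_ e e0)[N2 _ h2]] := f0 mu Cmu.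
pose n := maxn N1 N2.
have small : Np p (\val mu) (f n) < e%:E.
  have := h2 n (leq_maxr _ _); rewrite /= sub0r normrN => h.
  rewrite -(fineK (h1 n (leq_maxl _ _))) lte_fin.
  by apply: le_lt_trans h; exact: ler_norm.
have FVn : F (V n) by exists n.
have nmu : nbhs mu [set nu : Ppi_p_space X pi p | Np p (\val nu) (f n) < e%:E].
  by apply: open_nbhs_nbhs; split; [exact: open_Np_lt|exact: small].
have [nu [[_ h] h']] := clu _ _ FVn nmu.
by move: h'; rewrite /= ltNge h.
Qed.

End wasserstein_lipschitz.

(** * Distance to finitely many points, total boundedness, limits of [Np] *)

Section finite_distance.
Context {R : realType} {T : ptopologicalType} {D : T -> T -> R} {q : nat -> T}.
Hypothesis pD : polish_dist D q.

(** The points q 0 to q n are involved. Sublevel sets play the role of finite unions of balls, while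
    the function itself is 1-Lipschitz. *)
Fixpoint fdist n x : R :=
  if n is n'.+1 then Num.min (fdist n' x) (D x (q n)) else D x (q 0%N).

Lemma fdist_ge0 n x : 0 <= fdist n x.
Proof. by elim: n => [|n IH] /=; rewrite ?le_min ?IH (pd_ge0 pD). Qed.

Lemma fdist_le n i x : (i <= n)%N -> fdist n x <= D x (q i).
Proof.
elim: n => [|n IH] /=; first by rewrite leqn0 => /eqP ->.
by rewrite leq_eqVlt => /predU1P[->|/IH]; rewrite ge_min ?lexx ?orbT// => ->.
Qed.

Lemma fdist_nd n m x : (n <= m)%N -> fdist m x <= fdist n x.
Proof.
move=> /subnK <-; elim: (m - n)%N => // k IH.
by rewrite addSn /= ge_min IH.
Qed.

Lemma fdist_ltP n x e : fdist n x < e -> exists2 i, (i <= n)%N & D x (q i) < e.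
Proof.
elim: n => [|n IH] /=; first by exists 0%N.
by rewrite gt_min => /orP[/IH[i /leqW ? ?]|?]; [exists i|exists n.+1].
Qed.

Lemma fdist_leD n x y : fdist n x <= fdist n y + D x y.
Proof.
elim: n => [|n IH] /=; first by rewrite addrC; exact: (pd_tri pD).
have := pd_tri pD y x (q n.+1); rewrite addrC => h.
by rewrite addr_minl le_min !ge_min IH h orbT.
Qed.

Lemma fdist_lipschitz n x y : `|fdist n x - fdist n y| <= D x y.
Proof.
have := fdist_leD n x y; have := fdist_leD n y x; rewrite (pd_sym pD y x).
by rewrite ler_norml => ? ?; apply/andP; split; lra.
Qed.

Lemma fdist_cvg0 x : fdist n x @[n --> \oo] --> 0.
Proof.
apply/cvgrPdist_lt => e e0; have [i ie] := pd_dense pD x e0.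
exists i => // n /= ni; rewrite sub0r normrN ger0_norm ?fdist_ge0//.
exact: le_lt_trans (fdist_le x ni) ie.
Qed.

End finite_distance.
Arguments fdist {R T} D q n x.

Lemma ultra_bigcup_seq (I : eqType) (T : Type) (F : set_system T) (s : seq I)
    (A : I -> set T) : UltraFilter F ->
  F (\bigcup_(i in [set` s]) A i) -> exists2 i, i \in s & F (A i).
Proof.
move=> UF; elim: s => [|i s IH] FU.
  by exfalso; apply: (@filter_not_empty _ F); apply: filterS FU => x [].
have [Fi|Fi] := in_ultra_setVsetC (A i) UF; first by exists i; rewrite ?mem_head.
have [|j js Fj] := IH; last by exists j => //; rewrite inE js orbT.
apply: filterS2 FU Fi => x [j /=]; rewrite inE => /predU1P[->//|js Aj] _.
by exists j.
Qed.

(** An ultrafilter on [K] contains one of the finitely many balls of each radius, so it is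
    Cauchy. *)
Lemma totally_bounded_compact (R : realType) (T : completePseudoMetricType R)
    (K : set T) : closed K ->
  (forall e : R, 0 < e -> exists s : seq T,
    K `<=` \bigcup_(y in [set` s]) ball y e) -> compact K.
Proof.
move=> clK tb; rewrite compact_ultra => F UF FK.
have : cvg F.
  apply: cauchy_cvg; apply: cauchy_exP => e e0; have [s hs] := tb e e0.
  have [y _ Fy] := ultra_bigcup_seq UF (filterS hs FK).
  by exists y.
move=> /cvg_ex[l Fl]; exists l; split => //; apply: clK => U nU.
by apply: (@filter_ex _ F); apply: filterI => //; exact: Fl.
Qed.

Section Np_limits.
Context {R : realType}.
Variable p : R.
Hypothesis p1 : 1 <= p.
Local Open Scope ereal_scope.
Context d (T : measurableType d) (mu : {measure set T -> \bar R}).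

Let p0 : (0 < p)%R. Proof. exact: lt_le_trans p1. Qed.

Lemma Np_dominated_cvg0 (f : nat -> T -> measurableTypeR R) (g : T -> measurableTypeR R) :
  (forall n, measurable_fun setT (f n)) -> measurable_fun setT g ->
  (forall n z, 0 <= f n z <= g z)%R ->
  {ae mu, forall z, f n z @[n --> \oo] --> 0%R} ->
  \int[mu]_z (g z `^ p)%:E < +oo ->
  Np p mu (f n) @[n --> \oo] --> 0.
Proof.
move=> mf mg fg fcvg ifin.
have f0 n z : (0 <= f n z)%R by have /andP[] := fg n z.
have mfp n := measurable_powR_EFin p (mf n).
have [] := @dominated_convergence _ _ _ mu _ measurableT
  (fun n z => (f n z `^ p)%:E) (cst 0) (fun z => (g z `^ p)%:E).
- exact: mfp.
- exact: measurable_cst.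
- apply: filterS fcvg => z /cvgrPdist_lt h _; apply: cvg_EFin; first exact: nearW.
  apply/cvgrPdist_lt => e e0.
  have e1 : (0 < e `^ p^-1)%R by exact: powR_gt0.
  apply: filterS (h _ e1) => n; rewrite /= !sub0r !normrN.
  rewrite !ger0_norm ?powR_ge0// => fe.
  rewrite -[e](@powRr1 R) ?ltW// -(@mulVf _ p) ?gt_eqF// powRrM.
  by apply: gt0_ltr_powR; rewrite // nnegrE// powR_ge0.
- apply/integrableP; split; first exact: measurable_powR_EFin.
  by under eq_integral do rewrite gee0_abs ?lee_fin ?powR_ge0//.
- apply: aeW => z n _; rewrite gee0_abs ?lee_fin ?powR_ge0//.
  by have /andP[? ?] := fg n z; apply: ler_powRl; rewrite // ltW.
move=> _ _; rewrite integral0 => /fine_cvgP[h1 /cvgrPdist_le h2].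
have near_le e : (0 < e)%R -> \forall n \near \oo, Np p mu (f n) <= e%:E.
  move=> e0; have ep0 : (0 < e `^ p)%R by exact: powR_gt0.
  apply: filterS2 h1 (h2 _ ep0) => n fn; rewrite /= sub0r normrN => h.
  apply/(Np_le p1); first exact: ltW.
  by have := le_trans (ler_norm _) h; rewrite -lee_fin fineK.
apply/fine_cvgP; split.
  apply: filterS (near_le 1%R ltr01) => n h.
  by rewrite ge0_fin_numE ?Np_ge0// (le_lt_trans h)// ltry.
apply/cvgrPdist_le => e e0; apply: filterS (near_le e e0) => n h.
rewrite /= sub0r normrN ger0_norm ?fine_ge0 ?Np_ge0//.
rewrite -lee_fin fineK// ge0_fin_numE ?Np_ge0//.
by rewrite (le_lt_trans h)// ltry.
Qed.

Lemma Np_cvg0 (f : nat -> T -> measurableTypeR R) :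
  (forall n, measurable_fun setT (f n)) -> (forall n z, 0 <= f n z)%R ->
  (forall n z, f n z <= f 0%N z)%R ->
  (forall z, f n z @[n --> \oo] --> 0%R) ->
  \int[mu]_z (f 0%N z `^ p)%:E < +oo ->
  Np p mu (f n) @[n --> \oo] --> 0.
Proof.
move=> mf f0 fle fcvg; apply: Np_dominated_cvg0 => //; last exact: aeW.
by move=> n z; rewrite f0 fle.
Qed.

Lemma Np_markov (f : T -> measurableTypeR R) (c : R) :
  measurable_fun setT f -> (forall z, 0 <= f z)%R -> (0 < c)%R ->
  (c `^ p)%:E * mu [set z | c <= f z]%R <= Np p mu f `^ p.
Proof.
move=> mf f0 c0; have mS := measurable_ge c mf.
rewrite (NpK p1) -(integral_cst _ mS).
apply: (@le_trans _ _ (\int[mu]_(z in [set z | c <= f z]%R) (f z `^ p)%:E)).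
  apply: ge0_le_integral => //.
  - by move=> z _; rewrite lee_fin powR_ge0.
  - by apply: measurable_funTS; exact: measurable_powR_EFin.
  - by move=> z /= cz; rewrite lee_fin; apply: ler_powRl => //; rewrite ltW.
apply: ge0_subset_integral => //; first exact: measurable_powR_EFin.
by move=> z _; rewrite lee_fin powR_ge0.
Qed.

End Np_limits.

(** * Compact closure implies uniform integrability and tightness *)

Section necessity.
Context {R : realType} {Om : completeMetricType R}
  {X : completeNormedModType R}.
Variables (sepOm : separable Om) (sepX : separable X).
Variable p : R.
Hypothesis p1 : 1 <= p.
Implicit Type (mu nu : probability (borel (Om * X)%type) R)
  (pi : probability (borel Om) R).

Let p0 : 0 < p. Proof. exact: lt_le_trans p1. Qed.

(** The maximum is 1-Lipschitz for [prod_dist] for every [p], which the sum is not when p > 1. *)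
Definition far w0 (z : Om * X) : R := Num.max (mdist z.1 w0) `|z.2|.

(** A 1-Lipschitz substitute for [far] restricted to its superlevel set at [k], a discontinuous
    function. *)
Definition excess w0 (k : R) z : R := Num.max 0 (far w0 z - k).

Lemma far_ge0 w0 z : 0 <= far w0 z.
Proof. by rewrite le_max mdist_ge0. Qed.

Lemma far_leD w0 z z' : far w0 z <= far w0 z' + prod_dist p z z'.
Proof.
have h1 := mdist_prod_dist p1 z z'; have h2 := norm_prod_dist p1 z z'.
have h3 := metric_triangle z.1 z'.1 w0.
have h4 : `|z.2| <= `|z'.2| + `|z.2 - z'.2|.
  by rewrite -{1}(subrK z'.2 z.2) addrC ler_normD.
have h5 : mdist z'.1 w0 <= far w0 z' by rewrite le_max lexx.
have h6 : `|z'.2| <= far w0 z' by rewrite le_max lexx orbT.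
by rewrite ge_max; apply/andP; split; lra.
Qed.

Lemma excess_ge0 w0 k z : 0 <= excess w0 k z.
Proof. by rewrite le_max lexx. Qed.

Lemma excess_lipschitz1 w0 k : lipschitz1 p (excess w0 k).
Proof.
split=> [z|z z']; first exact: excess_ge0.
have h z1 z2 : excess w0 k z1 <= excess w0 k z2 + prod_dist p z1 z2.
  have := far_leD w0 z1 z2; have := prod_dist_ge0 p z1 z2.
  have h1 : 0 <= excess w0 k z2 by exact: excess_ge0.
  have h2 : far w0 z2 - k <= excess w0 k z2 by rewrite le_max lexx orbT.
  by move=> h3 h4; rewrite ge_max; apply/andP; split; lra.
have := h z z'; have := h z' z; rewrite (prod_distC p z' z) ler_norml => ? ?.
by apply/andP; split; lra.
Qed.

Lemma excess_nd w0 k k' z : k <= k' -> excess w0 k' z <= excess w0 k z.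
Proof.
move=> kk'; rewrite ge_max excess_ge0/= le_max; apply/orP; right.
by rewrite lerD2l lerN2.
Qed.

Lemma excess_cvg0 w0 z : excess w0 n%:R z @[n --> \oo] --> 0.
Proof.
apply: cvg_near_cst; near=> n; apply/max_idPl.
rewrite subr_le0; near: n; exact: nbhs_infty_ger.
Unshelve. all: end_near. Qed.

Lemma pow_far w0 z : far w0 z `^ p <= mdist z.1 w0 `^ p + `|z.2| `^ p.
Proof.
rewrite /far; have [_|_] := leP (mdist z.1 w0) `|z.2|.
  by rewrite lerDr powR_ge0.
by rewrite lerDl powR_ge0.
Qed.

Local Open Scope ereal_scope.

Lemma integral_fst_mdist pi mu w0 (A : set (borel Om)) : first_marginal pi mu ->
  measurable A ->
  \int[mu]_(z in fst @^-1` A) (mdist z.1 w0 `^ p)%:E =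
  \int[pi]_(w in A) (mdist w w0 `^ p)%:E.
Proof.
move=> fm mA; symmetry.
apply: (law_integral measurable_borel_fst (fun A mA => esym (fm A mA))) => //.
- apply: measurable_funTS; apply: measurable_powR_EFin.
  exact: measurable_mdist.
- by move=> w; rewrite lee_fin powR_ge0.
Qed.

Lemma measurable_far_fun w0 :
  measurable_fun setT (far w0 : borel (Om * X)%type -> measurableTypeR R).
Proof.
apply: measurable_maxr; first exact: measurable_fst_mdist.
exact: measurable_snd_norm.
Qed.

Lemma integral_far_lty pi mu w0 : Ppi_p pi p mu ->
  \int[pi]_w (mdist w w0 `^ p)%:E < +oo -> \int[mu]_z (far w0 z `^ p)%:E < +oo.
Proof.
move=> [fm mup] dfin.
have md : measurable_fun setT
    ((fun z => (mdist z.1 w0 `^ p)%:E) : borel (Om * X)%type -> \bar R).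
  by apply: measurable_powR_EFin; exact: measurable_fst_mdist.
apply: (@le_lt_trans _ _ (\int[mu]_z ((mdist z.1 w0 `^ p)%:E + (`|z.2| `^ p)%:E))).
  apply: ge0_le_integral => //.
  - by move=> z _; rewrite lee_fin powR_ge0.
  - by apply: measurable_powR_EFin; exact: measurable_far_fun.
  - apply: emeasurable_funD => //; exact: measurable_snd_pow.
  - by move=> z _; rewrite -EFinD lee_fin pow_far.
rewrite ge0_integralD//; last 2 first.
- by move=> z _; rewrite lee_fin powR_ge0.
- exact: measurable_snd_pow.
rewrite lte_add_pinfty//.
  rewrite [X in X < _](_ : _ = \int[mu]_(z in fst @^-1` setT) (mdist z.1 w0 `^ p)%:E).
    by rewrite (integral_fst_mdist w0 fm).
  by rewrite preimage_setT.
move: mup; rewrite (integral_moment_disintegration sepOm sepX p1 fm)//.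
Qed.

Lemma Ppi_excess_cvg0 pi mu w0 : Ppi_p pi p mu ->
  \int[pi]_w (mdist w w0 `^ p)%:E < +oo ->
  Np p mu (excess w0 n%:R) @[n --> \oo] --> 0.
Proof.
move=> Pmu dfin; apply: (@Np_cvg0 _ p p1 _ _ mu (fun n => excess w0 n%:R)).
- by move=> n; apply: measurable_lipschitz1 (excess_lipschitz1 w0 _).
- by move=> n z; exact: excess_ge0.
- by move=> n z; apply: excess_nd; rewrite ler0n.
- exact: excess_cvg0.
rewrite (_ : excess w0 0%N%:R = far w0); first exact: integral_far_lty Pmu dfin.
by apply/funext => z; rewrite /excess subr0; apply/max_idPr; exact: far_ge0.
Qed.

(** If d + |x| >= 4k then [far] is at least 2k, so |x| <= far <= 2 (far - k); hence the factor
    2^p. *)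
Lemma moment_on_excess mu w0 (k : R) : (0 <= k)%R ->
  moment_on p mu [set z | (4 * k <= mdist z.1 w0 + `|z.2|)%R] <=
  (2 `^ p)%:E * \int[mu]_z (excess w0 k z `^ p)%:E.
Proof.
move=> k0; have me : measurable_fun setT
    (excess w0 k : borel (Om * X)%type -> measurableTypeR R).
  exact: measurable_lipschitz1 (excess_lipschitz1 w0 _).
rewrite -ge0_integralZl_EFin ?powR_ge0//; last 2 first.
- by move=> z _; rewrite lee_fin powR_ge0.
- exact: measurable_powR_EFin.
rewrite /moment_on [leLHS]integral_mkcond; apply: ge0_le_integral => //.
- by move=> z _; rewrite patchE; case: ifP => // _; rewrite lee_fin powR_ge0.
- apply/(measurable_restrictT _ (measurable_far sepOm sepX w0 _)).
  by apply: measurable_funTS; exact: measurable_snd_pow.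
- by apply: measurable_funeM; exact: measurable_powR_EFin.
move=> z _; rewrite patchE; case: ifPn => [|_]; last by rewrite -EFinM lee_fin mulr_ge0// powR_ge0.
rewrite inE/= => h; rewrite -EFinM lee_fin -powRM ?excess_ge0//.
apply: ler_powRl => //; first exact: ltW.
have h1 : (mdist z.1 w0 <= far w0 z)%R by rewrite le_max lexx.
have h2 : (`|z.2| <= far w0 z)%R by rewrite le_max lexx orbT.
have h3 : (far w0 z - k <= excess w0 k z)%R by rewrite le_max lexx orbT.
by lra.
Qed.

Lemma compact_unif_integrable pi (C : set (Ppi_p_space X pi p))
    (K : set (probability (borel (Om * X)%type) R)) w0 :
  compact C -> (forall mu, K mu -> exists2 a : Ppi_p_space X pi p, C a & \val a = mu) ->
  \int[pi]_w (mdist w w0 `^ p)%:E < +oo -> unif_integrable p K w0.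
Proof.
move=> cC KC dfin; apply/(unif_integrableP sepOm sepX) => e e0.
(* Chosen so that the factor 2^p of [moment_on_excess] turns the p-th power of this bound into
   [e]. *)
have e1 : (0 < e `^ p^-1 / 2)%R by rewrite divr_gt0// powR_gt0.
have [n hn] := compact_Np_small sepOm sepX p1 cC (fun n => excess_lipschitz1 w0 n%:R)
  (fun n m z nm => excess_nd w0 z (ltac:(by rewrite ler_nat) : n%:R <= m%:R)%R)
  (fun (a : Ppi_p_space X pi p) _ => Ppi_excess_cvg0 (set_mem (valP a)) dfin) e1.
exists (4 * n%:R)%R => mu /KC[a Ca <-].
apply: le_trans (moment_on_excess _ w0 (ler0n _ n)) _.
have := (Np_le p1 (\val a) (excess w0 n%:R) (ltW e1)).1 (ltW (hn _ Ca)).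
move=> h; apply: (@le_trans _ _ ((2 `^ p)%:E * ((e `^ p^-1 / 2) `^ p)%:E)).
  by apply: lee_wpmul2l => //; rewrite lee_fin powR_ge0.
rewrite -EFinM lee_fin -powRM// ?(ltW e1)// mulrCA mulfV// mulr1.
by rewrite -powRrM mulVf ?gt_eqF// powRr1// ltW.
Qed.

Section tightness.
Variables (q : nat -> X) (pX : polish_dist (fun x y : X => `|x - y|%R) q).
Local Notation fd := (fdist (fun x y : X => `|x - y|%R) q).

(** Truncation at 1 makes dominated convergence available under every law, and the levels 2^-m used
    for tightness do not exceed 1. *)
Definition trunc_dist n (z : Om * X) : R := Num.min 1%R (fd n z.2).

Lemma trunc_dist_ge0 n z : (0 <= trunc_dist n z)%R.
Proof. by rewrite le_min ler01 (fdist_ge0 pX). Qed.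

Lemma trunc_dist_lipschitz1 n : lipschitz1 p (trunc_dist n).
Proof.
split=> [z|z z']; first exact: trunc_dist_ge0.
have h z1 z2 : (trunc_dist n z1 <= trunc_dist n z2 + prod_dist p z1 z2)%R.
  have h1 := fdist_leD pX n z1.2 z2.2; have h2 := norm_prod_dist p1 z1 z2.
  have h3 := prod_dist_ge0 p z1 z2.
  rewrite /trunc_dist addr_minl le_min !ge_min; apply/andP; split; apply/orP.
    by left; lra.
  by right; lra.
have := h z z'; have := h z' z; rewrite (prod_distC p z' z) ler_norml => ? ?.
by apply/andP; split; lra.
Qed.

Lemma Ppi_trunc_dist_cvg0 mu : Np p mu (trunc_dist n) @[n --> \oo] --> 0.
Proof.
apply: (@Np_cvg0 _ p p1 _ _ mu trunc_dist).
- by move=> n; apply: measurable_lipschitz1 (trunc_dist_lipschitz1 n).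
- by move=> n z; exact: trunc_dist_ge0.
- move=> n z; rewrite /trunc_dist le_min !ge_min lexx/=.
  by apply/orP; right; exact: (fdist_le (D := fun x y : X => `|x - y|%R) _ (leq0n n)).
- move=> z; apply/cvgrPdist_lt => e e0.
  have /cvgrPdist_lt/(_ e e0) := fdist_cvg0 pX z.2.
  apply: filterS => n; rewrite !sub0r !normrN.
  rewrite !ger0_norm ?trunc_dist_ge0 ?(fdist_ge0 pX)// => h.
  by rewrite gt_min h orbT.
apply: (@le_lt_trans _ _ (\int[mu]_z (cst 1 z))).
  apply: ge0_le_integral => //.
  - by move=> z _; rewrite lee_fin powR_ge0.
  - apply: measurable_powR_EFin.
    by apply: measurable_lipschitz1 (trunc_dist_lipschitz1 _).
  move=> z _; rewrite lee_fin (_ : 1%R = 1 `^ p)%R; last by rewrite powR1.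
  apply: (ler_powRl (ltW p0) (trunc_dist_ge0 _ _)).
  by rewrite /trunc_dist ge_min lexx.
by rewrite integral_cst// mul1e (le_lt_trans (probability_le1 _ _))// ltry.
Qed.

Lemma closed_fdist_le n (c : R) : closed [set x : X | (fd n x <= c)%R].
Proof.
have cf : continuous (fd n : X -> R).
  apply: (@pd_lipschitz_continuous _ _ _ _ pX _ 1%R) => x y; rewrite mul1r.
  exact: fdist_lipschitz.
exact: (closed_comp (fun x _ => cf x) (@closed_le R c)).
Qed.

(** The set is closed, and at scale 2^-m the points q 0 to q (N m) form a finite net. *)
Lemma compact_fdist (N : nat -> nat) :
  compact (\bigcap_m [set x : X | (fd (N m) x <= 2^-1 ^+ m)%R]).
Proof.
apply: totally_bounded_compact.
  by apply: closed_bigI => m _; exact: closed_fdist_le.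
move=> e e0; have [m _ /(_ m (leqnn _))/= hm] := expr_half_lt 1%R e0.
exists [seq q i | i <- iota 0 (N m).+1] => x /(_ m I)/= xm.
have [|i iN xi] := @fdist_ltP _ _ (fun x y : X => `|x - y|%R) q (N m) x e.
  by rewrite (le_lt_trans xm)//; move: hm; rewrite mul1r.
exists (q i).
  by apply: (@map_f _ _ q (iota 0 (N m).+1)); rewrite mem_iota.
by rewrite -ball_normE /= distrC.
Qed.

End tightness.

Lemma compact_fibrely_tight pi (C : set (Ppi_p_space X pi p))
    (K : set (probability (borel (Om * X)%type) R)) :
  compact C ->
  (forall mu, K mu -> exists2 a : Ppi_p_space X pi p, C a & \val a = mu) ->
  fibrely_tight K.
Proof.
move=> cC KC eps eps0; have [q pX] := polish_dist_normed sepX.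
(* The bounds [b m] add up to eps / 2, which leaves room for the strict inequality. *)
pose b (m : nat) : R := (eps / 2 / (2 ^ m.+1)%:R)%R.
have b0 m : (0 < b m)%R by rewrite divr_gt0 ?divr_gt0// ltr0n expn_gt0.
(* With this bound on [Np], Markov's inequality at level 2^-m gives mass at most [b m]. *)
pose c (m : nat) : R := (2^-1 ^+ m * b m `^ p^-1)%R.
have c0 m : (0 < c m)%R by rewrite mulr_gt0 ?powR_gt0// expr_half_gt0.
have tnd n n' z : (n <= n')%N -> (trunc_dist q n' z <= trunc_dist q n z)%R.
  move=> nn'; rewrite /trunc_dist le_min !ge_min lexx/=.
  by apply/orP; right; exact: (fdist_nd (D := fun x y : X => `|x - y|%R)).
have hN m : exists n, forall a, C a -> Np p (\val a) (trunc_dist q n) < (c m)%:E.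
  apply: (compact_Np_small sepOm sepX p1 cC) => //.
    exact: trunc_dist_lipschitz1 pX.
  by move=> a _; exact: Ppi_trunc_dist_cvg0 pX _.
have [N NP] := choice hN.
have cK := @compact_fdist _ pX N.
exists (\bigcap_m [set x : X | (fdist (fun x y : X => `|x - y|) q (N m) x <= 2^-1 ^+ m)%R]).
  exact: cK.
set Ke := \bigcap_m _.
apply: (@le_lt_trans _ _ (eps / 2)%:E); last by rewrite lte_fin; lra.
apply/le_sup_ge0 => [|mu Kmu]; first by rewrite lee_fin divr_ge0// ltW.
have clKe : closed Ke by apply: closed_bigI => m _; exact: closed_fdist_le.
pose S (m : nat) : set (borel (Om * X)%type) :=
  [set z | (2^-1 ^+ m <= trunc_dist q (N m) z)%R].
have mt m : measurable_fun setT
    (trunc_dist q (N m) : borel (Om * X)%type -> measurableTypeR R).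
  exact: measurable_lipschitz1 (trunc_dist_lipschitz1 pX _).
have mS m : measurable (S m) by exact: measurable_ge (mt m).
have muS m : mu (S m) <= (b m)%:E.
  have h0 : (0 < 2^-1 ^+ m :> R)%R by exact: expr_half_gt0.
  have := Np_markov p1 mu (mt m) (trunc_dist_ge0 pX _) h0.
  have [a Ca aE] := KC _ Kmu.
  have hlt := ltW (NP m a Ca); rewrite aE in hlt.
  have h := lee_poweRl (ltW p0) (Np_ge0 p mu (trunc_dist q (N m))) hlt.
  move=> /le_trans/(_ h); rewrite poweR_EFin /c powRM ?powR_ge0 ?(ltW h0)// -powRrM mulVf ?gt_eqF//.
  by rewrite powRr1 ?(ltW (b0 m))// EFinM lee_pmul2l// ?lte_fin ?powR_gt0.
(* A point outside [Ke] violates one of the conditions defining it, hence lies over some [S m]. *)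
apply: (@le_trans _ _ (\sum_(m <oo) mu (S m))).
  apply: measure_sigma_subadditive => //.
    apply: measurable_borel_setX => //; apply: measurableC.
    exact: measurable_borel_closed.
  move=> [w x] [_ /= xK]; apply: contrapT => h; apply: xK => m _ /=.
  rewrite leNgt; apply/negP => xm; apply: h; exists m => //=.
  rewrite /S/= /trunc_dist/= le_min (ltW xm) andbT.
  by rewrite exprn_ile1// ?invr_ge0// invf_le1// ler1n.
apply: le_trans (epsilon_trick0 xpredT (ltac:(by rewrite divr_ge0// ltW) : 0 <= eps / 2)%R).
exact: lee_nneseries.
Qed.

End necessity.

(** * Bounds stable under closure *)

Section polish_tightness.
Context {R : realType} {T : ptopologicalType} {D : T -> T -> R} {q : nat -> T}.
Hypothesis pD : polish_dist D q.

Lemma measurable_fdist n :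
  measurable_fun setT (fdist D q n : borel T -> measurableTypeR R).
Proof.
apply: continuous_real_measurable.
apply: (@pd_lipschitz_continuous _ _ _ _ pD _ 1) => x y; rewrite mul1r.
exact: fdist_lipschitz.
Qed.

Lemma compact_fdist_lt (K : set T) e : compact K -> 0 < e ->
  exists n, forall x, K x -> fdist D q n x < e.
Proof.
rewrite compact_cover => cK e0.
have [||s _ hs] := cK nat setT (fun i => [set x | D (q i) x < e]).
- by move=> i _; exact: (pd_open_ball pD).
- move=> x _; have [i xi] := pd_dense pD x e0.
  by exists i => //=; rewrite (pd_sym pD).
exists (\max_(i <- finmap.enum_fset s) i)%N => x /hs[i /= si xi].
apply: le_lt_trans xi; rewrite (pd_sym pD); apply: fdist_le.
exact: (@leq_bigmax_seq _ _ xpredT id).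
Qed.

(** Ulam's tightness of a single law: these sets decrease to the empty set by density of [q].
    Applied to [pi], it controls the [Om] component, about which fibre tightness says nothing. *)
Lemma probability_fdist (nu : probability (borel T) R) e (eta : R) :
  0 < e -> 0 < eta -> exists n, (nu [set x | e <= fdist D q n x]%R <= eta%:E)%E.
Proof.
move=> e0 eta0; pose F n : set (borel T) := [set x | e <= fdist D q n x].
have mF n : measurable (F n) by exact: measurable_ge (measurable_fdist n).
have F0 : \bigcap_n F n = set0.
  apply/seteqP; split => // x h; have /cvgrPdist_lt/(_ e e0)[n _ hn] := fdist_cvg0 pD x.
  have := hn n (leqnn _); rewrite /= sub0r normrN ger0_norm ?(fdist_ge0 pD)//.
  by rewrite ltNge => /negP; apply; exact: h.
have : nu (F n) @[n --> \oo] --> nu (\bigcap_n F n).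
  apply: nonincreasing_cvg_mu => //.
  - by rewrite (le_lt_trans (probability_le1 _ (mF 0%N)))// ltry.
  - by apply: bigcapT_measurable.
  - move=> n m nm; apply/subsetPset => x; rewrite /F/= => /le_trans; apply.
    exact: fdist_nd.
rewrite F0 measure0 => /fine_cvgP[[N1 _ h1] /cvgrPdist_le/(_ _ eta0)[N2 _ h2]].
exists (maxn N1 N2).
have /= h3 := h1 (maxn N1 N2) (leq_maxl _ _).
have := h2 (maxn N1 N2) (leq_maxr _ _).
rewrite /= sub0r normrN -lee_fin => h; rewrite -(fineK h3).
by apply: le_trans h; rewrite lee_fin ler_norm.
Qed.

End polish_tightness.

Section sufficiency_bounds.
Context {R : realType} {Om : completeMetricType R}
  {X : completeNormedModType R}.
Variables (sepOm : separable Om) (sepX : separable X).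
Variable p : R.
Hypothesis p1 : 1 <= p.
Implicit Type (mu nu : probability (borel (Om * X)%type) R)
  (pi : probability (borel Om) R).
Local Open Scope ereal_scope.

Let p0 : (0 < p)%R. Proof. exact: lt_le_trans p1. Qed.

Lemma closure_Np_le pi (K : set (Ppi_p_space X pi p)) f (c : R) :
  lipschitz1 p f -> (forall a, K a -> Np p (\val a) f <= c%:E) ->
  forall a, closure K a -> Np p (\val a) f <= c%:E.
Proof.
move=> fL h a Ca.
have cl : closed [set a : Ppi_p_space X pi p | Np p (\val a) f <= c%:E].
  exact: closed_Np_le.
by apply: (cl a); apply: closureS Ca => b /h.
Qed.

Lemma integral_mdist_tail pi w0 : \int[pi]_w (mdist w w0 `^ p)%:E < +oo ->
  forall e : R, (0 < e)%R -> exists n, forall k : R, (n%:R <= k)%R ->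
    \int[pi]_(w in [set w : Om | k <= mdist w w0]%R) (mdist w w0 `^ p)%:E <= e%:E.
Proof.
move=> dfin e e0.
pose A (k : R) : set (borel Om) := [set w | k <= mdist w w0]%R.
have mA k : measurable (A k) by exact: measurable_ge (measurable_mdist sepOm w0).
pose h n w : R := (mdist w w0 * \1_(A n%:R) w)%R.
have mh n : measurable_fun setT (h n : borel Om -> measurableTypeR R).
  exact: measurable_funM (measurable_mdist sepOm w0) (measurable_indic (mA _)).
have h0 n w : (0 <= h n w)%R by rewrite mulr_ge0// mdist_ge0.
have : Np p pi (h n) @[n --> \oo] --> 0.
  apply: (@Np_cvg0 _ p p1 _ _ pi h).
  - exact: mh.
  - exact: h0.
  - move=> n w; rewrite /h ler_wpM2l ?mdist_ge0// !indicE.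
    (* At rank 0 the cut is the whole space, so [h 0] dominates all the others. *)
    rewrite (_ : w \in A 0%:R)//; first by rewrite lern1 leq_b1.
    by rewrite inE /A/= mdist_ge0.
  - move=> w; apply: cvg_near_cst; near=> n.
    rewrite /h indicE memNset ?mulr0// /A/=; apply/negP; rewrite -ltNge.
    by near: n; exact: nbhs_infty_gtr.
  rewrite (_ : (fun w => _) = fun w => (mdist w w0 `^ p)%:E)//.
  apply/funext => w; rewrite /h indicE mem_set ?mulr1//.
  by rewrite /A/= mdist_ge0.
have ep0 : (0 < e `^ p^-1)%R by exact: powR_gt0.
move=> /fine_cvgP[[N1 _ h1] /cvgrPdist_le/(_ _ ep0)[N2 _ h2]].
pose n := maxn N1 N2; exists n => k nk.
have Nn : Np p pi (h n) <= (e `^ p^-1)%:E.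
  have := h2 n (leq_maxr _ _); rewrite /= sub0r normrN -lee_fin => hn'.
  rewrite -(fineK (h1 n (leq_maxl _ _))).
  by apply: le_trans hn'; rewrite lee_fin ler_norm.
move/(Np_le p1 _ _ (ltW ep0)) : Nn.
have -> : ((e `^ p^-1) `^ p = e)%R by rewrite -powRrM mulVf ?gt_eqF// powRr1// ltW.
apply: le_trans; rewrite [leLHS]integral_mkcond; apply: ge0_le_integral => //.
- by move=> w _; rewrite patchE; case: ifP => // _; rewrite lee_fin powR_ge0.
- apply/(measurable_restrictT _ (mA k)); apply: measurable_funTS.
  by apply: measurable_powR_EFin; exact: measurable_mdist.
- exact: measurable_powR_EFin.
move=> w _; rewrite patchE; case: ifPn => [|_]; last by rewrite lee_fin powR_ge0.
rewrite inE => kw; rewrite /h indicE mem_set ?mulr1//.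
by rewrite /A/= (le_trans nk).
Unshelve. all: end_near. Qed.

(** Where [far] exceeds [k], it equals one of the two terms, which then also exceeds [k]; elsewhere
    the excess vanishes. *)
Lemma excess_pow w0 (k : R) (z : Om * X) : (0 <= k)%R ->
  (excess w0 k z `^ p <=
   (if k <= mdist z.1 w0 then mdist z.1 w0 `^ p else 0) +
   (if k <= `|z.2| then `|z.2| `^ p else 0))%R.
Proof.
move=> k0; have [h|h] := leP (far w0 z) k.
  rewrite (_ : excess w0 k z = 0)%R; last by apply/max_idPl; rewrite subr_le0.
  rewrite powR0 ?gt_eqF// addr_ge0//; case: ifP => // _; exact: powR_ge0.
have le_far : (excess w0 k z <= far w0 z)%R.
  by rewrite ge_max far_ge0/= gerBl.
apply: le_trans (ler_powRl (ltW p0) (excess_ge0 _ _ _) le_far) _.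
move: h; rewrite /far; have [_|_] := leP (mdist z.1 w0) `|z.2|%R => h.
  by rewrite (ltW h) lerDr; case: ifP => // _; exact: powR_ge0.
by rewrite (ltW h) lerDl; case: ifP => // _; exact: powR_ge0.
Qed.

(** By [excess_pow] the excess splits in two: the tail in [Om] depends on [pi] alone and is the same
    for all members of [K], and the tail in [X] is covered by uniform integrability. *)
Lemma unif_integrable_excess pi (K : set (probability (borel (Om * X)%type) R)) w0 :
  K `<=` Ppi_p pi p -> \int[pi]_w (mdist w w0 `^ p)%:E < +oo ->
  unif_integrable p K w0 ->
  forall e : R, (0 < e)%R -> exists2 k : R, (0 <= k)%R &
    forall mu, K mu -> Np p mu (excess w0 k) <= e%:E.
Proof.
move=> KP dfin /(unif_integrableP sepOm sepX) ui e e0.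
have e2 : (0 < e `^ p / 2)%R by rewrite divr_gt0// powR_gt0.
have [k1 hk1] := ui _ e2.
have [n hn] := integral_mdist_tail dfin e2.
pose k := Num.max n%:R k1; exists k; first by rewrite le_max ler0n.
have k0 : (0 <= k)%R by rewrite le_max ler0n.
move=> mu Kmu; apply/(Np_le p1); first exact: ltW.
have mA : measurable ([set w | k <= mdist w w0]%R : set (borel Om)).
  exact: measurable_ge (measurable_mdist sepOm w0).
have mA' : measurable ([set z | k <= mdist z.1 w0]%R : set (borel (Om * X)%type)).
  exact: measurable_ge (measurable_fst_mdist sepOm w0).
have mB : measurable ([set z | k <= `|z.2|]%R : set (borel (Om * X)%type)).
  exact: measurable_ge (measurable_snd_norm sepOm sepX).
have [fm _] := KP _ Kmu.
pose f1 (z : borel (Om * X)%type) : \bar R :=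
  ((fun z => (mdist z.1 w0 `^ p)%:E) \_ [set z : Om * X | k <= mdist z.1 w0]%R) z.
pose f2 (z : borel (Om * X)%type) : \bar R :=
  ((fun z => (`|z.2| `^ p)%:E) \_ [set z : Om * X | k <= `|z.2|]%R) z.
have mf1 : measurable_fun setT f1.
  apply/(measurable_restrictT _ mA'); apply: measurable_funTS.
  by apply: measurable_powR_EFin; exact: measurable_fst_mdist.
have mf2 : measurable_fun setT f2.
  by apply/(measurable_restrictT _ mB); apply: measurable_funTS; exact: measurable_snd_pow.
have f10 z : 0 <= f1 z by rewrite /f1 patchE; case: ifP => // _; rewrite lee_fin powR_ge0.
have f20 z : 0 <= f2 z by rewrite /f2 patchE; case: ifP => // _; rewrite lee_fin powR_ge0.
apply: (@le_trans _ _ (\int[mu]_z (f1 z + f2 z))).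
  apply: ge0_le_integral => //.
  - by move=> z _; rewrite lee_fin powR_ge0.
  - apply: measurable_powR_EFin.
    by apply: measurable_lipschitz1 (excess_lipschitz1 p1 w0 _).
  - exact: emeasurable_funD.
  move=> z _; rewrite /f1 /f2 !patchE.
  have := excess_pow w0 z k0; rewrite -lee_fin EFinD => /le_trans; apply.
  by apply: leeD; case: ifPn => h; [rewrite mem_set|rewrite memNset//; exact/negP
    |rewrite mem_set|rewrite memNset//; exact/negP].
rewrite ge0_integralD// (splitr (e `^ p)) EFinD; apply: leeD.
  rewrite /f1 -integral_mkcond.
  have := integral_fst_mdist sepOm p w0 fm mA; rewrite (_ : _ @^-1` _ =
    [set z : Om * X | k <= mdist z.1 w0]%R)// => ->.
  by apply: hn; rewrite le_max lexx.
rewrite /f2 -integral_mkcond; apply: le_trans (hk1 _ Kmu).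
apply: moment_on_le => //; first exact: measurable_far.
move=> z /= kz; apply: (@le_trans _ _ `|z.2|%R); last by rewrite lerDr mdist_ge0.
by apply: le_trans kz; rewrite le_max lexx orbT.
Qed.

End sufficiency_bounds.

(** * Tightness as a bound on a Lipschitz function *)

Section tightness_transfer.
Context {R : realType} {Om : completeMetricType R}
  {X : completeNormedModType R}.
Variables (sepOm : separable Om) (sepX : separable X).
Variable p : R.
Hypothesis p1 : 1 <= p.
Implicit Type (mu nu : probability (borel (Om * X)%type) R)
  (pi : probability (borel Om) R).
Variables (q : nat -> Om * X) (pD : polish_dist sum_dist q).
Local Notation fd := (fdist sum_dist q).
Local Open Scope ereal_scope.

Let p0 : (0 < p)%R. Proof. exact: lt_le_trans p1. Qed.

(** The division by 2 compensates [sum_dist] being at most twice [prod_dist], so the function is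
    1-Lipschitz for the latter. *)
Definition trunc_sum_dist n (z : Om * X) : R := Num.min 1%R (fd n z / 2)%R.

Lemma trunc_sum_dist_ge0 n z : (0 <= trunc_sum_dist n z)%R.
Proof. by rewrite le_min ler01 divr_ge0// (fdist_ge0 pD). Qed.

Lemma trunc_sum_dist_lipschitz1 n : lipschitz1 p (trunc_sum_dist n).
Proof.
split=> [z|z z']; first exact: trunc_sum_dist_ge0.
have h z1 z2 : (trunc_sum_dist n z1 <= trunc_sum_dist n z2 + prod_dist p z1 z2)%R.
  have h1 := fdist_leD pD n z1 z2; have h2 := norm_prod_dist p1 z1 z2.
  have h3 := prod_dist_ge0 p z1 z2; have h4 := mdist_prod_dist p1 z1 z2.
  rewrite /sum_dist in h1.
  rewrite /trunc_sum_dist addr_minl le_min !ge_min; apply/andP; split; apply/orP.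
    by left; lra.
  by right; lra.
have := h z z'; have := h z' z; rewrite (prod_distC p z' z) ler_norml => ? ?.
by apply/andP; split; lra.
Qed.

(** Fibre tightness handles [X] and tightness of [pi] handles [Om], as all members of [K] share this
    marginal. The three thirds of [r] are the errors in [Om], in [X], and in approximating the pair
    of centres by a point of [q]. *)
Lemma fibrely_tight_fdist pi (K : set (probability (borel (Om * X)%type) R))
    (r eta : R) :
  K `<=` Ppi_p pi p -> fibrely_tight K -> (0 < r)%R -> (0 < eta)%R ->
  exists n, forall mu, K mu -> mu [set z | r <= fd n z]%R <= eta%:E.
Proof.
move=> KP tK r0 eta0.
have [qO pO] := polish_dist_metric sepOm.
have [qX pX] := polish_dist_normed sepX.
have r3 : (0 < r / 3)%R by rewrite divr_gt0.
have eta2 : (0 < eta / 2)%R by rewrite divr_gt0.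
have [Ke cKe /ltW hKe] := tK _ eta2.
have [n hn] := compact_fdist_lt pX cKe r3.
have [N hN] := probability_fdist pO pi r3 eta2.
have [k hk] := choice (fun ij : nat * nat =>
  pd_dense pD (qO ij.1, qX ij.2) r3).
(* Finitely many pairs of centres occur, so their approximants in [q] have bounded indices. *)
pose M := (\max_(i < N.+1) \max_(j < n.+1) k (i : nat, j : nat))%N.
exists M => mu Kmu.
pose A : set (borel Om) := [set w | r / 3 <= fdist (@mdist R Om) qO N w]%R.
have mA : measurable A by exact: measurable_ge (measurable_fdist pO N).
have mB : measurable (setT `*` ~` Ke : set (borel (Om * X)%type)).
  apply: measurable_borel_setX => //; apply: measurableC.
  by apply: measurable_borel_closed; apply: compact_closed => //; exact: metric_hausdorff.
have mA' : measurable (fst @^-1` A : set (borel (Om * X)%type)).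
  by rewrite -[X in measurable X]setTI; exact: measurable_borel_fst.
have mF : measurable ([set z | r <= fd M z]%R : set (borel (Om * X)%type)).
  exact: measurable_ge (measurable_fdist pD M).
have muA : mu (fst @^-1` A) <= (eta / 2)%:E.
  by have [fm _] := KP _ Kmu; apply: le_trans hN; rewrite (fm _ mA).
have muB : mu (setT `*` ~` Ke) <= (eta / 2)%:E.
  by move/le_sup_ge0 : hKe; apply => //; rewrite lee_fin ltW.
apply: (@le_trans _ _ (mu (fst @^-1` A `|` setT `*` ~` Ke))).
  apply: le_measure; rewrite ?inE//; first exact: measurableU.
  move=> [w x] /= h; apply: contrapT => /not_orP[wA xK].
  have /fdist_ltP[i iN wi] : (fdist (@mdist R Om) qO N w < r / 3)%R.
    by rewrite ltNge; apply/negP.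
  have {}xK : Ke x by apply: contrapT => xK'; apply: xK; split.
  have /fdist_ltP[j jn xj] := hn _ xK.
  have kM : (k (i, j) <= M)%N.
    rewrite -ltnS in iN; rewrite -ltnS in jn.
    apply: leq_trans (leq_bigmax (Ordinal iN)).
    exact: (leq_bigmax (Ordinal jn)).
  have := fdist_le (D := sum_dist) (q := q) (w, x) kM.
  have := pd_tri pD (qO i, qX j) (w, x) (q (k (i, j))).
  have : (sum_dist (w, x) (qO i, qX j) = mdist w (qO i) + `|x - qX j|)%R by [].
  by have /= := hk (i, j); move: h wi xj => /=; lra.
rewrite (splitr eta) EFinD; apply: le_trans (leeD muA muB).
exact: measureU2.
Qed.

Lemma Np_tail_le mu (f : borel (Om * X)%type -> measurableTypeR R) (s : R) :
  measurable_fun setT f -> (forall z, 0 <= f z <= 1)%R -> (0 <= s)%R ->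
  \int[mu]_z (f z `^ p)%:E <= (s `^ p)%:E + mu [set z | s <= f z]%R.
Proof.
move=> mf f01 s0; have mS := measurable_ge s mf.
apply: (@le_trans _ _ (\int[mu]_z ((s `^ p)%:E + (\1_[set z | s <= f z]%R z)%:E))).
  apply: ge0_le_integral => //.
  - by move=> z _; rewrite lee_fin powR_ge0.
  - exact: measurable_powR_EFin.
  - apply: emeasurable_funD => //; apply/measurable_EFinP.
    exact: measurable_indic.
  move=> z _; rewrite -EFinD lee_fin indicE; have /andP[f0 fz1] := f01 z.
  have [sf|fs] := leP s (f z).
    rewrite mem_set//; apply: (@le_trans _ _ 1%R); last by rewrite lerDr powR_ge0.
    by have := ler_powRl (ltW p0) f0 fz1; rewrite powR1.
  rewrite memNset ?addr0; last by move=> /=; rewrite leNgt fs.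
  by apply: ler_powRl => //; exact: ltW.
rewrite ge0_integralD//.
- rewrite integral_cst// integral_indic// setIT.
  apply: leeD2r; rewrite -[leRHS]mule1; apply: lee_wpmul2l.
    by rewrite lee_fin powR_ge0.
  exact: probability_le1.
- by move=> z _; rewrite lee_fin powR_ge0.
- by apply/measurable_EFinP; exact: measurable_indic.
Qed.

(** This form of tightness passes to the closure of [K], by [closure_Np_le]; [Np_tight] then
    converts it back. Half of e^p pays for values below [s], half for the mass above [s]. *)
Lemma fibrely_tight_Np pi (K : set (probability (borel (Om * X)%type) R)) (e : R) :
  K `<=` Ppi_p pi p -> fibrely_tight K -> (0 < e)%R ->
  exists n, forall mu, K mu -> Np p mu (trunc_sum_dist n) <= e%:E.
Proof.
move=> KP tK e0.
have e2 : (0 < e `^ p / 2)%R by rewrite divr_gt0// powR_gt0.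
pose s := ((e `^ p / 2) `^ p^-1)%R.
have s0 : (0 < s)%R by exact: powR_gt0.
have sE : (s `^ p = e `^ p / 2)%R.
  by rewrite /s -powRrM mulVf ?gt_eqF// powRr1// ltW.
have [n hn] := fibrely_tight_fdist KP tK s0 e2.
exists n => mu Kmu; apply/(Np_le p1); first exact: ltW.
have mf := measurable_lipschitz1 sepOm sepX p1 (trunc_sum_dist_lipschitz1 n).
apply: le_trans (Np_tail_le _ mf _ (ltW s0)) _.
  by move=> z; rewrite trunc_sum_dist_ge0/= ge_min lexx.
rewrite sE [X in _ <= X%:E](splitr (e `^ p)) EFinD; apply: leeD2l.
apply: le_trans (hn _ Kmu); apply: le_measure; rewrite ?inE.
- exact: measurable_ge mf.
- exact: measurable_ge (measurable_fdist pD n).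
move=> z /=; rewrite le_min => /andP[_]; have := fdist_ge0 pD n z.
by move: s0; lra.
Qed.

Lemma Np_tight pi (C : set (Ppi_p_space X pi p)) :
  (forall e : R, (0 < e)%R -> exists n,
    forall a, C a -> Np p (\val a) (trunc_sum_dist n) <= e%:E) ->
  forall r eta : R, (0 < r)%R -> (0 < eta)%R -> exists n,
    forall a, C a -> \val a [set z | r <= fd n z]%R <= eta%:E.
Proof.
move=> hC r eta r0 eta0.
(* Where [fd n] is at least [r], the truncated and halved distance is at least this level. *)
pose s := (Num.min 1 (r / 2))%R.
have s0 : (0 < s)%R by rewrite lt_min ltr01 divr_gt0.
have [n hn] := hC _ (mulr_gt0 s0 (powR_gt0 p^-1 eta0)).
exists n => a /hn h.
have mf := measurable_lipschitz1 sepOm sepX p1 (trunc_sum_dist_lipschitz1 n).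
have := Np_markov p1 (\val a) mf (trunc_sum_dist_ge0 n) s0.
have {}h := lee_poweRl (ltW p0) (Np_ge0 p (\val a) (trunc_sum_dist n)) h.
move=> /le_trans/(_ h).
rewrite poweR_EFin powRM ?powR_ge0 ?(ltW s0)// -powRrM mulVf ?gt_eqF//.
rewrite powRr1 ?(ltW eta0)// EFinM lee_pmul2l// ?lte_fin ?powR_gt0//.
apply: le_trans; apply: le_measure; rewrite ?inE.
- exact: measurable_ge (measurable_fdist pD n).
- exact: measurable_ge mf.
move=> z /= h'; rewrite le_min ge_min lexx/= ge_min; apply/orP; right.
by move: h'; lra.
Qed.

End tightness_transfer.

(** * Limits along ultrafilters *)

Lemma ultra_cvg_segment (R : realType) (I : Type) (F : set_system I)
    (f : I -> R) (a b : R) : UltraFilter F -> (forall i, a <= f i <= b) ->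
  exists l : R, f i @[i --> F] --> l.
Proof.
move=> UF fab; have [|l [_ clf]] := @segment_compact R a b (f i @[i --> F]) _.
  by apply: (@filterS _ F _ setT) => [i _|]; [rewrite /= in_itv/=|exact: filterT].
exists l => U /nbhs_interior nU.
have [//|FnU] := in_ultra_setVsetC (f @^-1` U) UF.
have [x [nUx Ux]] := clf (~` U) U FnU (filterS (@interior_subset _ _) nU).
by case: (nUx Ux).
Qed.

(** A diagonal choice: the j-th index brings the coordinates of code less than [j] within 2^-j of
    their limits, finitely many conditions that a filter can meet together. It gives access to
    theorems on sequences. *)
Lemma filter_pick_seq (R : realType) (I : Type) (F : set_system I)
    (A : countType) (f : A -> I -> R) (l : A -> R) (S : set I) :
  ProperFilter F -> (forall r, f r i @[i --> F] --> l r) -> F S ->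
  exists2 a : nat -> I, (forall j, S (a j)) &
    forall r, f r (a j) @[j --> \oo] --> l r.
Proof.
move=> FF fl FS.
pose good j i := S i /\ forall k : 'I_j,
  if unpickle k is Some r then `|l r - f r i| < 2^-1 ^+ j else true.
have [j|a ha] := choice (_ : forall j, exists i, good j i).
  apply: (@filter_ex _ F); apply: filterI => //.
  apply: filter_forall => k; case: (unpickle k) => [r|]; last exact: nearW.
  by have /cvgrPdist_lt := fl r; apply; exact: expr_half_gt0.
exists a => [j|r]; first by have [] := ha j.
apply/cvgrPdist_lt => e e0; have [N _ hN] := expr_half_lt 1 e0.
(* From rank [(pickle r).+1] on, [r] is among the controlled coordinates. *)
exists (maxn N (pickle r).+1) => // j /=; rewrite geq_max => /andP[Nj rj].
have [_ /(_ (Ordinal rj))/=] := ha j; rewrite pickleK => /lt_le_trans; apply.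
by have := hN _ Nj; rewrite /= mul1r => /ltW.
Qed.

Section limit_mass.
Context {R : realType} {T : ptopologicalType} {D : T -> T -> R} {q : nat -> T}.
Hypothesis pD : polish_dist D q.
Local Notation cm := (cell_mass pD).

Lemma cell_mass_ge0 nu r : 0 <= cm nu r.
Proof. by have [_ + _] := mass_cell_mass pD nu; apply. Qed.

Lemma cell_mass_le1 nu r : cm nu r <= 1.
Proof.
rewrite -lee_fin cell_massE; apply: probability_le1; exact: measurable_cell.
Qed.

Lemma series_cell_mass_le nu r n :
  series (fun i => cm nu (i :: r)) n <= cm nu r.
Proof.
have [_ m0 ms] := mass_cell_mass pD nu.
have /cvg_lim <- // := ms r; apply: nondecreasing_cvgn_le.
  by apply: nondecreasing_series => *; exact: m0.
by apply/cvg_ex; exists (cm nu r); exact: ms.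
Qed.

(** A point of the cell within 2^-(size r) of some q i with i <= M has its next letter at most [i],
    by minimality of [kappa], hence lies in one of the first [n] children. *)
Lemma cell_mass_tail (nu : probability (borel T) R) r M n : (M < n)%N ->
  (nu (cell pD r) <= (series (fun i => cm nu (i :: r)) n)%:E +
   nu [set z | 2^-1 ^+ size r <= fdist D q M z]%R)%E.
Proof.
move=> Mn.
have mF : measurable ([set z | 2^-1 ^+ size r <= fdist D q M z]%R : set (borel T)).
  exact: measurable_ge (measurable_fdist pD M).
have mU : measurable (\big[setU/set0]_(i < n) cell pD ((i : nat) :: r) : set (borel T)).
  by apply: bigsetU_measurable => i _; exact: measurable_cell.
apply: (@le_trans _ _ (nu (\big[setU/set0]_(i < n) cell pD ((i : nat) :: r)
    `|` [set z | 2^-1 ^+ size r <= fdist D q M z]%R))).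
  apply: le_measure; rewrite ?inE//; [exact: measurable_cell|exact: measurableU|].
  move=> z zr; have [h|h] := leP (2^-1 ^+ size r) (fdist D q M z); first by right.
  left; rewrite -(bigcup_mkord n (fun i => cell pD (i :: r))); have [i iM zi] := fdist_ltP h.
  exists (kappa pD (size r) z) => /=.
    by apply: leq_ltn_trans (kappa_le pD zi) (leq_ltn_trans iM Mn).
  by rewrite /cell/cylinder/= zr.
apply: le_trans (measureU2 _ mU mF) _; apply: leeD2r.
rewrite seriesEnat -sumEFin big_mkord.
under [leRHS]eq_bigr do rewrite cell_massE.
apply: (@content_subadditive _ _ _ nu _ (fun i => cell pD (i :: r))) => //.
by move=> i _; exact: measurable_cell.
Qed.

(** The limits exist by compactness of [0, 1]. Tightness keeps mass from escaping to children of
    large index, so that the limits are still countably additive over the children. *)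
Lemma ultra_mass (I : topologicalType) (F : set_system I)
    (nu : I -> probability (borel T) R) : UltraFilter F ->
  (forall r eta : R, 0 < r -> 0 < eta -> exists n,
    \forall i \near F, (nu i [set z | r <= fdist D q n z]%R <= eta%:E)%E) ->
  exists2 m, mass m & forall r, cm (nu i) r @[i --> F] --> m r.
Proof.
move=> UF tight.
have [r|m hm] := choice (_ : forall r, exists l : R, cm (nu i) r @[i --> F] --> l).
  apply: (ultra_cvg_segment (a := 0) (b := 1)) => i.
  by rewrite cell_mass_ge0 cell_mass_le1.
exists m => //; split.
- apply: (@cvg_unique _ _ (cm (nu i) [::] @[i --> F]) _ _ _ (hm [::])) => //.
  rewrite (_ : (fun i => _) = cst 1); first exact: cvg_cst.
  by apply/funext => i; have [] := mass_cell_mass pD (nu i).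
- move=> r; apply: (ler_cvg_to (cvg_cst 0) (hm r)).
  by apply: nearW => i; exact: cell_mass_ge0.
move=> r.
have sF n : series (fun i => cm (nu a) (i :: r)) n @[a --> F] -->
    series (fun i => m (i :: r)) n.
  have s0 (f : nat -> R) : series f 0%N = 0 by rewrite seriesEnat/= big_geq.
  elim: n => [|n IH]; first by rewrite s0; under eq_fun do rewrite s0; exact: cvg_cst.
  by rewrite seriesSr; under eq_fun do rewrite seriesSr; exact: cvgD.
apply/cvgrPdist_le => e e0.
have [M hM] := tight _ _ (expr_half_gt0 (size r)) e0.
exists M.+1 => // n /= Mn; rewrite ger0_norm.
  rewrite lerBlDr addrC; apply: (ler_cvg_to (hm r) (cvgD (sF n) (cvg_cst e))).
  apply: filterS hM => a ha /=; rewrite -lee_fin cell_massE EFinD.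
  by apply: le_trans (cell_mass_tail _ _ Mn) _; exact: leeD2l.
rewrite subr_ge0; apply: (ler_cvg_to (sF n) (hm r)).
by apply: nearW => a; exact: series_cell_mass_le.
Qed.

End limit_mass.

(** A closed set is a decreasing limit of open neighbourhoods, so the inequality extends to closed
    sets; complements reverse it on open sets, which form a generating pi-system. *)
Lemma measure_eq_le_open (R : realType) (T : ptopologicalType) (D : T -> T -> R)
    (q : nat -> T) (mu nu : probability (borel T) R) : polish_dist D q ->
  (forall U : set T, open U -> (mu U <= nu U)%E) ->
  forall A : set (borel T), measurable A -> mu A = nu A.
Proof.
move=> pD le_open.
have mo (U : set T) : open U -> measurable (U : set (borel T)).
  exact: measurable_borel.
have le_closed (B : set T) : closed B -> (mu B <= nu B)%E.
  move=> clB; pose V k : set (borel T) :=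
    \bigcup_(x in B) [set y | D x y < 2^-1 ^+ k].
  have oV k : open (V k : set T).
    by apply: bigcup_open => x _; exact: (pd_open_ball pD).
  have VB : \bigcap_k V k = B.
    apply/seteqP; split => [z Vz|z Bz k _]; last first.
      by exists z => //=; rewrite (pd_refl pD) expr_half_gt0.
    apply: contrapT => nBz.
    have /(pd_nbhs pD)[e e0 eB] : nbhs z (~` B).
      by apply: open_nbhs_nbhs; split => //; exact: closed_openC.
    have [k _ /(_ k (leqnn _))/= hk] := expr_half_lt 1 e0.
    have [x Bx xz] := Vz k I.
    by apply: (eB x) => //=; rewrite (pd_sym pD); move: xz hk => /=; lra.
  have cvgV (P : probability (borel T) R) : P (V k) @[k --> \oo] --> P B.
    rewrite -VB; apply: nonincreasing_cvg_mu => [|k||k l kl].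
    - by rewrite (le_lt_trans (probability_le1 _ (mo _ (oV 0%N))))// ltry.
    - exact: mo.
    - by apply: bigcapT_measurable => k; exact: mo.
    apply/subsetPset => y [x Bx /= xy]; exists x => //=.
    apply: lt_le_trans xy _; apply: ler_wiXn2l => //; rewrite ?invr_ge0//.
    by rewrite invf_le1// ler1n.
  have /cvg_lim <- // := cvgV mu; have /cvg_lim <- // := cvgV nu.
  apply: lee_lim; [exact: cvgP (cvgV mu)|exact: cvgP (cvgV nu)|].
  by apply: nearW => k; exact: le_open.
have eq_open (U : set T) : open U -> mu U = nu U.
  move=> oU; apply/eqP; rewrite eq_le le_open//=.
  have := le_closed _ (open_closedC oU).
  rewrite !probability_setC; [|exact: mo..].
  have fin (P : probability (borel T) R) : P U \is a fin_num := fin_num_measure P _ (mo _ oU).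
  by rewrite -(fineK (fin mu)) -(fineK (fin nu)) -!EFinB !lee_fin lerD2l lerN2.
move=> A mA; apply: (@measure_unique _ R (borel T) open (fun=> setT)) => //.
- by move=> U V; exact: openI.
- by move=> _; exact: openT.
- exact: bigcup_const.
- by move=> _; apply: le_lt_trans (probability_le1 mu _) _; rewrite ?ltry.
Qed.

(** * Almost sure representation and lower semicontinuity *)

Section limit_law.
Context {R : realType}.
Local Open Scope ereal_scope.

(** Only asymptotic lower bounds are required, as these are what indicators of open sets satisfy
    along convergent points. *)
Lemma fatou_ae d (S : measurableType d) (P : {measure set S -> \bar R})
    (f_ : nat -> S -> measurableTypeR R) (f : S -> measurableTypeR R) (c : \bar R) :
  (forall n, measurable_fun setT (f_ n)) -> measurable_fun setT f ->
  (forall n t, 0 <= f_ n t)%R -> (forall t, 0 <= f t)%R ->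
  {ae P, forall t, forall e : R, (0 < e)%R -> \forall n \near \oo, (f t - e <= f_ n t)%R} ->
  (forall n, \int[P]_t (f_ n t)%:E <= c) -> \int[P]_t (f t)%:E <= c.
Proof.
move=> mf_ mf f_0 f0 fae hc.
have mf_E n : measurable_fun setT (fun t => (f_ n t)%:E) by apply/measurable_EFinP; exact: mf_.
have f_E0 n t : setT t -> 0 <= (f_ n t)%:E by rewrite lee_fin.
apply: (@le_trans _ _ (\int[P]_t limn_einf (fun n => (f_ n t)%:E))).
  apply: ae_ge0_le_integral => //.
  - by move=> t _; rewrite lee_fin.
  - by apply/measurable_EFinP; exact: mf.
  - move=> t _; rewrite limn_einf_lim; apply: lime_ge; first exact: is_cvg_einfs.
    by apply: nearW => n; apply: le_ereal_inf_tmp => _ [k _ <-]; rewrite lee_fin.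
  - apply: (measurableT_comp (@oppe_measurable R setT)).
    apply: measurable_fun_limn_esup => n.
    exact: (measurableT_comp (@oppe_measurable R setT) (mf_E n)).
  apply: filterS fae => t ft _; apply/lee_addgt0Pr => e e0.
  rewrite -leeBlDr// limn_einf_lim -EFinB.
  apply: lime_ge; first exact: is_cvg_einfs.
  have [N _ hN] := ft _ e0; exists N => // n /= Nn.
  apply: le_ereal_inf_tmp => _ [k /= nk <-]; rewrite lee_fin; apply: hN.
  exact: leq_trans nk.
apply: le_trans (fatou _ measurableT mf_E f_E0) _.
rewrite limn_einf_lim; apply: lime_le; first exact: is_cvg_einfs.
by apply: nearW => n; apply: (le_trans _ (hc n)); apply: ereal_inf_lbound; exists n => /=.
Qed.

Section Np_scale.
Variable p : R.
Hypothesis p1 : (1 <= p)%R.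

Let p0 : (0 < p)%R. Proof. exact: lt_le_trans p1. Qed.

Lemma Np_scale d (S : measurableType d) (P : {measure set S -> \bar R})
    (f : S -> measurableTypeR R) (b c : R) :
  measurable_fun setT f -> (forall t, 0 <= f t)%R -> (0 <= b)%R -> (0 <= c)%R ->
  Np p P f <= c%:E -> Np p P (fun t => b * f t)%R <= (b * c)%:E.
Proof.
move=> mf f0 b0 c0 /(Np_le p1 _ _ c0) h; apply/(Np_le p1); first exact: mulr_ge0.
under eq_integral do rewrite powRM// EFinM.
rewrite ge0_integralZl_EFin ?powR_ge0//; last 2 first.
- by move=> t _; rewrite lee_fin powR_ge0.
- exact: measurable_powR_EFin.
by rewrite powRM// EFinM; apply: lee_wpmul2l => //; rewrite lee_fin powR_ge0.
Qed.

Lemma Np_cst_le d (S : measurableType d) (P : probability S R) (c : R) :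
  (0 <= c)%R -> Np p P (cst c) <= c%:E.
Proof.
move=> c0; apply/(Np_le p1) => //.
rewrite (integral_cst P measurableT (c `^ p)%:E) -[leRHS]mule1; apply: lee_wpmul2l.
  by rewrite lee_fin powR_ge0.
exact: probability_le1.
Qed.

End Np_scale.

Section skorokhod.
Context {T : ptopologicalType} {D : T -> T -> R} {q : nat -> T}.
Hypothesis pD : polish_dist D q.

(** Off the null set of [code_cvg], the first k + 1 letters eventually agree, and [decode_prefix]
    bounds the distance by 12 * 2^-k. *)
Lemma skorokhod_cvg (nu_ : nat -> probability (borel T) R) m : mass m ->
  (forall r, cell_mass pD (nu_ n) r @[n --> \oo] --> m r) ->
  {ae (@unif R), forall t,
    D (decode D q (code m t)) (decode D q (code (cell_mass pD (nu_ n)) t))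
      @[n --> \oo] --> 0%R}.
Proof.
move=> mm mcvg.
have [E [mE E0] hE] := code_cvg (fun n => mass_cell_mass pD (nu_ n)) mm mcvg.
exists E; split => // t /= ht; apply: contrapT => Et; apply: ht.
apply/cvgrPdist_lt => e e0.
have [k _ /(_ k (leqnn _))/= hk] := expr_half_lt 12%R e0.
apply: filterS (hE t Et k.+1) => n hn; rewrite sub0r normrN ger0_norm ?(pd_ge0 pD)//.
by apply: le_lt_trans hk; apply: (decode_prefix pD); rewrite hn.
Qed.

Lemma measurable_decode_code m : mass m -> measurable_fun setT
  ((decode D q \o code m) : measurableTypeR R -> borel T).
Proof.
by move=> mm; apply: measurableT_comp (measurable_code mm); exact: measurable_decode.
Qed.

End skorokhod.

End limit_law.

Lemma powR_lower (R : realType) (p a : R) (u : nat -> R) : 0 < p -> 0 <= a ->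
  u n @[n --> \oo] --> a ->
  forall e, 0 < e -> \forall n \near \oo, a `^ p - e <= u n `^ p.
Proof.
(* At 0 the lower bound is trivial; elsewhere the power function is differentiable, hence
   continuous. *)
move=> p0; rewrite le_eqVlt => /predU1P[<- _ e e0|a0 ua e e0].
  apply: nearW => n; rewrite powR0 ?gt_eqF// sub0r.
  by apply: (@le_trans _ _ 0); [rewrite oppr_le0 ltW|exact: powR_ge0].
have ca : {for a, continuous (fun x : R => x `^ p)}.
  apply: differentiable_continuous; apply/derivable1_diffP.
  by apply: derivable_powR; rewrite in_itv/= andbT.
have := cvg_comp u (fun x : R => x `^ p) ua ca.
move=> /cvgrPdist_le/(_ _ e0); apply: filterS => n /=.
by rewrite ler_norml => /andP[_]; rewrite !lerBlDr addrC.
Qed.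

Section limit_open.
Context {R : realType} {T : ptopologicalType} {D : T -> T -> R} {q : nat -> T}.
Hypothesis pD : polish_dist D q.
Variables (nu_ : nat -> probability (borel T) R) (m : seq nat -> R).
Hypotheses (mm : mass m)
  (mcvg : forall r, cell_mass pD (nu_ n) r @[n --> \oo] --> m r).
Variable mu : probability (borel T) R.
Hypothesis muE : forall A, mu A = unif ((decode D q \o code m) @^-1` A).
Local Open Scope ereal_scope.

(** The open half of the portmanteau theorem: if the limit point lies in [U], so do the
    approximating points eventually, and Fatou's lemma applies to the indicators. *)
Lemma limit_open_le (U : set T) c : open U -> (forall n, nu_ n U <= c) ->
  mu U <= c.
Proof.
move=> oU hc.
have mU : measurable (U : set (borel T)) by exact: measurable_borel.
pose Y := decode D q \o code m.
pose Y_ n := decode D q \o code (cell_mass pD (nu_ n)).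
have mY : measurable (Y @^-1` U : set (measurableTypeR R)).
  by rewrite -[X in measurable X]setTI; apply: (measurable_decode_code pD mm).
have mY_ n : measurable (Y_ n @^-1` U : set (measurableTypeR R)).
  rewrite -[X in measurable X]setTI.
  exact: (measurable_decode_code pD (mass_cell_mass pD (nu_ n))).
rewrite muE -/Y -(setIT (Y @^-1` U)) -integral_indic//.
apply: (@fatou_ae R _ (measurableTypeR R) unif (fun n => \1_(Y_ n @^-1` U)) (\1_(Y @^-1` U)) c).
- by move=> n; exact: measurable_indic.
- exact: measurable_indic.
- by move=> n t; rewrite indicE ler0n.
- by move=> t; rewrite indicE ler0n.
- have := skorokhod_cvg mm mcvg; apply: (@filterS _ _ (ae_filter_ringOfSetsType unif)) => t ht e e0.
  have [Ut|Ut] := pselect (U (Y t)); last first.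
    apply: nearW => n; rewrite !indicE memNset// sub0r.
    by apply: (@le_trans _ _ 0%R); rewrite ?ler0n// oppr_le0 ltW.
  have [d d0 dU] := pd_ballP pD oU Ut.
  move/cvgrPdist_lt : ht => /(_ _ d0); apply: filterS => n.
  rewrite sub0r normrN ger0_norm ?(pd_ge0 pD)// => /dU Un.
  by rewrite !indicE mem_set// mem_set// lerBlDr lerDl ltW.
- move=> n; rewrite integral_indic// setIT.
  by apply: le_trans (hc n); rewrite (decode_code_law pD (nu_ n) mU).
Qed.

End limit_open.

Lemma Np_lty_moment (R : realType) d (S : measurableType d)
    (P : {measure set S -> \bar R}) (p c : R) (f : S -> R) : 1 <= p ->
  0 <= c -> (Np p P f <= c%:E)%E -> (\int[P]_z (f z `^ p)%:E < +oo)%E.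
Proof. by move=> p1 c0 /(Np_le p1 _ _ c0)/le_lt_trans; apply; rewrite ltry. Qed.

(** * The limit law on the product and convergence to it for [Wp] *)

Section fibred_limit.
Context {R : realType} {Om : completeMetricType R}
  {X : completeNormedModType R}.
Variables (sepOm : separable Om) (sepX : separable X).
Variable p : R.
Hypothesis p1 : 1 <= p.
Variables (q : nat -> Om * X) (pD : polish_dist sum_dist q).
Variables (a_ : nat -> probability (borel (Om * X)%type) R) (m : seq nat -> R).
Hypotheses (mm : mass m)
  (mcvg : forall r, cell_mass pD (a_ n) r @[n --> \oo] --> m r).
Variable mu : probability (borel (Om * X)%type) R.
Hypothesis muE : forall A, mu A = unif ((decode sum_dist q \o code m) @^-1` A).
Variable pi : probability (borel Om) R.
Local Open Scope ereal_scope.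

Let p0 : (0 < p)%R. Proof. exact: lt_le_trans p1. Qed.

Let Y : measurableTypeR R -> borel (Om * X)%type := decode sum_dist q \o code m.
Let Y_ n : measurableTypeR R -> borel (Om * X)%type :=
  decode sum_dist q \o code (cell_mass pD (a_ n)).

Let mY : measurable_fun setT Y.
Proof. exact (measurable_decode_code pD mm). Qed.

Let mY_ n : measurable_fun setT (Y_ n).
Proof. exact (measurable_decode_code pD (mass_cell_mass pD (a_ n))). Qed.

Let a_E n A : measurable A -> a_ n A = unif (Y_ n @^-1` A).
Proof. exact: decode_code_law. Qed.

Let prod_dist_cvg0 :
  {ae (@unif R), forall t, prod_dist p (Y t) (Y_ n t) @[n --> \oo] --> 0%R}.
Proof.
have := skorokhod_cvg mm mcvg; apply: (@filterS _ _ (ae_filter_ringOfSetsType unif)) => t /cvgrPdist_lt ht.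
apply/cvgrPdist_lt => e e0; apply: filterS (ht _ (divr_gt0 e0 (ltr0n _ 2))) => n.
rewrite !sub0r !normrN !ger0_norm ?prod_dist_ge0 ?(pd_ge0 pD)// => h.
apply: le_lt_trans (prod_dist_sum p1 _ _) _.
by move: h; rewrite ltr_pdivlMr// mulrC.
Qed.

Lemma limit_Np_le g (c : R) : lipschitz1 p g -> (0 <= c)%R ->
  (forall n, Np p (a_ n) g <= c%:E) -> Np p mu g <= c%:E.
Proof.
move=> gL c0 hc.
have mg := measurable_lipschitz1 sepOm sepX p1 gL.
have [g0 gl] := gL.
rewrite (Np_law p mY (fun A _ => muE A) mg); apply/(Np_le p1) => //.
apply: (@fatou_ae _ _ _ _ (fun n t => g (Y_ n t) `^ p)%R).
- move=> n; apply: (measurableT_comp (measurable_powR p)).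
  exact: measurableT_comp mg (mY_ n).
- by apply: (measurableT_comp (measurable_powR p)); exact: measurableT_comp mg mY.
- by move=> n t; exact: powR_ge0.
- by move=> t; exact: powR_ge0.
- have := prod_dist_cvg0; apply: (@filterS _ _ (ae_filter_ringOfSetsType unif)) => t /cvgrPdist_lt ht.
  apply: (@powR_lower _ p (g (Y t)) (fun n => g (Y_ n t)) p0 (g0 _)).
  apply/cvgrPdist_lt => e e0.
  apply: filterS (ht _ e0) => n; rewrite sub0r normrN ger0_norm ?prod_dist_ge0//.
  exact: le_lt_trans.
move=> n; have := hc n; rewrite (Np_law p (mY_ n) (a_E n) mg).
by move=> /(Np_le p1 _ _ c0).
Qed.

(** The first marginals all equal [pi], so [limit_open_le] bounds that of [mu] by [pi] on open sets,
    which forces equality. *)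
Lemma limit_first_marginal : (forall n, first_marginal pi (a_ n)) ->
  first_marginal pi mu.
Proof.
move=> hpi A mA; have [qO pO] := polish_dist_metric sepOm.
have [nu nuE] := law_exists mu (@measurable_borel_fst Om X).
rewrite -nuE; apply: (measure_eq_le_open pO) => // U oU.
rewrite nuE; apply: (limit_open_le mm mcvg muE) => [|n].
  by apply: open_comp => // -[w x] _; exact: cvg_fst.
by rewrite hpi//; exact: measurable_borel.
Qed.

Lemma limit_Ppi w0 (k c : R) : first_marginal pi mu -> (0 <= k)%R -> (0 <= c)%R ->
  Np p mu (excess w0 k) <= c%:E -> Ppi_p pi p mu.
Proof.
move=> fm k0 c0 hc; split => //.
rewrite (integral_moment_disintegration sepOm sepX p1 fm)// preimage_setT.
apply: (@Np_lty_moment _ _ _ _ _ (k + c)%R) => //; first exact: addr_ge0.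
rewrite EFinD; apply: le_trans (leeD (Np_cst_le p1 mu k0) hc).
apply: Np_minkowski => //.
- exact: measurable_lipschitz1 (excess_lipschitz1 p1 w0 _).
- exact: measurable_snd_norm.
- by move=> z; exact: excess_ge0.
move=> z; have h1 : (`|z.2| <= far w0 z)%R by rewrite le_max lexx orbT.
have h2 : (far w0 z - k <= excess w0 k z)%R by rewrite le_max lexx orbT.
by rewrite /cst; lra.
Qed.

(** The joint law of [Y] and [Y_ n] under [unif] is a coupling. *)
Lemma Wp_le_law n : Wp p mu (a_ n) <= Np p unif (fun t => prod_dist p (Y t) (Y_ n t)).
Proof.
have mYY := measurable_borel_pair pD pD mY (mY_ n).
have [gam gamE] := law_exists unif mYY.
have := Np_law p mYY (fun A _ => gamE A) (measurable_prod_dist sepOm sepX p).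
rewrite /comp/= => <-; rewrite /Wp /wasserstein /Np.
apply: (lee_poweRl _ _); first by rewrite invr_ge0 ltW.
  apply: le_ereal_inf_tmp => _ [g _ <-].
  by apply: integral_ge0 => z _; rewrite lee_fin powR_ge0.
apply: ereal_inf_lbound; exists gam => // A mA; split.
  by rewrite gamE muE.
by rewrite gamE a_E.
Qed.

(** The distance is at most its truncation at 8k plus 4 times the excesses of both points. The
    truncated part tends to 0 by dominated convergence; the excesses are uniformly small. A single
    good index suffices against an ultrafilter. *)
Lemma limit_Wp w0 : (forall e : R, (0 < e)%R -> exists2 k : R, (0 <= k)%R &
    forall n, Np p (a_ n) (excess w0 k) <= e%:E) ->
  forall e : R, (0 < e)%R -> exists n, Wp p mu (a_ n) < e%:E.
Proof.
(* The two excess terms cost 2 * 4 * e / 16 = e / 2 and the truncated part e / 4, which together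
   stay below [e]. *)
move=> hex e e0; have e16 : (0 < e / 16)%R by rewrite divr_gt0.
have [k k0 hk] := hex _ e16.
have exL : lipschitz1 p (excess w0 k : Om * X -> R) by exact: excess_lipschitz1.
have mex := measurable_lipschitz1 sepOm sepX p1 exL.
have hmu : Np p mu (excess w0 k) <= (e / 16)%:E.
  exact: limit_Np_le exL (ltW e16) hk.
have mB n : measurable_fun setT
    ((fun t => prod_dist p (Y t) (Y_ n t)) : measurableTypeR R -> measurableTypeR R).
  exact: measurableT_comp (measurable_prod_dist sepOm sepX p)
    (measurable_borel_pair pD pD mY (mY_ n)).
(* The level 8k is twice the sum of four terms, the distances to [w0] and the norms of both points,
   each at most [k] plus an excess; the factor 2 is that of [prod_dist_sum]. *)
pose H n t : R := Num.min (prod_dist p (Y t) (Y_ n t)) (8 * k)%R.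
have mH n : measurable_fun setT (H n : measurableTypeR R -> measurableTypeR R).
  by apply: measurable_minr => //; exact: mB.
have H0 n t : (0 <= H n t <= 8 * k)%R.
  by rewrite ge_min lexx orbT andbT le_min prod_dist_ge0/= mulr_ge0.
have [n hn] : exists n, Np p unif (H n) <= (e / 4)%:E.
  have e4 : (0 < e / 4)%R by rewrite divr_gt0.
  have : Np p unif (H n) @[n --> \oo] --> 0.
    apply: (@Np_dominated_cvg0 _ p p1 _ _ unif H (cst (8 * k)%R)).
    - exact: mH.
    - exact: measurable_cst.
    - exact: H0.
    - have := prod_dist_cvg0; apply: (@filterS _ _ (ae_filter_ringOfSetsType unif)) => t /cvgrPdist_lt ht.
      apply/cvgrPdist_lt => d d0; apply: filterS (ht _ d0) => n.
      rewrite !sub0r !normrN !ger0_norm ?prod_dist_ge0//; last by have /andP[] := H0 n t.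
      by move=> h; rewrite gt_min h.
    apply: (@Np_lty_moment _ _ _ _ _ (8 * k)%R) => //; first exact: mulr_ge0.
    by apply: Np_cst_le => //; exact: mulr_ge0.
  move=> /fine_cvgP[[N1 _ h1] /cvgrPdist_le/(_ _ e4)[N2 _ h2]].
  exists (maxn N1 N2); have := h2 _ (leq_maxr N1 N2).
  rewrite /= sub0r normrN -lee_fin => h'.
  rewrite -(fineK (h1 _ (leq_maxl N1 N2))).
  by apply: le_trans h'; rewrite lee_fin ler_norm.
exists n; apply: le_lt_trans (Wp_le_law n) _.
have mE1 : measurable_fun setT (fun t => 4 * excess w0 k (Y t))%R.
  by apply: measurable_funM => //; exact: measurableT_comp mex mY.
have mE2 : measurable_fun setT (fun t => 4 * excess w0 k (Y_ n t))%R.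
  by apply: measurable_funM => //; exact: measurableT_comp mex (mY_ n).
have E1 : Np p unif (fun t => 4 * excess w0 k (Y t))%R <= (4 * (e / 16))%:E.
  apply: (Np_scale p1) => //; [exact: measurableT_comp mex mY| |exact: ltW|].
    by move=> t; exact: excess_ge0.
  by move: hmu; rewrite (Np_law p mY (fun A _ => muE A) mex).
have E2 : Np p unif (fun t => 4 * excess w0 k (Y_ n t))%R <= (4 * (e / 16))%:E.
  apply: (Np_scale p1) => //; [exact: measurableT_comp mex (mY_ n)| |exact: ltW|].
    by move=> t; exact: excess_ge0.
  by move: (hk n); rewrite (Np_law p (mY_ n) (a_E n) mex).
pose E12 t : R := (4 * excess w0 k (Y t) + 4 * excess w0 k (Y_ n t))%R.
have E120 z : (0 <= 4 * excess w0 k z)%R by rewrite mulr_ge0// excess_ge0.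
have hE12 : Np p unif E12 <= (4 * (e / 16) + 4 * (e / 16))%:E.
  rewrite EFinD; apply: le_trans (leeD E1 E2).
  by apply: Np_minkowski => //; [exact: measurable_funD|move=> t; exact: addr_ge0].
apply: (@le_lt_trans _ _ ((e / 4)%:E + (4 * (e / 16) + 4 * (e / 16))%:E)); last first.
  by rewrite -EFinD lte_fin; lra.
apply: le_trans (leeD hn hE12).
apply: Np_minkowski => //.
- exact: measurable_funD.
- by move=> t; have /andP[] := H0 n t.
- by move=> t; exact: addr_ge0.
- by move=> t; exact: prod_dist_ge0.
move=> t; rewrite /H /E12; have [h|h] := leP (prod_dist p (Y t) (Y_ n t)) (8 * k)%R.
  by rewrite lerDl addr_ge0.
have h1 := prod_dist_sum p1 (Y t) (Y_ n t).
have h2 := metric_triangle (Y t).1 w0 (Y_ n t).1.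
have h3 := ler_normB (Y t).2 (Y_ n t).2.
have far1 (z : Om * X) : (mdist z.1 w0 <= k + excess w0 k z)%R.
  have : (far w0 z - k <= excess w0 k z)%R by rewrite le_max lexx orbT.
  have : (mdist z.1 w0 <= far w0 z)%R by rewrite le_max lexx.
  by lra.
have far2 (z : Om * X) : (`|z.2| <= k + excess w0 k z)%R.
  have : (far w0 z - k <= excess w0 k z)%R by rewrite le_max lexx orbT.
  have : (`|z.2| <= far w0 z)%R by rewrite le_max lexx orbT.
  by lra.
have := far1 (Y t); have := far1 (Y_ n t); have := far2 (Y t); have := far2 (Y_ n t).
move: h1 h2 h3; rewrite /sum_dist (metric_sym w0); lra.
Qed.

End fibred_limit.

(** * Compactness and the final equivalences *)

Section compactness.
Context {R : realType} {Om : completeMetricType R}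
  {X : completeNormedModType R}.
Variables (sepOm : separable Om) (sepX : separable X).
Variable p : R.
Hypothesis p1 : 1 <= p.
Variable pi : probability (borel Om) R.
Local Open Scope ereal_scope.

Lemma tight_compact (q : nat -> Om * X) (pD : polish_dist sum_dist q)
    (C : set (Ppi_p_space X pi p)) w0 : closed C ->
  (forall e : R, (0 < e)%R -> exists n,
    forall a, C a -> Np p (\val a) (trunc_sum_dist q n) <= e%:E) ->
  (forall e : R, (0 < e)%R -> exists2 k : R, (0 <= k)%R &
    forall a, C a -> Np p (\val a) (excess w0 k) <= e%:E) ->
  compact C.
Proof.
move=> clC hT hE; rewrite compact_ultra => F UF FC.
pose nu (a : Ppi_p_space X pi p) : probability (borel (Om * X)%type) R := \val a.
have [|m mm mF] := @ultra_mass _ _ _ _ pD _ F nu UF.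
  move=> r eta r0 eta0; have [n hn] := Np_tight sepOm sepX p1 pD hT r0 eta0.
  by exists n; apply: filterS FC => a /hn.
have [mu muE] := law_exists unif (measurable_decode_code pD mm).
have PF : ProperFilter F by exact: ultra_proper.
(* The sequence may vary with [S], but its limit masses are always [m], so that [mu] is the limit
   law in every use. *)
have near_C (S : set (Ppi_p_space X pi p)) : F S -> exists a : nat -> Ppi_p_space X pi p,
    [/\ forall j, C (a j), forall j, S (a j) &
        forall r, cell_mass pD (nu (a j)) r @[j --> \oo] --> m r].
  move=> FS; have [a aSC acvg] := filter_pick_seq PF mF (filterI FS FC).
  by exists a; split => // j; have [] := aSC j.
have Pmu : Ppi_p pi p mu.
  have [a [aC _ acvg]] := near_C _ filterT.
  have [k k0 hk] := hE _ ltr01.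
  apply: (limit_Ppi sepOm sepX p1 _ k0 ler01 (w0 := w0)).
    apply: (limit_first_marginal sepOm mm acvg muE) => j.
    by have [] := set_mem (valP (a j)).
  apply: (limit_Np_le sepOm sepX p1 mm acvg muE) => //.
    exact: excess_lipschitz1.
  by move=> j; exact: hk.
pose l : Ppi_p_space X pi p := exist _ mu (mem_set Pmu).
have Fl : F --> l.
  move=> U /nbhs_interior; rewrite nbhsE => -[V [oV Vl] VU].
  have [e e0 eV] := (open_Wp V).1 oV l Vl.
  pose B := [set b : Ppi_p_space X pi p | Wp p mu (nu b) < e%:E].
  suff FB : F B by apply: filterS FB => b /eV/VU; exact: interior_subset.
  (* If the ball were not in [F], a sequence picked in its complement would by [limit_Wp] have a
     term inside it. *)
  have [//|FnB] := in_ultra_setVsetC B UF.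
  have [a [aC anB acvg]] := near_C _ FnB; exfalso.
  have [n hn] : exists n, Wp p mu (nu (a n)) < e%:E.
    apply: (limit_Wp sepOm sepX p1 mm acvg muE (w0 := w0)) => // d d0.
    by have [k k0 hk] := hE d d0; exists k => // j; exact: hk.
  exact: (anB n).
exists l; split => //; apply: clC => U nU.
by apply: (@filter_ex _ F); apply: filterI => //; exact: Fl.
Qed.

End compactness.

Theorem proposition3p2 (R : realType) (Om : completeMetricType R)
    (X : completeNormedModType R) (sepOm : separable Om) (sepX : separable X)
    (p : R) (hp : 1 <= p) (pi : probability (borel Om) R)
    (hpi : finite_moment p pi)
    (K : set (probability (borel (Om * X)%type) R))
    (hK : K `<=` Ppi_p pi p) :
  (Wp_relatively_compact pi p K <->
     fibrely_tight K /\ exists w0 : Om, unif_integrable p K w0) /\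
  ((exists w0 : Om, unif_integrable p K w0) <->
     (forall w0 : Om, unif_integrable p K w0)) /\
  ((exists w0 : Om, unif_integrable p K w0) <->
     (exists w0 : Om, unif_integrable_split pi p K w0)) /\
  ((exists w0 : Om, unif_integrable_split pi p K w0) <->
     (forall w0 : Om, unif_integrable_split pi p K w0)).
Proof.
have splitE w := unif_integrable_splitE sepOm sepX hp w hK.
have change w w' : unif_integrable p K w -> unif_integrable p K w'.
  exact: unif_integrable_change.
have [w0 dfin] := hpi; split; last first.
  split; first by split=> [[w h] w'|h]; [exact: change h|exists w0].
  split; first by split=> -[w /splitE h]; exists w.
  split=> [[w /splitE h] w'|h]; last by exists w0.
  by apply/splitE; exact: change h.
(* Uniform integrability is moved to the base point at which the moment of [pi] is known to be
   finite. *)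
split=> [cK|[tK [w /(change w w0) ui]]].
  have KC mu : K mu -> exists2 a : Ppi_p_space X pi p,
      closure [set a : Ppi_p_space X pi p | K (\val a)] a & \val a = mu.
    move=> Kmu; exists (exist _ mu (mem_set (hK mu Kmu))) => //.
    exact: subset_closure.
  split; first exact: (compact_fibrely_tight sepOm sepX hp cK KC).
  by exists w0; exact: (compact_unif_integrable sepOm sepX hp cK KC dfin).
have [q pD] := @polish_dist_sum R Om X sepOm sepX.
apply: (@tight_compact _ _ _ sepOm sepX p hp pi q pD _ w0) => [|e e0|e e0].
- exact: closed_closure.
- have [n hn] := fibrely_tight_Np sepOm sepX hp pD hK tK e0.
  exists n; apply: (closure_Np_le sepOm sepX hp) => [|a /hn//].
  exact: trunc_sum_dist_lipschitz1.
have [k k0 hk] := unif_integrable_excess sepOm sepX hp hK dfin ui e0.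
exists k => //; apply: (closure_Np_le sepOm sepX hp) => [|a /hk//].
exact: excess_lipschitz1.
Qed.
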